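(* Let $-\tfrac12<\alpha<0$ and let $n\in\mathbb{N}$ with $n\ge2$. Suppose $h,g$ are analytic in $\mathbb{D}=\{|z|<1\}$ with $\operatorname{Re}\big(1+\frac{zh''(z)}{h'(z)}\big)>\alpha$ for all $z\in\mathbb{D}$ and $g'(z)=z^nh'(z)$ for all $z\in\mathbb{D}$. Then $f=h+\overline{g}$ is close-to-convex in the disk $$|z|<\sqrt[n]{\frac{1+2\alpha}{1+2n+2\alpha}}.$$
   Context: A domain $\Omega$ is close-to-convex if $\mathbb{C}\setminus\Omega$ is a union of non-intersecting half-lines. A harmonic function is close-to-convex in a disk if it is injective there and maps that disk onto a close-to-convex domain. *)

(* Defs.v *)
From HB Require Import structures.
From mathcomp Require Import all_boot all_order all_algebra.
From mathcomp Require Import all_classical all_reals all_analysis.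
From mathcomp Require Import complex.
Set Implicit Arguments. Unset Strict Implicit. Unset Printing Implicit Defensive.
Import Order.TTheory GRing.Theory Num.Theory.
Import numFieldNormedType.Exports.
Local Open Scope classical_set_scope.
Local Open Scope ring_scope.
Local Open Scope complex_scope.

HB.instance Definition _ (R : rcfType) := NormedModule.copy R[i] (R[i])^o.

Definition cdisk (R : realType) (r : R) : set R[i] :=
  [set z : R[i] | `|z| < r%:C].

Definition analytic_on (R : realType) (D : set R[i]) (f : R[i] -> R[i]) :=
  forall z0, D z0 -> exists2 rho : R, 0 < rho &
    exists a : nat -> R[i], forall z, `|z - z0| < rho%:C ->
      series (fun k => a k * (z - z0) ^+ k) @ \oo --> f z.

Definition is_halfline (R : realType) (L : set R[i]) :=
  exists a d : R[i], d != 0 /\ L = [set a + t%:C * d | t in [set t : R | 0 <= t]].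

Definition close_to_convex_domain (R : realType) (O : set R[i]) :=
  [/\ open O, connected O &
    exists F : set (set R[i]),
      [/\ (forall L, F L -> is_halfline L),
          (forall L1 L2, F L1 -> F L2 -> L1 <> L2 -> L1 `&` L2 = set0) &
          ~` O = \bigcup_(L in F) L]].

Definition close_to_convex_on (R : realType) (D : set R[i]) (f : R[i] -> R[i]) :=
  set_inj D f /\ close_to_convex_domain (f @` D).

(* Main.v *)
(** Put z = r e^{it}, D(t) = d/dt f(z) = i (A - conj B) with A = z h'(z), B = z^n A.  For r^n the
    number in the statement, the argument T of D satisfies T' > -c for some c < 1/2, while T grows
    by 2 pi over a period, so T is increasing at every point of some levels phi and phi + pi
    (mod 2 pi): the levels spoiled by a point where T' <= 0 have total measure at most 2 pi c < pi
    modulo pi.  For d = e^{i phi} the function Im (conj d f) then increases on the arc from z1 to z2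
    and decreases on the complementary arc.  It is the imaginary part of the analytic function
    G = conj d h - d g, and the minimum principle gives
    Im ((z - z1) (z - z2) G'(z) / (z1 - z2)) > 0 in the disk.  In the upper half plane model with z1
    at 0 and z2 at infinity this says that Im (conj d f) increases along the rays from 0, so each of
    its level sets is a graph over the slope of the ray; as |g'| < |h'|, Re (conj d f) is monotone
    along it.  Hence f is injective, its image meets every line parallel to d in a segment, and the
    complement is filled by rays parallel to d and, beyond the two extreme lines, orthogonal to d. *)

Require Import Defs.
From HB Require Import structures.
From mathcomp Require Import all_boot all_order all_algebra.
From mathcomp Require Import all_classical all_reals all_analysis.
From mathcomp Require Import complex ring lra zify.
Set Implicit Arguments. Unset Strict Implicit. Unset Printing Implicit Defensive.
Import Order.TTheory GRing.Theory Num.Theory.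
Import numFieldNormedType.Exports.
Local Open Scope classical_set_scope.
Local Open Scope ring_scope.
Local Open Scope complex_scope.

Local Notation normc := Normc.normc.
Local Notation Re := complex.Re.
Local Notation Im := complex.Im.

(** * Modulus and complex derivatives *)

Section Modulus.
Context {R : realType}.
Implicit Types z w : R[i].

(** The constant c comes from the worst position on the circle, where A B is a negative real: there
    T' exceeds (alpha (1 - k) - n k) / (1 + k) with k = r^n, and the radius is the one for which the
    numerator equals - (1 - k) / 2. Hence c = (1 - k) / (2 (1 + k)), strictly below 1/2. This strict
    gap allows the good level to be found by counting instead of by measure: among P equally spaced
    levels modulo pi at most C + 2 c P are spoiled, with C independent of P. The obstacle is that T
    itself need not increase, so nothing is known about the boundary curve beyond the behaviour of T
    at two opposite levels; everything else must be extracted from one sign condition inside the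
    disk. Neither integrals nor the argument principle are used: arguments are built from
    arctangents of ratios, the minimum principle from the leading term of a power series, and
    injectivity and openness of f from its level curves. As r < 1, all functions are analytic on the
    closed disk of radius r, so no boundary limits of h or g occur. *)

Lemma normr_normc z : `|z| = (normc z)%:C.
Proof. by case: z. Qed.

Lemma normc_ge0 z : 0 <= normc z.
Proof. by case: z => a b; exact: sqrtr_ge0. Qed.

Lemma normcD z w : normc (z + w) <= normc z + normc w.
Proof. exact: le_normcD. Qed.

Lemma normc_opp z : normc (- z) = normc z.
Proof. exact: normcN. Qed.

Lemma normcB z w : normc (z - w) <= normc z + normc w.
Proof. by rewrite -(normc_opp w); exact: normcD. Qed.

Lemma normc_distC z w : normc (z - w) = normc (w - z).
Proof. by rewrite -normc_opp opprB. Qed.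

Lemma sqr_normc_ReIm z : normc z ^+ 2 = Re z ^+ 2 + Im z ^+ 2.
Proof. by case: z => a b /=; rewrite sqr_sqrtr// addr_ge0 ?sqr_ge0. Qed.

Lemma normc_le z (r : R) : 0 <= r -> (normc z <= r) = (Re z ^+ 2 + Im z ^+ 2 <= r ^+ 2).
Proof. by move=> r0; rewrite -sqr_normc_ReIm ler_sqr ?nnegrE ?normc_ge0. Qed.

Lemma normc_Re z : `|Re z| <= normc z.
Proof.
by rewrite -ler_sqr ?nnegrE ?normc_ge0// sqr_normc_ReIm real_normK ?num_real// lerDl sqr_ge0.
Qed.

Lemma normc_Im z : `|Im z| <= normc z.
Proof.
by rewrite -ler_sqr ?nnegrE ?normc_ge0// sqr_normc_ReIm real_normK ?num_real// lerDr sqr_ge0.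
Qed.

Lemma normc_ReDIm z : normc z <= `|Re z| + `|Im z|.
Proof.
have a0 := normr_ge0 (Re z); have b0 := normr_ge0 (Im z).
rewrite normc_le ?addr_ge0// -(real_normK (num_real (Re z))) -(real_normK (num_real (Im z))).
by nra.
Qed.

Lemma normcX z n : normc (z ^+ n) = normc z ^+ n.
Proof. by elim: n => [|n IH]; rewrite ?expr0 ?Normc.normc1// !exprS Normc.normcM IH. Qed.

Lemma normc_real (x : R) : normc x%:C = `|x|.
Proof. by rewrite /= expr0n addr0 sqrtr_sqr. Qed.

Lemma normc_conj z : normc z^*%C = normc z.
Proof. by case: z => a b /=; rewrite sqrrN. Qed.

Lemma normc_eq0 z : (normc z == 0) = (z == 0).
Proof. by apply/eqP/eqP => [/Normc.eq0_normc//|->]; rewrite Normc.normc0. Qed.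

Lemma normc_gt0 z : (0 < normc z) = (z != 0).
Proof. by rewrite lt_neqAle normc_ge0 andbT eq_sym normc_eq0. Qed.

Lemma normc_nat n : normc (n%:R : R[i]) = n%:R.
Proof. by rewrite -(rmorph_nat (real_complex R)) normc_real normr_nat. Qed.

Lemma cdiskE (r : R) z : cdisk r z <-> normc z < r.
Proof. by rewrite /cdisk /= normr_normc ltcR. Qed.

Lemma normc_sum (u : nat -> R[i]) m n :
  normc (\sum_(m <= k < n) u k) <= \sum_(m <= k < n) normc (u k).
Proof.
elim/big_ind2 : _ => [|x1 x2 y1 y2 h1 h2|//]; first by rewrite Normc.normc0.
by rewrite (le_trans (normcD _ _))// lerD.
Qed.

Lemma ReD z w : Re (z + w) = Re z + Re w. Proof. by case: z; case: w. Qed.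
Lemma ImD z w : Im (z + w) = Im z + Im w. Proof. by case: z; case: w. Qed.
Lemma ReN z : Re (- z) = - Re z. Proof. by case: z. Qed.
Lemma ImN z : Im (- z) = - Im z. Proof. by case: z. Qed.
Lemma ReM z w : Re (z * w) = Re z * Re w - Im z * Im w.
Proof. by case: z; case: w. Qed.
Lemma ImM z w : Im (z * w) = Re z * Im w + Im z * Re w.
Proof. by case: z; case: w. Qed.
Lemma ReJ z : Re z^*%C = Re z. Proof. by case: z. Qed.
Lemma ImJ z : Im z^*%C = - Im z. Proof. by case: z. Qed.
Definition ReImE := (ReD, ImD, ReN, ImN, ReM, ImM, ReJ, ImJ).

Lemma eq_ReIm z w : Re z = Re w -> Im z = Im w -> z = w.
Proof. by case: z w => a b [c d] /= -> ->. Qed.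

End Modulus.

Section EpsilonDelta.
Context {R : realType}.
Implicit Types (z w l : R[i]) (f g : R[i] -> R[i]).

Lemma real_complex_pos (e : R[i]) : 0 < e -> exists2 r : R, 0 < r & e = r%:C.
Proof. by case: e => a b; rewrite ltcE /= => /andP[/eqP -> a0]; exists a. Qed.

Lemma cvg_seqP (u : nat -> R[i]) l :
  u @ \oo --> l <->
  forall e : R, 0 < e -> exists N, forall n, (N <= n)%N -> normc (u n - l) < e.
Proof.
split=> [/cvgrPdist_lt H e e0|H].
  have /H[N _ HN] : 0 < e%:C by rewrite ltcR.
  by exists N => n /HN; rewrite /= normr_normc ltcR normc_distC.
apply/cvgrPdist_lt => e /real_complex_pos[r r0 ->].
have [N HN] := H _ r0; exists N => // n /HN.
by rewrite /= normr_normc ltcR normc_distC.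
Qed.

Lemma nbhs_normcP z (A : set R[i]) :
  nbhs z A <-> exists2 e : R, 0 < e & forall w, normc (w - z) < e -> A w.
Proof.
split=> [/nbhs_ballP[e /real_complex_pos[r r0 ->]] H|[e e0 H]].
  by exists r => // w wz; apply: H; rewrite /ball /= /ball_ normr_normc ltcR normc_distC.
apply/nbhs_ballP; exists e%:C; first by rewrite /= ltcR.
by move=> w; rewrite /ball /= /ball_ normr_normc ltcR normc_distC; exact: H.
Qed.

(** Free of quotients: the estimate is non-strict and includes w = z, so it composes without
    separating the case of a zero increment. *)
Definition cderiv f z l := forall e : R, 0 < e -> exists2 r : R, 0 < r &
  forall w, normc (w - z) < r -> normc (f w - f z - l * (w - z)) <= e * normc (w - z).

Lemma cderiv_derive1 f z l : cderiv f z l -> derive1 f z = l.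
Proof.
move=> H; apply: cvg_lim => //.
apply/cvgrPdist_lt => e /real_complex_pos[r r0 ->].
have r20 : 0 < r / 2 by lra.
have [d d0 Hd] := H _ r20.
apply/nbhs_normcP; exists d => // w; rewrite subr0 => wd /= w0.
rewrite normr_normc ltcR -normc_opp opprB.
have := Hd (w + z); rewrite addrK => /(_ wd) {}Hd.
have w0' : 0 < normc w by rewrite normc_gt0.
rewrite -(@ltr_pM2l _ (normc w))//.
apply: (@le_lt_trans _ _ (r / 2 * normc w)); last by rewrite mulrC ltr_pM2l//; lra.
apply: le_trans Hd; rewrite -Normc.normcM.
rewrite le_eqVlt; apply/orP; left; apply/eqP; congr normc.
by rewrite mulrBr [_ *: _]/GRing.scale/= mulrA divff// mul1r [l * _]mulrC.
Qed.

Lemma cderivD f g z l1 l2 : cderiv f z l1 -> cderiv g z l2 ->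
  cderiv (fun w => f w + g w) z (l1 + l2).
Proof.
move=> Hf Hg e e0.
have e20 : 0 < e / 2 by lra.
have [d1 d10 H1] := Hf _ e20; have [d2 d20 H2] := Hg _ e20.
exists (Num.min d1 d2); first by rewrite lt_min d10.
move=> w; rewrite lt_min => /andP[/H1 {}H1 /H2 {}H2].
rewrite (_ : _ - _ = (f w - f z - l1 * (w - z)) + (g w - g z - l2 * (w - z))); last by ring.
by rewrite (le_trans (normcD _ _))//; lra.
Qed.

Lemma cderivZ (c : R[i]) f z l : cderiv f z l -> cderiv (fun w => c * f w) z (c * l).
Proof.
move=> Hf e e0.
have c0 : 0 < normc c + 1 by rewrite ltr_wpDl ?normc_ge0.
have e20 : 0 < e / (normc c + 1) by rewrite divr_gt0.
have [d d0 H] := Hf _ e20.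
exists d => // w /H {}H.
rewrite (_ : _ - _ = c * (f w - f z - l * (w - z))); last by ring.
rewrite Normc.normcM.
apply: (@le_trans _ _ ((normc c + 1) * normc (f w - f z - l * (w - z)))).
  by rewrite ler_wpM2r ?normc_ge0// lerDl.
by rewrite -ler_pdivlMl// mulrA [_^-1 * _]mulrC.
Qed.

Definition ccont f z := forall e : R, 0 < e -> exists2 r : R, 0 < r &
  forall w, normc (w - z) < r -> normc (f w - f z) < e.

Lemma cderiv_ccont f z l : cderiv f z l -> ccont f z.
Proof.
move=> Hf e e0; have [d d0 H] := Hf 1 ltr01.
have c0 : 0 < normc l + 1 by rewrite ltr_wpDl ?normc_ge0.
have e1 : 0 < e / (normc l + 1) by rewrite divr_gt0.
exists (Num.min d (e / (normc l + 1))); first by rewrite lt_min d0.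
move=> w; rewrite lt_min => /andP[/H {}H]; rewrite ltr_pdivlMr// => H2.
rewrite (_ : f w - f z = (f w - f z - l * (w - z)) + l * (w - z)); last by ring.
by rewrite (le_lt_trans (normcD _ _))// Normc.normcM; lra.
Qed.

End EpsilonDelta.

(** * Power series *)

Section PowerSeries.
Context {R : realType}.
Implicit Types (z w d l : R[i]) (f g : R[i] -> R[i]) (a : nat -> R[i]).

Definition psum a d N := \sum_(0 <= k < N) a k * d ^+ k.

Lemma seriesE a d : series (fun k => a k * d ^+ k) = psum a d.
Proof. by apply/funext => N; rewrite /series. Qed.

Definition cvs (u : nat -> R[i]) l :=
  forall e : R, 0 < e -> exists N, forall n, (N <= n)%N -> normc (u n - l) < e.

Lemma le_of_eps (x y : R) : (forall e, 0 < e -> x <= y + e) -> x <= y.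
Proof. by move=> H; apply/ler_addgt0Pr. Qed.

Lemma cvs_normc_le u l (B : R) (N0 : nat) c :
  cvs u l -> (forall n, (N0 <= n)%N -> normc (u n - c) <= B) -> normc (l - c) <= B.
Proof.
move=> ul uB; apply: le_of_eps => e e0.
have [N HN] := ul _ e0.
rewrite (_ : l - c = (u (maxn N N0) - c) - (u (maxn N N0) - l)); last by ring.
rewrite (le_trans (normcB _ _))// lerD ?uB ?leq_maxr//.
by rewrite ltW// HN// leq_maxl.
Qed.

Lemma cvs_unique u l1 l2 : cvs u l1 -> cvs u l2 -> l1 = l2.
Proof.
move=> H1 H2; apply/eqP; rewrite -subr_eq0 -normc_eq0 eq_le normc_ge0 andbT.
apply: le_of_eps => e e0; rewrite add0r.
have [N HN] := H2 _ e0.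
by apply: cvs_normc_le H1 _ => n /HN/ltW; exact.
Qed.

Lemma cvsD u v l1 l2 : cvs u l1 -> cvs v l2 -> cvs (fun n => u n + v n) (l1 + l2).
Proof.
move=> H1 H2 e e0; have e20 : 0 < e / 2 by lra.
have [N1 HN1] := H1 _ e20; have [N2 HN2] := H2 _ e20.
exists (maxn N1 N2) => n; rewrite geq_max => /andP[/HN1 h1 /HN2 h2].
rewrite (_ : _ - _ = (u n - l1) + (v n - l2)); last by ring.
by rewrite (le_lt_trans (normcD _ _))//; lra.
Qed.

Lemma cvsZ c u l : cvs u l -> cvs (fun n => c * u n) (c * l).
Proof.
move=> H e e0.
have c0 : 0 < normc c + 1 by rewrite ltr_wpDl ?normc_ge0.
have e20 : 0 < e / (normc c + 1) by rewrite divr_gt0.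
have [N HN] := H _ e20.
exists N => n /HN; rewrite -mulrBr Normc.normcM ltr_pdivlMr// => h.
have := normc_ge0 (u n - l); have := normc_ge0 c; nra.
Qed.

Lemma cvs_shift u l : cvs (fun n => u n.+1) l -> cvs u l.
Proof. by move=> H e /H[N HN]; exists N.+1 => -[//|n] /HN. Qed.

Lemma cvs_succ u l : cvs u l -> cvs (fun n => u n.+1) l.
Proof. by move=> H e /H[N HN]; exists N => n /leqW /HN. Qed.

Lemma ler_sum_nat_term (u : nat -> R) k N : (forall i, 0 <= u i) -> (k < N)%N ->
  u k <= \sum_(0 <= i < N) u i.
Proof.
move=> u0 kN; rewrite (big_cat_nat (n := k)) ?(ltnW kN)//= (big_ltn kN).
by rewrite addrCA lerDl addr_ge0 ?sumr_ge0.
Qed.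

(** Real and imaginary parts are dominated by the moduli, so only the convergence of absolutely
    summable real series is invoked. *)
Lemma abs_summable (u : nat -> R[i]) (B : R) :
  (forall N, \sum_(0 <= k < N) normc (u k) <= B) ->
  exists l, cvs (fun N => \sum_(0 <= k < N) u k) l.
Proof.
move=> HB.
have real_sum (v : nat -> R) : (forall k, `|v k| <= normc (u k)) ->
    exists l : R, forall e, 0 < e -> exists N, forall n, (N <= n)%N ->
      `|\sum_(0 <= k < n) v k - l| < e.
  move=> vu.
  have c1 : cvgn (series (fun k => normc (u k))).
    apply: nondecreasing_is_cvgn.
      by apply: nondecreasing_series => k _ _; exact: normc_ge0.
    by exists B => _ [n _ <-]; exact: HB.
  have c2 : cvgn [normed series v].
    by apply: series_le_cvg c1 => k /=; rewrite ?normr_ge0 ?normc_ge0.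
  have c3 : cvgn (series v) by exact: (normed_cvg c2).
  exists (limn (series v)) => e e0.
  have /cvgrPdist_lt/(_ _ e0)[N _ HN] := c3.
  by exists N => n /HN /=; rewrite distrC.
have [l1 H1] := real_sum _ (fun k => normc_Re (u k)).
have [l2 H2] := real_sum _ (fun k => normc_Im (u k)).
exists (l1 +i* l2) => e e0; have e20 : 0 < e / 2 by lra.
have [N1 {}H1] := H1 _ e20; have [N2 {}H2] := H2 _ e20.
exists (maxn N1 N2) => n; rewrite geq_max => /andP[/H1 h1 /H2 h2].
apply: le_lt_trans (normc_ReDIm _) _; rewrite !ReImE /=.
have -> : Re (\sum_(0 <= k < n) u k) = \sum_(0 <= k < n) Re (u k).
  by elim/big_ind2 : _ => [//|x1 x2 y1 y2 <- <-|//]; rewrite ReD.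
have -> : Im (\sum_(0 <= k < n) u k) = \sum_(0 <= k < n) Im (u k).
  by elim/big_ind2 : _ => [//|x1 x2 y1 y2 <- <-|//]; rewrite ImD.
by lra.
Qed.

Lemma geo_sum_le (y : R) m n : 0 <= y < 1 ->
  \sum_(m <= k < n) y ^+ k <= y ^+ m / (1 - y).
Proof.
move=> /andP[y0 y1]; have y1' : 0 < 1 - y by lra.
have [mn|/ltnW nm] := leqP m n; last first.
  by rewrite big_geq// divr_ge0 ?exprn_ge0// ltW.
rewrite ler_pdivlMr//.
suff -> : (\sum_(m <= k < n) y ^+ k) * (1 - y) = y ^+ m - y ^+ n.
  by rewrite gerBl exprn_ge0.
rewrite mulr_suml -[RHS]opprB -telescope_sumr// -sumrN.
by apply: eq_bigr => k _; rewrite exprS; ring.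
Qed.

(** Each of the k powers y^0, ..., y^(k-1) is at least y^k, and their sum is bounded by the
    geometric series. *)
Lemma natr_mul_expr_le (y : R) k : 0 <= y < 1 -> k%:R * y ^+ k <= (1 - y)^-1.
Proof.
move=> y01; have /andP[y0 y1] := y01.
have := @geo_sum_le y 0 k y01; rewrite expr0 mul1r; apply: le_trans.
rewrite (_ : k%:R * _ = \sum_(0 <= i < k) y ^+ k); last by rewrite sumr_const_nat subn0 mulr_natl.
rewrite big_seq [leRHS]big_seq; apply: ler_sum => i; rewrite mem_index_iota => /andP[_ ik].
by apply: ler_wiXn2l => //; [exact: ltW | exact: ltnW].
Qed.

Lemma psum_term_bounded a d l : cvs (psum a d) l ->
  exists2 M : R, 0 < M & forall k, normc (a k) * normc d ^+ k <= M.
Proof.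
move=> H; have [N HN] := H 1 ltr01.
pose B := \sum_(0 <= i < N) (normc (a i) * normc d ^+ i).
have t0 i : 0 <= normc (a i) * normc d ^+ i by rewrite mulr_ge0 ?exprn_ge0 ?normc_ge0.
exists (B + 2) => [|k]; first by rewrite ltr_wpDl// sumr_ge0.
have [kN|Nk] := ltnP k N.
  by rewrite (le_trans (ler_sum_nat_term t0 kN))// lerDl.
rewrite -normcX -Normc.normcM.
have -> : a k * d ^+ k = (psum a d k.+1 - l) - (psum a d k - l).
  by rewrite /psum big_nat_recr//=; ring.
have h1 := HN _ Nk; have h2 := HN _ (leqW Nk).
have B0 : 0 <= B by rewrite sumr_ge0.
by rewrite (le_trans (normcB _ _))//; lra.
Qed.

(** Two intermediate radii split s / t into three ratios below 1: two of them absorb one factor k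
    each, the third leaves a geometric series. The weight k^2 is the one produced by
    [expr_taylor2]. *)
Lemma psum_weighted_bounded a (M s t : R) : 0 < s -> s < t ->
  (forall k, normc (a k) * t ^+ k <= M) ->
  exists2 B : R, 0 < B & forall N, \sum_(0 <= k < N) normc (a k) * k%:R ^+ 2 * s ^+ k <= B.
Proof.
move=> s0 st HM.
pose s1 := s + (t - s) / 3; pose s2 := s + 2 * (t - s) / 3.
have [s10 s20 t0] : [/\ 0 < s1, 0 < s2 & 0 < t] by rewrite /s1 /s2; split; lra.
have y1 : 0 <= s / s1 < 1 by rewrite divr_ge0 ?ltW//= ltr_pdivrMr// mul1r /s1; lra.
have y2 : 0 <= s1 / s2 < 1 by rewrite divr_ge0 ?ltW//= ltr_pdivrMr// mul1r /s1 /s2; lra.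
have y3 : 0 <= s2 / t < 1 by rewrite divr_ge0 ?ltW//= ltr_pdivrMr// mul1r /s2; lra.
have M0 : 0 <= M by have := HM 0%N; rewrite expr0 mulr1; apply: le_trans; exact: normc_ge0.
pose K := M * (1 - s / s1)^-1 * (1 - s1 / s2)^-1.
have K0 : 0 <= K by rewrite !mulr_ge0// invr_ge0; lra.
exists (K * (1 - s2 / t)^-1 + 1) => [|N].
  by rewrite ltr_wpDl// mulr_ge0// invr_ge0; lra.
apply: (@le_trans _ _ (\sum_(0 <= k < N) K * (s2 / t) ^+ k)); last first.
  rewrite -mulr_sumr; have := @geo_sum_le _ 0 N y3; rewrite expr0 mul1r => h.
  by rewrite (@le_trans _ _ (K * (1 - s2 / t)^-1))// ?ler_wpM2l// lerDl.
apply: ler_sum => k _.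
have -> : normc (a k) * k%:R ^+ 2 * s ^+ k = (normc (a k) * t ^+ k) * (k%:R * (s / s1) ^+ k) *
    (k%:R * (s1 / s2) ^+ k) * (s2 / t) ^+ k.
  rewrite !expr_div_n; field.
  by rewrite !expf_neq0// gt_eqF.
have p y : 0 <= y < 1 -> 0 <= k%:R * y ^+ k by move=> /andP[? _]; rewrite mulr_ge0 ?exprn_ge0.
have /andP[y30 _] := y3.
rewrite ler_wpM2r ?exprn_ge0// /K.
have a0 : 0 <= normc (a k) * t ^+ k by rewrite mulr_ge0 ?normc_ge0 ?exprn_ge0 ?ltW.
apply: ler_pM; [by rewrite mulr_ge0// p|exact: p| |exact: natr_mul_expr_le].
by apply: ler_pM; [|exact: p|exact: HM|exact: natr_mul_expr_le].
Qed.

(* The factor s ^+ 2 replaces the exponent k - 2, which would be truncated. *)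
Lemma expr_taylor2 z w (s : R) k : 0 < s -> normc z <= s -> normc w <= s ->
  normc (w ^+ k - z ^+ k - k%:R * z ^+ k.-1 * (w - z)) * s ^+ 2 <=
  k%:R ^+ 2 * s ^+ k * normc (w - z) ^+ 2.
Proof.
move=> s0 zs ws; elim: k => [|k IH].
  by rewrite !expr0 subrr !mul0r subr0 Normc.normc0 mul0r expr0n/= !mul0r.
have -> : w ^+ k.+1 - z ^+ k.+1 - k.+1%:R * z ^+ k.+1.-1 * (w - z) =
  w * (w ^+ k - z ^+ k - k%:R * z ^+ k.-1 * (w - z)) + k%:R * z ^+ k.-1 * (w - z) ^+ 2.
  case: k {IH} => [|k]; first by rewrite /= !expr0 !expr1; ring.
  by rewrite /= !exprS -[k.+2%:R]natr1; ring.
set E := _ - _ - _ in IH *; set e2 := normc (w - z) ^+ 2 in IH *.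
apply: (@le_trans _ _ ((s * normc E + k%:R * normc (z ^+ k.-1) * e2) * s ^+ 2)).
  rewrite ler_wpM2r ?exprn_ge0 ?(ltW s0)//; apply: le_trans (normcD _ _) _.
  rewrite !Normc.normcM normc_nat -expr2 lerD// ler_wpM2r ?normc_ge0//.
rewrite mulrDl.
have -> : s * normc E * s ^+ 2 = s * (normc E * s ^+ 2) by ring.
have h1 : s * (normc E * s ^+ 2) <= k%:R ^+ 2 * s ^+ k.+1 * e2.
  apply: le_trans (ler_wpM2l (ltW s0) IH) _.
  by rewrite le_eqVlt; apply/orP; left; apply/eqP; rewrite (exprS s k); ring.
have e20 : 0 <= e2 by rewrite exprn_ge0 ?normc_ge0.
have h2 : k%:R * normc (z ^+ k.-1) * e2 * s ^+ 2 <= k%:R * s ^+ k.+1 * e2.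
  case: k {IH E h1} => [|k]; first by rewrite !mul0r.
  rewrite [X in _ <= _ * X * _](_ : _ = s ^+ k * s ^+ 2); last by rewrite -exprD addn2.
  rewrite normcX /= (_ : _ * _ * _ * _ = k.+1%:R * (normc z ^+ k * s ^+ 2) * e2); last by ring.
  rewrite ler_wpM2r// ler_wpM2l// ler_wpM2r ?exprn_ge0 ?(ltW s0)//.
  by rewrite lerXn2r ?nnegrE ?normc_ge0 ?(ltW s0).
have h3 : 0 <= s ^+ k.+1 * e2 by rewrite mulr_ge0// exprn_ge0// ltW.
have k0 : 0 <= k%:R :> R by [].
rewrite -[k.+1%:R]natr1; nra.
Qed.

Definition dcoef a k := k.+1%:R * a k.+1.

(** Termwise differentiation. For |d| < s < t < rho the coefficients are at most M / t^k, so the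
    second-order error of every partial sum is at most (B / s^2) |w - (z0 + d)|^2, uniformly in the
    number of terms, and this bound survives the limit. *)
Lemma cvs_dcoef a (f : R[i] -> R[i]) z0 (rho : R) :
  (forall d, normc d < rho -> cvs (psum a d) (f (z0 + d))) ->
  forall d, normc d < rho -> exists2 l, cvs (psum (dcoef a) d) l & cderiv f (z0 + d) l.
Proof.
move=> H d dr; have d0 := normc_ge0 d.
pose s := normc d + (rho - normc d) / 3; pose t := normc d + 2 * (rho - normc d) / 3.
have [s0 st tr t0] : [/\ 0 < s, s < t, t < rho & 0 < t] by rewrite /s /t; split; lra.
have nt : normc (t%:C : R[i]) = t by rewrite normc_real ger0_norm// ltW.
have [M M0 HM] : exists2 M : R, 0 < M & forall k, normc (a k) * t ^+ k <= M.
  by rewrite -nt; apply: psum_term_bounded (H t%:C _); rewrite nt.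
have [B B0 HB] := psum_weighted_bounded s0 st HM.
have ds : normc d <= s by rewrite /s; lra.
have [l Hl] : exists l, cvs (psum (dcoef a) d) l.
  apply: (@abs_summable _ (B / s)) => N; rewrite ler_pdivlMr// mulr_suml.
  apply: le_trans (HB N.+1); rewrite big_nat_recl//= ler_wpDl ?mulr_ge0 ?normc_ge0 ?exprn_ge0 ?(ltW s0)//.
  apply: ler_sum => k _; rewrite /dcoef !Normc.normcM normc_nat normcX.
  rewrite (exprS s k) [leRHS](_ : _ = k.+1%:R ^+ 2 * normc (a k.+1) * s ^+ k * s); last by ring.
  rewrite ler_pM2r// ler_pM ?mulr_ge0 ?exprn_ge0 ?normc_ge0//.
    rewrite ler_wpM2r ?normc_ge0// expr2 ler_peMl//.
    by rewrite ler1n.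
  by rewrite lerXn2r ?nnegrE ?normc_ge0 ?(ltW s0).
exists l => // e e0.
have Bs : 0 < B / s ^+ 2 by rewrite divr_gt0 ?exprn_gt0.
exists (Num.min (s - normc d) (e / (B / s ^+ 2))).
  by rewrite lt_min divr_gt0// andbT /s; lra.
move=> w; rewrite lt_min => /andP[wd1 wd2].
pose d' := w - z0; have wE : w = z0 + d' by rewrite /d'; ring.
have dd : w - (z0 + d) = d' - d by rewrite /d'; ring.
have d's : normc d' <= s.
  have -> : d' = d + (w - (z0 + d)) by rewrite /d'; ring.
  by rewrite (le_trans (normcD _ _))//; lra.
apply: (@le_trans _ _ (B / s ^+ 2 * normc (w - (z0 + d)) ^+ 2)); last first.
  move: wd2; rewrite ltr_pdivlMr// => wd2.
  by rewrite expr2 mulrA ler_wpM2r ?normc_ge0// mulrC ltW.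
(* One more term is taken from the two series for f because [dcoef] shifts the index: all three sums
   then end with the coefficient [a N]. *)
pose u N := psum a d' N.+1 + (-1) * psum a d N.+1 + (- (w - (z0 + d))) * psum (dcoef a) d N.
have Hu : cvs u (f w + (-1) * f (z0 + d) + (- (w - (z0 + d))) * l).
  apply: cvsD; last exact: cvsZ.
  apply: cvsD; [|apply: cvsZ]; apply: cvs_succ; last exact: H.
  by rewrite wE; apply: H; rewrite (le_lt_trans d's)//; lra.
rewrite (_ : _ - _ - _ = (f w + (-1) * f (z0 + d) + (- (w - (z0 + d))) * l) - 0); last by ring.
apply: cvs_normc_le (0%N) _ Hu _ => n _; rewrite subr0.
rewrite mulrAC ler_pdivlMr ?exprn_gt0//.
have -> : u n = \sum_(0 <= k < n.+1) a k * (d' ^+ k - d ^+ k - k%:R * d ^+ k.-1 * (d' - d)).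
  rewrite /u /psum mulN1r -sumrB dd.
  rewrite [X in _ + _ * X](_ : _ = \sum_(0 <= k < n.+1) a k * (k%:R * d ^+ k.-1)); last first.
    rewrite big_nat_recl//= mul0r mulr0 add0r; apply: eq_bigr => k _.
    by rewrite /dcoef; ring.
  rewrite mulr_sumr -big_split/=; apply: eq_bigr => k _; ring.
apply: (@le_trans _ _ (\sum_(0 <= k < n.+1) normc (a k) * k%:R ^+ 2 * s ^+ k * normc (d' - d) ^+ 2)).
  apply: le_trans (ler_wpM2r _ (normc_sum _ _ _)) _; first by rewrite exprn_ge0 ?(ltW s0).
  rewrite mulr_suml; apply: ler_sum => k _; rewrite Normc.normcM -[leLHS]mulrA.
  rewrite [leRHS](_ : _ = normc (a k) * (k%:R ^+ 2 * s ^+ k * normc (d' - d) ^+ 2)); last by ring.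
  by apply: ler_wpM2l; [exact: normc_ge0|exact: expr_taylor2].
by rewrite -mulr_suml dd ler_wpM2r ?exprn_ge0 ?normc_ge0.
Qed.

End PowerSeries.

(** * Local expansion of analytic functions and their local minima *)

Section LocalForm.
Context {R : realType}.
Implicit Types (z w d l : R[i]) (f g : R[i] -> R[i]) (a : nat -> R[i]).

Lemma psum0 a N : psum a 0 N.+1 = a 0%N.
Proof.
rewrite /psum big_nat_recl// expr0 mulr1 big1 ?addr0// => k _.
by rewrite expr0n mulr0.
Qed.

Lemma cvs_psum0 a l : cvs (psum a 0) l -> a 0%N = l.
Proof.
move=> H; apply: (cvs_unique _ H) => e e0.
by exists 1%N => -[//|n] _; rewrite psum0 subrr Normc.normc0.
Qed.

(** Either all coefficients after the constant one vanish, or the first nonzero one gives the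
    leading term. For |d| < t / 2 the tail is a geometric series of ratio below 1/2, hence at most
    twice its first term; this is the 2 in the witness for [K]. *)
Lemma psum_local_form a f z0 (rho : R) : 0 < rho ->
  (forall d, normc d < rho -> cvs (psum a d) (f (z0 + d))) ->
  (exists2 e : R, 0 < e & forall d, normc d < e -> f (z0 + d) = f z0) \/
  (exists k c K, exists2 e : R, 0 < e & c != 0 /\ forall d, normc d < e ->
     normc (f (z0 + d) - f z0 - c * d ^+ k.+1) <= K * normc d ^+ k.+2).
Proof.
move=> rho0 H.
have a0 : a 0%N = f z0.
  by apply: cvs_psum0; have := H 0; rewrite addr0 Normc.normc0; exact.
have [[k ak]|/forallNP a0'] := pselect (exists k, a k.+1 != 0); last first.
  left; exists rho => // d /H Hd; apply: (cvs_unique Hd) => e e0.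
  exists 1%N => -[//|n] _; rewrite /psum big_nat_recl// expr0 mulr1 big1 ?addr0.
    by rewrite a0 subrr Normc.normc0.
  by move=> i _; have /negP/negPn/eqP -> := a0' i; rewrite mul0r.
right.
have exk : exists k, a k.+1 != 0 by exists k.
case: (ex_minnP exk) => {ak}k ak kmin; have {exk}kmin j : (j < k)%N -> a j.+1 = 0.
  by move=> jk; apply/eqP/negPn/negP => /kmin; rewrite leqNgt jk.
pose t := rho / 2; have [t0 trho] : 0 < t /\ t < rho by rewrite /t; split; lra.
have nt : normc (t%:C : R[i]) = t by rewrite normc_real ger0_norm// ltW.
have [M M0 HM] : exists2 M : R, 0 < M & forall k, normc (a k) * t ^+ k <= M.
  by rewrite -nt; apply: psum_term_bounded (H t%:C _); rewrite nt.
exists k, (a k.+1), (M / t ^+ k.+2 * 2), (t / 2); first by rewrite divr_gt0.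
split=> // d dt; have d0 := normc_ge0 d.
have ddt : 0 <= normc d / t < 2^-1.
  by rewrite divr_ge0 ?(ltW t0)//= ltr_pdivrMr// mulrC.
have /H Hd : normc d < rho by lra.
rewrite -addrA -opprD; apply: cvs_normc_le (k.+2) _ Hd _ => -[//|n] kn.
rewrite /psum (big_cat_nat (n := k.+2))//= big_nat_recl// expr0 mulr1 a0.
rewrite big_nat_recr//= big_nat_cond big1 ?add0r; last first.
  by move=> i; rewrite andbT => /andP[_ /kmin ->]; rewrite mul0r.
rewrite (_ : _ - _ = \sum_(k.+2 <= i < n.+1) a i * d ^+ i); last by ring.
apply: le_trans (normc_sum _ _ _) _.
apply: (@le_trans _ _ (\sum_(k.+2 <= i < n.+1) M * (normc d / t) ^+ i)).
  apply: ler_sum => i _; rewrite Normc.normcM normcX expr_div_n mulrA mulrAC.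
  by rewrite ler_wpM2r ?exprn_ge0// ler_pdivlMr ?exprn_gt0.
rewrite -mulr_sumr -!mulrA ler_pM2l//.
have h01 : 0 <= normc d / t < 1 by lra.
apply: le_trans (geo_sum_le _ _ h01) _.
rewrite expr_div_n [leRHS](_ : _ = normc d ^+ k.+2 / t ^+ k.+2 * 2); last by ring.
rewrite ler_wpM2l ?divr_ge0 ?exprn_ge0 ?(ltW t0)//.
by rewrite -[leRHS]invrK lef_pV2 ?posrE ?invr_gt0//; lra.
Qed.

Definition analytic_at f z0 := exists2 rho : R, 0 < rho &
  exists a, forall d, normc d < rho -> cvs (psum a d) (f (z0 + d)).

Lemma analytic_onP (D : set R[i]) f : analytic_on D f -> forall z, D z -> analytic_at f z.
Proof.
move=> H z /H[rho rho0 [a Ha]]; exists rho => //; exists a => d dr.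
have := Ha (z + d); rewrite addrAC subrr add0r normr_normc ltcR => /(_ dr).
by rewrite seriesE => /cvg_seqP.
Qed.

Lemma analytic_derive1 f z : analytic_at f z ->
  cderiv f z (derive1 f z) /\ analytic_at (derive1 f) z.
Proof.
move=> [rho rho0 [a Ha]].
have H d : normc d < rho -> cvs (psum (dcoef a) d) (derive1 f (z + d)) /\
    cderiv f (z + d) (derive1 f (z + d)).
  by move=> /(cvs_dcoef Ha)[l H1 H2]; rewrite (cderiv_derive1 H2).
split; first by have := H 0; rewrite addr0 Normc.normc0 => /(_ rho0)[].
by exists rho => //; exists (dcoef a) => d /H[].
Qed.

Lemma analyticD f g z : analytic_at f z -> analytic_at g z ->
  analytic_at (fun w => f w + g w) z.
Proof.
move=> [r r0 [a Ha]] [s s0 [b Hb]]; exists (Num.min r s); first by rewrite lt_min r0.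
exists (fun k => a k + b k) => d; rewrite lt_min => /andP[/Ha h1 /Hb h2].
have -> : psum (fun k => a k + b k) d = (fun n => psum a d n + psum b d n).
  by apply/funext => n; rewrite /psum -big_split/=; apply: eq_bigr => k _; rewrite mulrDl.
exact: cvsD.
Qed.

Lemma analyticZ c f z : analytic_at f z -> analytic_at (fun w => c * f w) z.
Proof.
move=> [r r0 [a Ha]]; exists r => //; exists (fun k => c * a k) => d /Ha h1.
have -> : psum (fun k => c * a k) d = (fun n => c * psum a d n).
  by apply/funext => n; rewrite /psum mulr_sumr; apply: eq_bigr => k _; rewrite mulrA.
exact: cvsZ.
Qed.

(** Writing w = z + d gives the coefficients z a_k + a_(k-1). *)
Lemma analytic_mulX f z : analytic_at f z -> analytic_at (fun w => w * f w) z.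
Proof.
move=> [r r0 [a Ha]]; exists r => //.
exists (fun k => z * a k + if k is k'.+1 then a k' else 0) => d /Ha h1.
rewrite mulrDl; apply: cvs_shift.
have -> : (fun n => psum (fun k => z * a k + if k is k'.+1 then a k' else 0) d n.+1) =
    (fun n => z * psum a d n.+1 + d * psum a d n).
  apply/funext => n; rewrite {2}/psum !mulr_sumr.
  rewrite /psum (eq_bigr (fun k => z * (a k * d ^+ k) +
    (if k is k'.+1 then a k' else 0) * d ^+ k)); last by move=> k _; rewrite mulrDl mulrA.
  rewrite big_split/= -mulr_sumr; congr (_ + _).
  rewrite big_nat_recl//= mul0r add0r; apply: eq_bigr => k _.
  by rewrite exprS; ring.
by apply: cvsD; apply: cvsZ => //; exact: cvs_succ.
Qed.

(** A leading term c d^(k+1) takes every argument. With c om^(k+1) = - i and d = t om it equals - i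
    t^(k+1), which beats the error of order t^(k+2) for small t and pushes Im f below its supposed
    minimum. *)
Lemma analytic_local_min f z : analytic_at f z ->
  (exists2 e : R, 0 < e & forall w, normc (w - z) < e -> Im (f z) <= Im (f w)) ->
  exists2 e : R, 0 < e & forall w, normc (w - z) < e -> f w = f z.
Proof.
move=> [rho rho0 [a Ha]] [s s0 fmin].
have [[e e0 He]|[k [c [K [e e0 [c0 He]]]]]] := psum_local_form rho0 Ha.
  by exists e => // w /He; rewrite addrC subrK.
exfalso.
pose om := k.+1.-root (- 'i / c).
have omK : c * om ^+ k.+1 = - 'i by rewrite rootCK// mulrC divfK.
have nom : normc om ^+ k.+1 = (normc c)^-1.
  apply: (mulfI (x := normc c)); first by rewrite normc_eq0.
  rewrite -normcX -Normc.normcM omK divff ?normc_eq0//.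
  by rewrite normc_opp /= expr0n expr1n add0r sqrtr1.
have om0 : 0 < normc om.
  rewrite lt_neqAle normc_ge0 andbT; apply/eqP => h.
  by move: nom; rewrite -h expr0n/= => /esym/eqP; rewrite invr_eq0 normc_eq0 (negbTE c0).
pose L := `|K| * normc om ^+ k.+2 + 1.
have L0 : 0 < L by rewrite ltr_wpDl// mulr_ge0 ?exprn_ge0 ?normc_ge0.
have [t [t0 te ts tL]] : exists t, [/\ 0 < t, t * normc om < e, t * normc om < s & t < L^-1].
  have m0 : 0 < Num.min (Num.min e s / normc om) L^-1.
    by rewrite lt_min invr_gt0 L0 divr_gt0// lt_min e0.
  exists (Num.min (Num.min e s / normc om) L^-1 / 2).
  have : Num.min (Num.min e s / normc om) L^-1 / 2 < Num.min (Num.min e s / normc om) L^-1 by lra.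
  rewrite lt_min ltr_pdivlMr// lt_min => /andP[/andP[te ts] tL].
  by split=> //; lra.
have nto : normc (t%:C * om) = t * normc om.
  by rewrite Normc.normcM normc_real ger0_norm// ltW.
have := He (t%:C * om); rewrite nto => /(_ te).
have {fmin} := fmin (z + t%:C * om); rewrite addrAC subrr add0r nto => /(_ ts).
rewrite !exprMn mulrCA omK => fmin.
have -> : t%:C ^+ k.+1 * - 'i = (0 +i* (- t ^+ k.+1)) :> R[i].
  by rewrite -rmorphXn /=; apply: eq_ReIm; rewrite !ReImE/=; ring.
set E := _ - _ - _ => H1.
have H2 : t ^+ k.+1 <= normc E.
  rewrite (@le_trans _ _ (Im E))//; last by rewrite (le_trans (ler_norm _))// normc_Im.
  by rewrite /E !ReImE /=; lra.
have H3 := le_trans H2 H1.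
have tk : 0 < t ^+ k.+1 by rewrite exprn_gt0.
have H4 : t ^+ k.+1 <= t ^+ k.+1 * (t * L).
  apply: le_trans H3 _; rewrite (exprS t k.+1) [leLHS](_ : _ = t ^+ k.+1 * (t * (K * normc om ^+ k.+2))); last by ring.
  rewrite ler_pM2l// ler_pM2l// /L.
  rewrite (@le_trans _ _ (`|K| * normc om ^+ k.+2))// ?lerDl//.
  by rewrite ler_wpM2r ?exprn_ge0 ?normc_ge0// ler_norm.
move: H4; rewrite -{1}[t ^+ k.+1]mulr1 ler_pM2l// leNgt => /negP; apply.
by rewrite -ltr_pdivlMr// div1r.
Qed.

End LocalForm.

(** * Functions of a real variable *)

Section RealLine.
Context {R : realType}.
Implicit Types (x y a b e : R) (T : R -> R).

(** The supremum of the x such that P holds on [a, x] belongs to that set by the third premise, and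
    by the second it cannot be smaller than b. *)
Lemma real_induction (P : R -> Prop) a b : P a ->
  (forall x, a <= x -> x < b -> (forall y, a <= y -> y <= x -> P y) ->
     exists2 e, 0 < e & forall y, x < y -> y < x + e -> y <= b -> P y) ->
  (forall x, a < x -> x <= b -> (forall y, a <= y -> y < x -> P y) -> P x) ->
  forall x, a <= x -> x <= b -> P x.
Proof.
move=> Pa ext lim x ax xb; have ab := le_trans ax xb.
pose S := [set x | a <= x <= b /\ forall y, a <= y -> y <= x -> P y].
have Sa : S a by split; [rewrite lexx|move=> y ay ya; rewrite (_ : y = a)//; lra].
have hS : has_sup S by split; [exists a|exists b => y [/andP[]]].
pose s := sup S.
have as_ : a <= s by exact: (ub_le_sup (proj2 hS) Sa).
have sb : s <= b by apply: ge_sup; [exists a|move=> y [/andP[]]].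
have Plt y : a <= y -> y < s -> P y.
  move=> ay ys; have e0 : 0 < s - y by lra.
  have [z [_ Hz] sz] := sup_adherent e0 hS; apply: Hz => //; rewrite -/s in sz; lra.
have Ps : P s.
  by move: as_; rewrite le_eqVlt => /orP[/eqP <-//|as_]; exact: lim.
have Ple y : a <= y -> y <= s -> P y.
  by move=> ay; rewrite le_eqVlt => /orP[/eqP ->//|]; exact: Plt.
have [sltb|bs] := ltP s b; last by apply: Ple => //; lra.
have [e e0 He] := ext s as_ sltb Ple.
pose t := Num.min b (s + e / 2).
have st : s < t by rewrite lt_min sltb; lra.
suff /(ub_le_sup (proj2 hS)) : S t by rewrite -/s leNgt st.
split; first by rewrite ge_min lexx andbT; lra.
move=> y ay; rewrite le_min => /andP[yb yse].
by have [ys|sy] := leP y s; [exact: Ple|apply: He => //; lra].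
Qed.

(** Only comparisons with the value at x itself are made, which is what a positive derivative at the
    single point x gives. *)
Definition local_incr T x := exists2 e, 0 < e & forall y, `|y - x| < e ->
  (x < y -> T x < T y) /\ (y < x -> T y < T x).

Lemma local_incr_lt T a b : (forall x, a <= x -> x <= b -> local_incr T x) ->
  a < b -> T a < T b.
Proof.
move=> H ab.
suff : forall x, a <= x -> x <= b -> a < x -> T a < T x by move=> /(_ b); apply => //; lra.
apply: real_induction; first by rewrite ltxx.
- move=> x ax xb HP; have [e e0 He] := H _ ax (ltW xb).
  exists e => // y xy ye yb ay.
  have [|/(_ xy) h _] := He y; first by rewrite gtr0_norm; lra.
  move: ax; rewrite le_eqVlt => /orP[/eqP -> //|ax].
  by rewrite (lt_trans _ h)// HP// ltW.
- move=> x ax xb HP _; have [e e0 He] := H _ (ltW ax) xb.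
  pose y := Num.max ((a + x) / 2) (x - e / 2).
  have ay : a < y by rewrite lt_max; apply/orP; left; lra.
  have yx : y < x by rewrite gt_max; apply/andP; split; lra.
  have [|_ /(_ yx) h] := He y.
    rewrite ltr0_norm ?subr_lt0// opprB ltrBlDl -ltrBlDr lt_max; apply/orP; right; lra.
  by rewrite (lt_trans _ h)// HP// ltW.
Qed.

(** Compactness of [a, b] in the form in which it is used for counts, for uniform radii and for
    lifts of arguments: short intervals around each point are chained together. *)
Lemma additive_of_local (P : R -> R -> Prop) a b : a <= b ->
  (forall x y z, x <= y -> y <= z -> P x y -> P y z -> P x z) ->
  (forall x, a <= x -> x <= b -> exists2 e, 0 < e &
     forall u v, x - e < u -> u <= x -> x <= v -> v < x + e -> P u v) ->
  P a b.
Proof.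
move=> ab add loc.
suff : forall x, a <= x -> x <= b -> P a x by apply.
apply: real_induction.
- by have [e e0 He] := loc a (lexx a) ab; apply: He; lra.
- move=> x ax xb HP; have [e e0 He] := loc x ax (ltW xb).
  exists e => // y xy ye yb; apply: (add _ x); rewrite ?(ltW xy)//; first exact: HP.
  by apply: He; lra.
- move=> x ax xb HP; have [e e0 He] := loc x (ltW ax) xb.
  pose y := Num.max a (x - e / 2).
  have yx : y < x by rewrite gt_max ax; lra.
  have ya : a <= y by rewrite le_max lexx.
  have yxe : x - e < y by rewrite lt_max; apply/orP; right; lra.
  by apply: (add _ y) => //; rewrite ?(ltW yx)//; [exact: HP|apply: He => //; lra].
Qed.

Definition rcont T x := forall e, 0 < e -> exists2 r : R, 0 < r &
  forall y, `|y - x| < r -> `|T y - T x| < e.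

Lemma rcontP T x : rcont T x <-> {for x, continuous T}.
Proof.
split=> [H|/cvgrPdist_lt H e /H].
  apply/cvgrPdist_lt => e /H[r r0 Hr]; apply/nbhs_ballP; exists r => // y.
  by rewrite /ball /= distrC => /Hr; rewrite distrC.
move=> /nbhs_ballP[r /= r0 Hr]; exists r => // y; rewrite distrC => /Hr.
by rewrite /= distrC.
Qed.

Lemma is_derive_eps T x l : is_derive x 1 T l -> forall e, 0 < e ->
  exists2 r : R, 0 < r & forall y, `|y - x| < r ->
    `|T y - T x - l * (y - x)| <= e * `|y - x|.
Proof.
move=> [dT <-] e e0.
have /cvgrPdist_lt/(_ _ e0) : (fun h => h^-1 *: ((T \o shift x) (h *: (1:R)) - T x)) @ 0^' --> 'D_1 T x.
  exact: dT.
move=> /nbhs_ballP[r /= r0 Hr]; exists r => // y yr.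
have [->|yx] := eqVneq y x; first by rewrite !subrr mulr0 subrr normr0 mulr0.
have yx0 : y - x != 0 by rewrite subr_eq0.
have := Hr (y - x); rewrite /ball /= sub0r normrN => /(_ yr yx0).
rewrite [(y - x)%:A]mulr1 subrK [_ *: _]/GRing.scale/= => /ltW.
rewrite -(@ler_pM2r _ `|y - x|) ?normr_gt0// -normrM; apply: le_trans.
rewrite -normrN le_eqVlt; apply/orP; left; apply/eqP; congr `|_|.
by field.
Qed.

Lemma is_derive_rcont T x l : is_derive x 1 T l -> rcont T x.
Proof.
move=> [dT _]; apply/rcontP; apply: differentiable_continuous.
exact/derivable1_diffP.
Qed.

Lemma is_derive_local_incr T x l : is_derive x 1 T l -> 0 < l -> local_incr T x.
Proof.
move=> dT l0; have l20 : 0 < l / 2 by lra.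
have [r r0 Hr] := is_derive_eps dT l20.
exists r => // y /Hr; rewrite ler_norml => /andP[h1 h2]; split => xy.
  by move: h1; rewrite gtr0_norm ?subr_gt0//; nra.
by move: h2; rewrite ltr0_norm ?subr_lt0//; nra.
Qed.

Section Crossing.
Variables (T : R -> R) (phi : R).
Hypothesis Tc : forall x, rcont T x.
Hypothesis Tphi : forall x, T x = phi -> local_incr T x.

(** T exceeds phi just after a. At a first return to phi it would again be locally increasing, hence
    below phi just before, where it is still above. *)
Lemma crossing_gt a x : T a = phi -> a < x -> phi < T x.
Proof.
move=> Ta ax.
suff : forall y, a <= y -> y <= x -> a < y -> phi < T y by apply; rewrite ?(ltW ax).
apply: real_induction; first by rewrite ltxx.
- move=> y ay yx HP; move: ay; rewrite le_eqVlt => /orP[/eqP ay|ay].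
    have [e e0 He] := Tphi Ta; exists e => // z yz ze zx az.
    by have [|/(_ az)] := He z; [rewrite gtr0_norm; lra|rewrite Ta].
  have Ty : 0 < T y - phi by have := HP y (ltW ay) (lexx _) ay; lra.
  have [r r0 Hr] := Tc y Ty; exists r => // z yz zr zx az.
  have := Hr z; rewrite gtr0_norm ?subr_gt0// => /(_ _)/ltr_normlP.
  by move=> h; have [|h1 h2] := h; lra.
- move=> y ay yx HP _.
  have Ty : phi <= T y.
    rewrite leNgt; apply/negP => Typ.
    have Ty : 0 < phi - T y by lra.
    have [r r0 Hr] := Tc y Ty.
    pose z := Num.max ((a + y) / 2) (y - r / 2).
    have az : a < z by rewrite lt_max; apply/orP; left; lra.
    have zy : z < y by rewrite gt_max; apply/andP; split; lra.
    have zr : y - r < z by rewrite lt_max; apply/orP; right; lra.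
    have := HP z (ltW az) zy az; have := Hr z.
    rewrite ltr0_norm ?subr_lt0// => /(_ _)/ltr_normlP h.
    by have [|h1 h2] := h; lra.
  rewrite lt_neqAle Ty andbT; apply/eqP => /esym Typ.
  have [r r0 Hr] := Tphi Typ.
  pose z := Num.max ((a + y) / 2) (y - r / 2).
  have az : a < z by rewrite lt_max; apply/orP; left; lra.
  have zy : z < y by rewrite gt_max; apply/andP; split; lra.
  have zr : y - r < z by rewrite lt_max; apply/orP; right; lra.
  have := HP z (ltW az) zy az; have [|_ /(_ zy)] := Hr z; last by lra.
  by rewrite ltr0_norm ?subr_lt0//; lra.
Qed.

Lemma ivt_eq a b : a <= b -> (T a - phi) * (T b - phi) <= 0 ->
  exists2 x, a <= x <= b & T x = phi.
Proof.
move=> ab h.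
have [||x] := @IVT R T a b phi ab.
- by apply: continuous_subspaceT => x; apply/rcontP.
- by rewrite ge_min le_max; apply/andP; split; apply/orP; nra.
by rewrite in_itv /= => hx <-; exists x.
Qed.

(** T is below phi just before a. A larger value at an earlier x would force a crossing in between,
    after which T stays above phi, also at a. *)
Lemma crossing_lt a x : T a = phi -> x < a -> T x < phi.
Proof.
move=> Ta xa; rewrite ltNge; apply/negP; rewrite le_eqVlt => /orP[/eqP h|h].
  by have := crossing_gt (esym h) xa; rewrite Ta ltxx.
have [e e0 He] := Tphi Ta.
pose z := Num.max ((a + x) / 2) (a - e / 2).
have az : x < z by rewrite lt_max; apply/orP; left; lra.
have zy : z < a by rewrite gt_max; apply/andP; split; lra.
have zr : a - e < z by rewrite lt_max; apply/orP; right; lra.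
have [|_ /(_ zy) Tz] := He z; first by rewrite ltr0_norm ?subr_lt0//; lra.
have [||y /andP[xy yz] Ty] := @ivt_eq x z; [lra|nra|].
by have := crossing_gt Ty (le_lt_trans yz zy); rewrite Ta ltxx.
Qed.

End Crossing.
End RealLine.


(** * A level that is crossed only upwards *)

Section GoodLevel.
Context {R : realType}.
Variables (T T' : R -> R) (c : R).

(* The levels pi m / P + pi k, for all integers k, spoiled on [a, b] by a point where T' <= 0. *)
Definition bad_levels (P : nat) (a b : R) : {set 'I_P} :=
  [set m : 'I_P | `[< exists t (k : int), [/\ a <= t, t <= b, T' t <= 0 &
     T t = pi * (m%:R / P%:R + k%:~R)] >]].

(* Near such a point |T'| <= c, so T covers a length at most c (v - u). *)
Lemma bad_levels_local (x : R) :
  (forall t : R, is_derive t (1 : R) T (T' t)) -> (forall t, rcont T' t) ->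
  0 < c -> (forall t, - c < T' t) -> exists2 e : R, 0 < e &
  forall u v, x - e < u -> u <= x -> x <= v -> v < x + e ->
  exists C : nat, forall P, (0 < P)%N -> #|bad_levels P u v|%:R <= C%:R + c * (v - u) * P%:R / pi.
Proof.
move=> dT T'c c0 T'gt; have pi0 := pi_gt0 R.
have [T'x|T'x] := ltP 0 (T' x).
  have [r r0 Hr] := T'c x _ T'x; exists r => // u v h1 h2 h3 h4.
  exists 0%N => P P0; rewrite (_ : bad_levels P u v = finset.set0).
    by rewrite cards0 add0r divr_ge0 ?mulr_ge0 ?(ltW c0) ?(ltW pi0)//; lra.
  apply/setP => m; rewrite !inE; apply/negbTE/negP => /asboolP[t [k [ut tv T't _]]].
  have : `|T' t - T' x| < T' x by apply: Hr; rewrite ltr_norml; apply/andP; split; lra.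
  by rewrite ltr_norml => /andP[h5 h6]; lra.
have T'xc : 0 < c - T' x by rewrite subr_gt0 (le_lt_trans T'x c0).
have [r r0 Hr] := T'c x _ T'xc; exists r => // u v h1 h2 h3 h4.
have uv : u <= v by lra.
have T'le t : u <= t -> t <= v -> `|T' t| <= c.
  move=> ut tv; have : `|T' t - T' x| < c - T' x by apply: Hr; rewrite ltr_norml; apply/andP; split; lra.
  rewrite ler_norml ltr_norml => /andP[h5 h6].
  by have := T'gt t; move=> h7; apply/andP; split; lra.
have Tcont : continuous T by move=> t; apply/rcontP; exact: (is_derive_rcont (dT t)).
have [t0 t0uv Tmin] : exists2 t0, t0 \in `[u, v]%R & forall t, t \in `[u, v]%R -> T t0 <= T t.
  by apply: EVT_min => //; exact: continuous_subspaceT.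
have lip s t : u <= s -> s <= t -> t <= v -> `|T t - T s| <= c * (v - u).
  move=> us st tv.
  have [z zst ->] : exists2 z, z \in `[s, t]%R & T t - T s = T' z * (t - s).
    by apply: MVT_segment => //; exact: continuous_subspaceT.
  move: zst; rewrite in_itv /= => /andP[sz zt].
  rewrite normrM ler_pM ?normr_ge0//; first by rewrite T'le//; lra.
  by rewrite ger0_norm; lra.
have range t : u <= t -> t <= v -> T t0 <= T t <= T t0 + c * (v - u).
  move=> ut tv; rewrite Tmin ?in_itv/= ?ut//=.
  move: t0uv; rewrite in_itv /= => /andP[ut0 t0v].
  have [tt0|/ltW tt0] := leP t t0.
    by have := lip t t0 ut tt0 t0v; rewrite ler_norml => /andP[h5 h6]; lra.
  by have := lip t0 t ut0 tt0 tv; rewrite ler_norml => /andP[h5 h6]; lra.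
(* On [u, v] the values of T fill at most a length c (v - u). A spoiled level m comes with an
   integer j = m + k P confined to an interval of length D; there are at most 1 + D such integers,
   and j modulo P recovers m. *)
exists 1%N => P P0.
have P0' : 0 < P%:R :> R by rewrite ltr0n.
have /choice[j Hj] : forall m : 'I_P, exists j : int, m \in bad_levels P u v ->
    (exists k : int, j = m%:Z + k * P%:Z) /\ exists t, [/\ u <= t, t <= v & T t * P%:R / pi = j%:~R].
  move=> m; have [mb|mb] := boolP (m \in bad_levels P u v); last by exists 0.
  move: (mb); rewrite inE => /asboolP[t [k [ut tv _ Tt]]].
  exists (m%:Z + k * P%:Z) => _; split; first by exists k.
  exists t; split => //; rewrite Tt rmorphD rmorphM /= -!pmulrn.
  have Pn0 := lt0r_neq0 P0'; move: (pi : R) (lt0r_neq0 pi0) => p pn0.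
  by field; rewrite pn0 Pn0.
pose j0 := Num.ceil (T t0 * P%:R / pi).
pose D := c * (v - u) * P%:R / pi.
have D0 : 0 <= D by rewrite /D divr_ge0 ?mulr_ge0 ?(ltW c0) ?(ltW pi0)//; lra.
have jrange m : m \in bad_levels P u v -> j0 <= j m /\ (j m)%:~R - j0%:~R <= D.
  move=> /Hj[_ [t [ut tv jE]]]; have /andP[r1 r2] := range t ut tv.
  have e1 : T t0 * P%:R / pi <= (j m)%:~R.
    by rewrite -jE ler_pM2r ?invr_gt0// ler_pM2r.
  split; first by rewrite /j0 ceil_le_int.
  have := ceil_ge (T t0 * P%:R / pi); rewrite -/j0 => e2.
  suff : (j m)%:~R <= T t0 * P%:R / pi + D by lra.
  by rewrite -jE /D -mulrDl -mulrDl ler_pM2r ?invr_gt0// ler_pM2r.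
pose N := Num.truncn D.
have fP m : m \in bad_levels P u v -> (absz (j m - j0) < N.+1)%N.
  move=> /jrange[h5 h6]; rewrite ltnS /N.
  have e1 : (`|j m - j0|%N)%:R = (j m)%:~R - j0%:~R :> R.
    by rewrite -rmorphB /= natr_absz ger0_norm// subr_ge0.
  by rewrite truncn_ge_nat// e1.
pose f (m : 'I_P) : 'I_N.+1 := inord (absz (j m - j0)).
have finj : {in bad_levels P u v &, injective f}.
  move=> m1 m2 b1 b2 /(congr1 val); rewrite /f /= !inordK ?fP// => h.
  have [h5 _] := jrange _ b1; have [h6 _] := jrange _ b2.
  have jE : j m1 = j m2.
    by apply/eqP; rewrite -(inj_eq (addIr (- j0))) -[j m1 - j0]gez0_abs ?subr_ge0// h gez0_abs ?subr_ge0.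
  have [[k1 E1] _] := Hj _ b1; have [[k2 E2] _] := Hj _ b2.
  apply: ord_inj; have l1 := ltn_ord m1; have l2 := ltn_ord m2.
  have := congr1 (fun i => (i %% P%:Z)%Z) jE.
  by rewrite E1 E2 ![_%:Z + _]addrC !modzMDl !modz_nat !modn_small// => -[].
rewrite -(card_in_imset finj).
apply: (@le_trans _ _ (N.+1%:R)).
  by rewrite ler_nat; apply: leq_trans (max_card _) _; rewrite card_ord.
by rewrite -nat1r lerD2l -/D /N truncn_le.
Qed.

(** Chaining the local counts over [0, 2 pi] leaves at most C + 2 c P spoiled levels out of P. As C
    does not depend on P and 2 c < 1, any P > C / (1 - 2 c) leaves one unspoiled. *)
Lemma exists_good_level :
  (forall t : R, is_derive t (1 : R) T (T' t)) -> (forall t, rcont T' t) ->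
  0 < c -> 2 * c < 1 -> (forall t, - c < T' t) ->
  exists phi : R, forall t (k : int), 0 <= t -> t <= 2 * pi ->
  T t = phi + pi * k%:~R -> 0 < T' t.
Proof.
move=> dT T'c c0 c12 T'gt; have pi0 := pi_gt0 R.
pose Q (a b : R) := exists C : nat, forall P, (0 < P)%N ->
  #|bad_levels P a b|%:R <= C%:R + c * (b - a) * P%:R / pi.
have [C HC] : Q 0 (2 * pi).
  apply: additive_of_local; first by lra.
  - move=> x y z xy yz [C1 H1] [C2 H2]; exists (C1 + C2)%N => P P0.
    apply: (@le_trans _ _ (#|bad_levels P x y|%:R + #|bad_levels P y z|%:R)).
      rewrite -natrD ler_nat; apply: leq_trans (leq_card_setU _ _).
      apply/subset_leq_card/fintype.subsetP => m; rewrite inE => /asboolP[t [k [xt tz t1 t2]]].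
      apply/finset.setUP; have [ty|/ltW yt] := leP t y; [left|right];
        by rewrite inE; apply/asboolP; exists t, k.
    apply: le_trans (lerD (H1 _ P0) (H2 _ P0)) _.
    rewrite natrD le_eqVlt; apply/orP; left; apply/eqP.
    by move: (pi : R) (lt0r_neq0 pi0) => p pn0; field.
  - by move=> x _ _; exact: bad_levels_local.
pose P := (Num.truncn (C%:R / (1 - 2 * c))).+1.
have [m mP] : exists m : 'I_P, m \notin bad_levels P 0 (2 * pi).
  apply/existsP; rewrite -negb_forall; apply/negP => /forallP h.
  have : #|bad_levels P 0 (2 * pi)| = P.
    by rewrite (_ : bad_levels _ _ _ = finset.setT) ?cardsT ?card_ord//; apply/setP => m; rewrite h inE.
  have := HC P isT; move=> /[swap] ->.
  have : C%:R / (1 - 2 * c) < P%:R.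
    by rewrite truncnS_gt.
  rewrite ltr_pdivrMr; last by lra.
  rewrite subr0 (_ : c * (2 * pi) * P%:R / pi = 2 * c * P%:R); last first.
    by move: (pi : R) (lt0r_neq0 pi0) => p pn0; field.
  by lra.
exists (pi * (m%:R / P%:R)) => t k t0 t1 Tt; rewrite ltNge; apply: contraNN mP => T't.
by rewrite inE; apply/asboolP; exists t, k; split => //; rewrite mulrDr.
Qed.
End GoodLevel.

Section TwoCrossings.
Context {R : realType}.
Implicit Types (T : R -> R).

Lemma periodic_int (U : Type) (T : R -> U) p (j : int) x : (forall x, T (x + p) = T x) -> T (x + p * j%:~R) = T x.
Proof.
move=> Tp.
have H n y : T (y + p * n%:R) = T y.
  by elim: n => [|n IH]; rewrite ?mulr0 ?addr0// -natr1 mulrDr mulr1 addrA Tp.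
case: j => n; first exact: H.
by rewrite NegzE rmorphN /= mulrN -pmulrn -[in RHS](subrK (p * n.+1%:R) x) H.
Qed.

Lemma shift_into (p a x : R) : 0 < p -> exists j : int, a <= x + p * j%:~R < a + p.
Proof.
move=> p0; exists (- Num.floor ((x - a) / p)).
have := floor_itv ((x - a) / p); rewrite rmorphN /= rmorphD /= => /andP[].
rewrite ler_pdivlMr// ltr_pdivrMr// => h1 h2; apply/andP; split; lra.
Qed.

(** The values phi, phi + pi and phi + 2 pi are each taken exactly once, at t1, t2 and t1 + 2 pi.
    Between consecutive crossings T - phi is confined to (0, pi), then to (pi, 2 pi), which decides
    the sign of the sine. *)
Lemma two_crossings T (T' : R -> R) c :
  (forall t : R, is_derive t (1 : R) T (T' t)) -> (forall t, rcont T' t) ->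
  0 < c -> 2 * c < 1 -> (forall t, - c < T' t) ->
  (forall t, T (t + 2 * pi) = T t + 2 * pi) -> (forall t, T' (t + 2 * pi) = T' t) ->
  exists phi t1 t2, [/\ t1 < t2, t2 < t1 + 2 * pi,
    forall t, t1 < t -> t < t2 -> 0 < sin (T t - phi) &
    forall t, t2 < t -> t < t1 + 2 * pi -> sin (T t - phi) < 0].
Proof.
move=> dT cT' c0 c12 T'gt Tp T'p; have pi0 := pi_gt0 R; have pi20 : 0 < 2 * pi :> R by lra.
have [phi Hphi] := exists_good_level dT cT' c0 c12 T'gt.
have Tpj (j : int) t : T (t + 2 * pi * j%:~R) = T t + 2 * pi * j%:~R.
  pose g t := T t - t.
  have gp s : g (s + 2 * pi) = g s by rewrite /g Tp; ring.
  by have := periodic_int j t gp; rewrite /g => /eqP; rewrite subr_eq => /eqP ->; ring.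
have up (k : int) t : T t = phi + pi * k%:~R -> local_incr T t.
  move=> Tt; apply: is_derive_local_incr (dT t) _.
  (* The good level is known on one period only; translation by 2 pi j replaces k by k + 2 j. *)
  have [j /andP[j1 j2]] := shift_into 0 t pi20.
  rewrite -(periodic_int j t T'p); apply: (Hphi _ (k + 2 * j)) => //; first by lra.
  by rewrite Tpj Tt rmorphD rmorphM /=; ring.
have cT t : rcont T t := is_derive_rcont (dT t).
have ex (k : int) : exists t, T t = phi + pi * k%:~R.
  set psi := phi + _.
  (* j1 is chosen so that psi lies between the values of T at the consecutive multiples 2 pi j1 and
     2 pi (j1 + 1). *)
  have [j1 /andP[a1 b1]] := shift_into (psi - T 0 - 2 * pi) 0 pi20.
  rewrite add0r in a1 b1.
  have [||t _ Tt] := @ivt_eq R T psi cT (2 * pi * j1%:~R) (2 * pi * (j1 + 1)%:~R).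
  - by rewrite ler_pM2l// ler_int; lia.
  - have -> : T (2 * pi * j1%:~R) = T 0 + 2 * pi * j1%:~R by rewrite -Tpj add0r.
    have -> : T (2 * pi * (j1 + 1)%:~R) = T 0 + 2 * pi * (j1 + 1)%:~R by rewrite -Tpj add0r.
    have -> : (j1 + 1)%:~R = j1%:~R + 1 :> R by rewrite rmorphD.
    nra.
  by exists t.
have [t1 T1] := ex 0; rewrite -[0%:~R]/(0 : R) mulr0 addr0 in T1.
have [t2 T2] := ex 1; rewrite -[1%:~R]/(1 : R) mulr1 in T2.
have T3 : T (t1 + 2 * pi) = phi + pi * 2%:~R by rewrite Tp T1; ring.
have up1 t : T t = phi -> local_incr T t by move=> h; apply: (up 0); rewrite -[0%:~R]/(0 : R) mulr0 addr0.
have up2 t : T t = phi + pi -> local_incr T t by move=> h; apply: (up 1); rewrite -[1%:~R]/(1 : R) mulr1.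
exists phi, t1, t2; split.
- rewrite ltNge; apply/negP; rewrite le_eqVlt => /orP[/eqP h|].
    by move: T1; rewrite -h T2; lra.
  by move=> /(crossing_lt cT up1 T1); rewrite T2; lra.
- rewrite ltNge; apply/negP; rewrite le_eqVlt => /orP[/eqP h|].
    by move: T2; rewrite -h T3; rewrite -[2%:~R]/(2%:R : R); lra.
  move=> /(crossing_gt cT (@up 2) T3); rewrite T2 -[2%:~R]/(2%:R : R); lra.
- move=> t tt1 tt2; apply: sin_gt0_pi.
  have h1 := crossing_gt cT up1 T1 tt1; have h2 := crossing_lt cT up2 T2 tt2; apply/andP; split; lra.
- move=> t tt2 tt1.
  have h1 := crossing_gt cT up2 T2 tt2; have h2 := crossing_lt cT (@up 2) T3 tt1.
  rewrite -[2%:~R]/(2%:R : R) in h2.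
  rewrite (_ : T t - phi = (T t - phi - pi) + pi); last by ring.
  rewrite sinDpi oppr_lt0; apply: sin_gt0_pi; apply/andP; split; lra.
Qed.

End TwoCrossings.

(** * Arguments along circles *)

Section Circle.
Context {R : realType}.
Implicit Types (z w : R[i]) (t : R).

Definition cis t : R[i] := cos t +i* sin t.

Lemma normc_cis t : normc (cis t) = 1.
Proof. by rewrite /= cos2Dsin2 sqrtr1. Qed.

Lemma cisD s t : cis (s + t) = cis s * cis t.
Proof. by rewrite /cis cosD sinD; apply: eq_ReIm; rewrite !ReImE /=; ring. Qed.

Lemma cisN t : cis (- t) = (cis t)^*.
Proof. by rewrite /cis cosN sinN. Qed.

Lemma cis2pi t : cis (t + 2 * pi) = cis t.
Proof. by rewrite /cis mulr_natl sinD2pi cosD2pi. Qed.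

Lemma cis_neq0 t : cis t != 0.
Proof. by rewrite -normc_eq0 normc_cis oner_eq0. Qed.

Lemma cis_conj t : cis t * (cis t)^* = 1.
Proof.
by apply: eq_ReIm; rewrite !ReImE /=; [rewrite -(cos2Dsin2 t)|]; ring.
Qed.

Lemma polar z : exists t, z = (normc z)%:C * cis t.
Proof.
have [->|z0] := eqVneq z 0; first by exists 0; rewrite Normc.normc0 mul0r.
have n0 : 0 < normc z by rewrite normc_gt0.
pose x := Re z / normc z; pose y := Im z / normc z.
have xy : x ^+ 2 + y ^+ 2 = 1.
  by rewrite /x /y !expr_div_n -mulrDl -sqr_normc_ReIm divff// expf_neq0// gt_eqF.
have x1 : -1 <= x <= 1 by rewrite -ler_norml -(@ler_sqr _ `|x|) ?nnegrE// expr1n real_normK ?num_real//; nra.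
have yE : `|y| = sin (acos x).
  rewrite sin_acos// -(sqrtr_sqr y); congr Num.sqrt; lra.
have [y0|y0] := leP 0 y.
  exists (acos x); apply: eq_ReIm; rewrite !ReImE /= mul0r ?subr0 ?addr0.
    by rewrite acosK ?in_itv//= /x; field; rewrite gt_eqF.
  by rewrite -yE ger0_norm// /y; field; rewrite gt_eqF.
exists (- acos x); apply: eq_ReIm; rewrite !ReImE /= mul0r ?subr0 ?addr0.
  by rewrite cosN acosK ?in_itv//= /x; field; rewrite gt_eqF.
by rewrite sinN -yE ltr0_norm// /y; field; rewrite gt_eqF.
Qed.

Lemma polar_from (a : R) z : exists t, a <= t < a + 2 * pi /\ z = (normc z)%:C * cis t.
Proof.
have [t zE] := polar z; have pi0 := pi_gt0 R.
have [|j hj] := @shift_into R (2 * pi) a t; first by lra.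
exists (t + 2 * pi * j%:~R); split => //.
by rewrite (periodic_int _ _ cis2pi).
Qed.

End Circle.

Section Curves.
Context {R : realType}.
Implicit Types (z w l : R[i]) (f g : R[i] -> R[i]) (u v c : R -> R[i]) (t : R).

(** Componentwise, so that the rules for real derivatives apply; [cvderiv_eps] gives the equivalent
    estimate needed for compositions. *)
Definition cvderiv c t l :=
  is_derive t (1 : R) (fun s => Re (c s)) (Re l) /\ is_derive t (1 : R) (fun s => Im (c s)) (Im l).

Lemma cvderiv_eps c t l : cvderiv c t l <->
  forall e : R, 0 < e -> exists2 r : R, 0 < r &
  forall s : R, `|s - t| < r -> normc (c s - c t - l * (s - t)%:C) <= e * `|s - t|.
Proof.
split=> [[dR dI] e e0|H].
  have e20 : 0 < e / 2 by lra.
  have [r1 r10 H1] := is_derive_eps dR e20; have [r2 r20 H2] := is_derive_eps dI e20.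
  exists (Num.min r1 r2); first by rewrite lt_min r10.
  move=> s; rewrite lt_min => /andP[/H1 {}H1 /H2 {}H2].
  apply: le_trans (normc_ReDIm _) _; rewrite !ReImE /= !mulr0 subr0 add0r.
  by lra.
have aux (T : R -> R) (k : R) :
    (forall e, 0 < e -> exists2 r : R, 0 < r &
      forall s, `|s - t| < r -> `|T s - T t - k * (s - t)| <= e * `|s - t|) ->
    is_derive t (1 : R) T k.
  move=> HT.
  have lim : (fun h => h^-1 *: ((T \o shift t) (h *: (1 : R)) - T t)) @ 0^' --> k.
    apply/cvgrPdist_lt => e e0; have e20 : 0 < e / 2 by lra.
    have [r r0 Hr] := HT _ e20; apply/nbhs_ballP; exists r => // h.
    rewrite /ball /= sub0r normrN => hr h0.
    have := Hr (h + t); rewrite addrK => /(_ hr).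
    have nh : 0 < `|h| by rewrite normr_gt0.
    rewrite /= [h%:A]mulr1 [_ *: _]/GRing.scale/= => {}Hr.
    rewrite -(@ltr_pM2r _ `|h|)// -normrM.
    rewrite (_ : _ * _ = - (T (h + t) - T t - k * h)) ?normrN; last by field.
    by apply: le_lt_trans Hr _; rewrite ltr_pM2r//; lra.
  split; first by apply/cvg_ex; exists k; exact: lim.
  exact: (cvg_lim _ lim).
split; apply: aux => e /H[r r0 Hr]; exists r => // s /Hr; apply: le_trans.
  apply: le_trans (normc_Re _); rewrite !ReImE /= mulr0 subr0 le_eqVlt; apply/orP; left; apply/eqP.
  by congr `|_|; ring.
apply: le_trans (normc_Im _); rewrite !ReImE /= mulr0 add0r le_eqVlt; apply/orP; left; apply/eqP.
by congr `|_|; ring.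
Qed.

Lemma cvderiv_comp c f t l k : cvderiv c t l -> cderiv f (c t) k ->
  cvderiv (f \o c) t (k * l).
Proof.
move=> /cvderiv_eps Hc Hf; apply/cvderiv_eps => e e0.
pose L := normc l + 1; pose K := normc k + 1.
have L0 : 0 < L by rewrite ltr_wpDl ?normc_ge0.
have K0 : 0 < K by rewrite ltr_wpDl ?normc_ge0.
have e1 : 0 < e / 2 / L by rewrite !divr_gt0.
have e2 : 0 < e / 2 / K by rewrite !divr_gt0.
have [r1 r10 H1] := Hf _ e1; have [r2 r20 H2] := Hc _ e2; have [r3 r30 H3] := Hc _ ltr01.
exists (Num.min (r1 / L) (Num.min r2 r3)); first by rewrite !lt_min r20 r30 divr_gt0.
move=> s; rewrite !lt_min ltr_pdivlMr// => /and3P[s1 /H2 s2 /H3 s3].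
have lip : normc (c s - c t) <= L * `|s - t|.
  rewrite (_ : c s - c t = (c s - c t - l * (s - t)%:C) + l * (s - t)%:C); last by ring.
  by apply: le_trans (normcD _ _) _; rewrite Normc.normcM normc_real /L; lra.
have h1 := H1 (c s); have {}h1 := h1 _.
have cs : normc (c s - c t) < r1 by apply: le_lt_trans lip _; rewrite mulrC.
rewrite (_ : _ - _ = (f (c s) - f (c t) - k * (c s - c t)) +
  k * (c s - c t - l * (s - t)%:C)); last by rewrite /=; ring.
apply: le_trans (normcD _ _) _; rewrite Normc.normcM.
have q1 : normc (f (c s) - f (c t) - k * (c s - c t)) <= e / 2 * `|s - t|.
  apply: le_trans (h1 cs) _; apply: le_trans (ler_wpM2l (ltW e1) lip) _.
  by rewrite mulrA divfK ?gt_eqF.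
have q2 : normc k * normc (c s - c t - l * (s - t)%:C) <= e / 2 * `|s - t|.
  apply: (@le_trans _ _ (K * (e / 2 / K * `|s - t|))).
    by apply: ler_pM => //; rewrite ?normc_ge0// lerDl.
  by rewrite mulrA mulrCA divff ?mulr1// gt_eqF.
by lra.
Qed.

Lemma cvderiv_circle r t : cvderiv (fun s => r%:C * cis s) t (r%:C * ('i * cis t)).
Proof.
split.
  rewrite (_ : (fun s => _) = (fun s => r * cos s)); last first.
    by apply/funext => s; rewrite !ReImE /=; ring.
  rewrite (_ : Re _ = r * - sin t); last by rewrite !ReImE /=; ring.
  by apply: is_deriveZ.
rewrite (_ : (fun s => _) = (fun s => r * sin s)); last first.
  by apply/funext => s; rewrite !ReImE /=; ring.
rewrite (_ : Im _ = r * cos t); last by rewrite !ReImE /=; ring.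
by apply: is_deriveZ.
Qed.

Lemma cvderivB u v t k l : cvderiv u t k -> cvderiv v t l ->
  cvderiv (fun s => u s - v s) t (k - l).
Proof.
move=> [u1 u2] [v1 v2]; split; rewrite !ReImE.
  rewrite (_ : (fun s => _) = (fun s => Re (u s)) - (fun s => Re (v s))).
    exact: is_deriveB.
  by apply/funext => s; rewrite !ReImE.
rewrite (_ : (fun s => _) = (fun s => Im (u s)) - (fun s => Im (v s))).
  exact: is_deriveB.
by apply/funext => s; rewrite !ReImE.
Qed.

Lemma cvderiv_conj u t k : cvderiv u t k -> cvderiv (fun s => (u s)^*%C) t k^*%C.
Proof.
move=> [u1 u2]; split; rewrite !ReImE.
  by rewrite (_ : (fun s => _) = (fun s => Re (u s)))//; apply/funext => s; rewrite ReImE.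
rewrite (_ : (fun s => _) = - (fun s => Im (u s))); first exact: is_deriveN.
by apply/funext => s; rewrite ReImE.
Qed.

Definition lifted c (a : R -> R) := forall t, c t = (normc (c t))%:C * cis (a t).

Lemma liftedM u v a b : lifted u a -> lifted v b ->
  lifted (fun t => u t * v t) (fun t => a t + b t).
Proof.
move=> Hu Hv t; rewrite {1}Hu {1}Hv Normc.normcM rmorphM /= cisD; ring.
Qed.

(** Differentiating the identity sin a Re c - cos a Im c = 0 yields the derivative of the argument
    without choosing a branch. *)
Lemma lifted_derive c a t l (k : R) : (forall t, c t != 0) -> lifted c a -> cvderiv c t l ->
  is_derive t (1 : R) a k -> k = Im (l * (c t)^*%C) / (normc (c t) ^+ 2).
Proof.
move=> c0 H [d1 d2] da.
pose F s := sin (a s) * Re (c s) - cos (a s) * Im (c s).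
have F0 : F = cst 0.
  apply/funext => s; rewrite /F /= (H s) !ReImE /=; ring.
have ds : is_derive t (1 : R) (sin \o a) (cos (a t) * k) by apply: is_derive1_comp.
have dc : is_derive t (1 : R) (cos \o a) (- sin (a t) * k) by apply: is_derive1_comp.
have dF : is_derive t (1 : R) F ((sin (a t) * Re l + Re (c t) * (cos (a t) * k)) -
    (cos (a t) * Im l + Im (c t) * (- sin (a t) * k))).
  exact: (is_deriveB (is_deriveM ds d1) (is_deriveM dc d2)).
have := @derive_val _ _ _ _ _ _ _ dF; rewrite F0 derive_cst => /esym E.
have n0 : 0 < normc (c t) by rewrite normc_gt0.
have n2 : normc (c t) ^+ 2 != 0 by rewrite expf_neq0// gt_eqF.
apply: (mulIf n2); rewrite divfK//.
have hR : Re (c t) = normc (c t) * cos (a t) by rewrite {1}H !ReImE /=; ring.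
have hI : Im (c t) = normc (c t) * sin (a t) by rewrite {1}H !ReImE /=; ring.
move: E; rewrite !ReImE hR hI; move: (normc (c t)) => N E.
have := cos2Dsin2 (a t); move: E; move: (cos (a t)) (sin (a t)) => C S E CS.
have E2 : Im l * C - Re l * S = N * k * (C ^+ 2 + S ^+ 2) by lra.
rewrite CS in E2; rewrite (_ : _ + _ = N * (Im l * C - Re l * S)); last by ring.
by rewrite E2; ring.
Qed.

Lemma lifted_atan c : (forall t, 0 < Re (c t)) ->
  lifted c (fun t => atan (Im (c t) / Re (c t))).
Proof.
move=> c0 t; set x := Re (c t); set y := Im (c t).
have x0 : 0 < x := c0 t.
have n0 : 0 < normc (c t).
  by rewrite normc_gt0; apply: contraTneq x0 => h; rewrite /x h /= ltxx.
have nE : normc (c t) ^+ 2 = x ^+ 2 + y ^+ 2 := sqr_normc_ReIm _.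
have co : 0 < cos (atan (y / x)) by apply: cos_gt0_pihalf; rewrite atan_gtNpi2 atan_ltpi2.
have ta : sin (atan (y / x)) = y / x * cos (atan (y / x)).
  by have := atanK (y / x); rewrite /tan => {2}<-; rewrite divfK// gt_eqF.
have : (x / normc (c t)) ^+ 2 = cos (atan (y / x)) ^+ 2.
  have := cos2Dsin2 (atan (y / x)); rewrite ta exprMn => h.
  have h2 : cos (atan (y / x)) ^+ 2 * (1 + (y / x) ^+ 2) = 1 by rewrite -[RHS]h; ring.
  have p0 : 1 + (y / x) ^+ 2 != 0 by rewrite gt_eqF// ltr_wpDr ?sqr_ge0.
  apply: (mulIf p0); rewrite h2 expr_div_n nE; field.
  by rewrite -nE expf_neq0 ?gt_eqF.
move=> /eqP; rewrite eqf_sqr => /orP[/eqP h|/eqP h]; last first.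
  have : 0 < x / normc (c t) by rewrite divr_gt0.
  by rewrite h oppr_gt0 ltNge ltW.
apply: eq_ReIm; rewrite !ReImE /= ta -h mul0r.
  by rewrite -/x; field; rewrite gt_eqF.
by rewrite -/y; field; rewrite !gt_eqF.
Qed.

Lemma derive_atan_ratio c t l : 0 < Re (c t) -> cvderiv c t l ->
  exists k : R, is_derive t (1 : R) (fun t => atan (Im (c t) / Re (c t))) k.
Proof.
move=> c0 [d1 d2].
have dV := is_deriveV (lt0r_neq0 c0) d1.
have dM := is_deriveM d2 dV.
eexists; exact: (is_derive1_comp (is_derive1_atan _) dM).
Qed.

End Curves.

(** * Periodic arguments of nonvanishing functions on circles *)

Section CircleLift.
Context {R : realType}.
Implicit Types (z w l : R[i]) (f g H : R[i] -> R[i]) (u v c : R -> R[i]) (t : R).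

Lemma cderiv_mulX f z l : cderiv f z l -> cderiv (fun w => w * f w) z (f z + z * l).
Proof.
move=> Hf e e0; pose L := normc l + 1; pose Z := normc z + 1.
have L0 : 0 < L by rewrite ltr_wpDl ?normc_ge0.
have Z0 : 0 < Z by rewrite ltr_wpDl ?normc_ge0.
have e1 : 0 < e / 2 / Z by rewrite !divr_gt0.
have [d d0 Hd] := Hf _ e1.
exists (Num.min d (Num.min 1 (e / 2 / L))); first by rewrite !lt_min d0 ltr01 !divr_gt0.
move=> w; rewrite !lt_min => /and3P[/Hd {}Hd w1 w2].
rewrite (_ : _ - _ - _ = w * (f w - f z - l * (w - z)) + l * (w - z) * (w - z)); last by ring.
apply: le_trans (normcD _ _) _; rewrite !Normc.normcM.
have wZ : normc w <= Z.
  rewrite (_ : w = z + (w - z)); last by ring.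
  by apply: le_trans (normcD _ _) _; rewrite /Z lerD2l ltW.
have q1 : normc w * normc (f w - f z - l * (w - z)) <= e / 2 * normc (w - z).
  apply: le_trans (ler_pM (normc_ge0 _) (normc_ge0 _) wZ Hd) _.
  by rewrite mulrA mulrCA divff ?mulr1// gt_eqF.
have q2 : normc l * normc (w - z) * normc (w - z) <= e / 2 * normc (w - z).
  rewrite ler_wpM2r ?normc_ge0//; apply: (@le_trans _ _ (L * (e / 2 / L))).
    by apply: ler_pM; rewrite ?normc_ge0// ?lerDl// ltW.
  by rewrite mulrCA divff ?mulr1// gt_eqF.
by lra.
Qed.

(** The derivative is described only after multiplication by z, which avoids the exponent n - 1 and
    suffices on circles, whose tangent at z is i z. *)
Lemma cderiv_mulXn f z l n : cderiv f z l -> exists2 k,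
  cderiv (fun w => w ^+ n * f w) z k & z * k = z ^+ n * (n%:R * f z + z * l).
Proof.
move=> Hf; elim: n => [|n [k Hk kE]].
  exists l; last by rewrite expr0 mul0r add0r mul1r.
  by rewrite (_ : (fun w => _) = f)//; apply/funext => w; rewrite expr0 mul1r.
exists (z ^+ n * f z + z * k); last by rewrite kE exprS -natr1; ring.
rewrite (_ : (fun w => _) = (fun w => w * (w ^+ n * f w))); first exact: cderiv_mulX.
by apply/funext => w; rewrite exprS mulrA.
Qed.

Lemma cvderivM u v t k l : cvderiv u t k -> cvderiv v t l ->
  cvderiv (fun s => u s * v s) t (u t * l + v t * k).
Proof.
move=> [u1 u2] [v1 v2]; split; rewrite !ReImE.
  rewrite (_ : (fun s => _) = (fun s => Re (u s)) * (fun s => Re (v s)) -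
    (fun s => Im (u s)) * (fun s => Im (v s))).
    apply: is_derive_eq (is_deriveB (is_deriveM u1 v1) (is_deriveM u2 v2)) _.
    by rewrite /GRing.scale/=; ring.
  by apply/funext => s; rewrite !ReImE.
rewrite (_ : (fun s => _) = (fun s => Re (u s)) * (fun s => Im (v s)) +
    (fun s => Im (u s)) * (fun s => Re (v s))).
  apply: is_derive_eq (is_deriveD (is_deriveM u1 v2) (is_deriveM u2 v1)) _.
  by rewrite /GRing.scale/=; ring.
by apply/funext => s; rewrite !ReImE.
Qed.

Lemma normcJM z : z * z^*%C = (normc z ^+ 2)%:C.
Proof. by rewrite sqr_normc_ReIm; apply: eq_ReIm; rewrite !ReImE /=; ring. Qed.

(** v is a positive multiple of u (v conj u), so the two arguments add up. *)
Lemma lifted_divJ u v a b : (forall t, u t != 0) -> lifted u a ->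
  lifted (fun t => v t * (u t)^*%C) b -> lifted v (fun t => a t + b t).
Proof.
move=> u0 Hu Hv t; have n0 : 0 < normc (u t) by rewrite normc_gt0.
have nC : ((normc (u t) ^+ 2)%:C : R[i]) != 0 by rewrite eq_complex /= eqxx andbT expf_neq0 ?gt_eqF.
apply: (mulIf nC).
transitivity ((normc (v t) * normc (u t))%:C * cis (b t) * ((normc (u t))%:C * cis (a t))).
  by rewrite -(normcJM (u t)) -(Hu t) -(normc_conj (u t)) -Normc.normcM -(Hv t); ring.
by rewrite cisD expr2 !rmorphM /=; ring.
Qed.

Lemma normc_i : normc ('i : R[i]) = 1.
Proof. by rewrite /= expr0n expr1n add0r sqrtr1. Qed.

Lemma cis_near t0 (e : R) : 0 < e -> exists2 d : R, 0 < d &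
  forall t, `|t - t0| < d -> normc (cis t - cis t0) < e.
Proof.
move=> e0; have : cvderiv cis t0 ('i * cis t0).
  have := cvderiv_circle 1 t0; rewrite rmorph1 mul1r.
  by rewrite (_ : (fun s => _) = cis)//; apply/funext => s; rewrite mul1r.
move=> /cvderiv_eps/(_ 1 ltr01)[d d0 Hd].
exists (Num.min d (e / 2)); first by rewrite lt_min d0 divr_gt0.
move=> t; rewrite lt_min => /andP[/Hd]; rewrite mul1r => h h2.
rewrite (_ : _ - _ = (cis t - cis t0 - 'i * cis t0 * (t - t0)%:C) +
   'i * cis t0 * (t - t0)%:C); last by ring.
apply: le_lt_trans (normcD _ _) _.
rewrite !Normc.normcM normc_cis normc_real normc_i !mul1r.
by lra.
Qed.

(** Periodicity of [A] expresses that f has winding number 0 along the circle. *)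
Definition lift_on_circle f (r : R) := exists A : R -> R,
  [/\ forall t, A (t + 2 * pi) = A t, lifted (fun t => f (r%:C * cis t)) A &
      forall t, exists k : R, is_derive t (1 : R) A k].

(** At each angle the values of f on the two circles differ by less than a quarter turn, so the
    change of argument is an arctangent, automatically differentiable and periodic. *)
Lemma lift_transfer f (r s : R) :
  (forall t, f (r%:C * cis t) != 0) ->
  (forall t, exists l, cderiv f (r%:C * cis t) l) ->
  (forall t, exists l, cderiv f (s%:C * cis t) l) ->
  (forall t, 0 < Re (f (s%:C * cis t) * (f (r%:C * cis t))^*%C)) ->
  lift_on_circle f r -> lift_on_circle f s.
Proof.
move=> f0 dr ds pos [A [Ap HA dA]].
pose q t := f (s%:C * cis t) * (f (r%:C * cis t))^*%C.
exists (fun t => A t + atan (Im (q t) / Re (q t))); split.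
- by move=> t; rewrite Ap /q cis2pi.
- exact: (lifted_divJ f0 HA (lifted_atan pos)).
- move=> t; have [k Hk] := dA t; have [l Hl] := dr t; have [m Hm] := ds t.
  have c1 := cvderiv_comp (cvderiv_circle r t) Hl.
  have c2 := cvderiv_comp (cvderiv_circle s t) Hm.
  have [k2 Hk2] := derive_atan_ratio (pos t) (cvderivM c2 (cvderiv_conj c1)).
  by exists (k + k2); exact: is_deriveD.
Qed.

Lemma Re_mulJ_pos z w k : normc (z - k) < normc k / 4 -> normc (w - k) < normc k / 4 ->
  0 < Re (z * w^*%C).
Proof.
move=> hz hw.
have wc : normc k <= normc w + normc (w - k).
  by rewrite {1}(_ : k = w - (w - k)) ?normcB//; ring.
have zw : normc (z - w) <= normc (z - k) + normc (w - k).
  by rewrite (_ : z - w = (z - k) - (w - k)) ?normcB//; ring.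
have -> : z * w^*%C = (z - w) * w^*%C + w * w^*%C by ring.
rewrite normcJM ReD /=.
have := normc_Re ((z - w) * w^*%C); rewrite Normc.normcM normc_conj ler_norml => /andP[h _].
have z0 := normc_ge0 (z - k); have w0 := normc_ge0 w.
have zw1 : normc (z - w) < normc w by lra.
have w1 : 0 < normc w by have := normc_ge0 (z - w); lra.
have : normc (z - w) * normc w < normc w ^+ 2 by rewrite expr2 ltr_pM2r.
by lra.
Qed.

(* The argument is transported radially from the centre, hence is periodic. *)
Lemma lift_circle_exists f (r : R) : 0 <= r ->
  (forall z, normc z <= r -> f z != 0) ->
  (forall z, normc z <= r -> exists l, cderiv f z l) -> lift_on_circle f r.
Proof.
move=> r0 f0 df; have pi0 := pi_gt0 R.
have inr (s : R) t : 0 <= s <= 1 -> normc ((s * r)%:C * cis t) <= r.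
  move=> /andP[s0 s1]; rewrite Normc.normcM normc_cis mulr1 normc_real ger0_norm ?mulr_ge0//.
  by rewrite ler_piMl.
(* The tolerance in the radius is uniform in the angle: it is found near each angle, chained over
   [0, 2 pi], and extended by periodicity. *)
have tube (x : R) : 0 <= x <= 1 -> exists2 e : R, 0 < e & forall t s, 0 <= s <= 1 ->
    `|s - x| < e -> normc (f ((s * r)%:C * cis t) - f ((x * r)%:C * cis t)) <
      normc (f ((x * r)%:C * cis t)) / 4.
  move=> x01; have /andP[x0 x1] := x01.
  pose Q (a b : R) := exists2 e : R, 0 < e & forall t s, a <= t -> t <= b -> 0 <= s <= 1 ->
    `|s - x| < e -> normc (f ((s * r)%:C * cis t) - f ((x * r)%:C * cis t)) <
      normc (f ((x * r)%:C * cis t)) / 4.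
  have [e e0 He] : Q 0 (2 * pi).
    apply: additive_of_local; first by lra.
    - move=> a b b' ab bc [e1 e10 H1] [e2 e20 H2]; exists (Num.min e1 e2); first by rewrite lt_min e10.
      move=> t s ta tc s01; rewrite lt_min => /andP[s1 s2].
      by have [tb|/ltW bt] := leP t b; [exact: H1|exact: H2].
    - move=> t0 _ _; set c0 := (x * r)%:C * cis t0.
      have [l Hl] := df c0 (inr _ _ x01).
      have M0 : 0 < normc (f c0) by rewrite normc_gt0 f0// inr.
      (* A tenth suffices: two errors of this size stay below a quarter of nine tenths of |f c0|. *)
      have M10 : 0 < normc (f c0) / 10 by lra.
      have [d d0 Hd] := cderiv_ccont Hl M10.
      have dr : 0 < d / 2 / (r + 1) by rewrite !divr_gt0//; lra.
      have [e e0 He] := cis_near t0 dr.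
      exists e => // a b h1 h2 h3 h4; exists (d / 2 / (r + 1)) => // t s at_ tb s01 sx.
      have ct : normc (cis t - cis t0) * (r + 1) < d / 2.
        by rewrite -ltr_pdivlMr; [apply: He; rewrite ltr_norml; apply/andP; split; lra|lra].
      have sx' : `|s - x| * (r + 1) < d / 2 by rewrite -ltr_pdivlMr//; lra.
      have near y : 0 <= y <= 1 -> `|y - x| <= `|s - x| ->
          normc (f ((y * r)%:C * cis t) - f c0) < normc (f c0) / 10.
        move=> y01 yx; apply: Hd.
        have -> : (y * r)%:C * cis t - c0 = (y - x)%:C * (r%:C * cis t) +
          x%:C * (r%:C * (cis t - cis t0)).
          by rewrite /c0 !rmorphM rmorphB /=; ring.
        apply: le_lt_trans (normcD _ _) _; rewrite !Normc.normcM !normc_real normc_cis mulr1.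
        rewrite (ger0_norm r0) (ger0_norm x0).
        have n1 := normr_ge0 (s - x); have n2 := normc_ge0 (cis t - cis t0).
        have n3 : `|y - x| * r <= `|s - x| * r by rewrite ler_wpM2r.
        have n4 : x * (r * normc (cis t - cis t0)) <= r * normc (cis t - cis t0).
          by rewrite ler_piMl// mulr_ge0.
        by lra.
      have a1 := near s s01 (lexx _); have a2 := near x x01.
      rewrite subrr normr0 in a2; have {}a2 := a2 (normr_ge0 _).
      set fx := f ((x * r)%:C * cis t) in a2 *; set fs := f ((s * r)%:C * cis t) in a1 *.
      have b1 : normc (fs - fx) <= normc (fs - f c0) + normc (fx - f c0).
        by rewrite (_ : fs - fx = (fs - f c0) - (fx - f c0)) ?normcB//; ring.
      have b2 : normc (f c0) <= normc fx + normc (fx - f c0).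
        by rewrite {1}(_ : f c0 = fx - (fx - f c0)) ?normcB//; ring.
      by lra.
  exists e => // t s s01 sx.
  have [|j /andP[j1 j2]] := @shift_into R (2 * pi) 0 t; first by lra.
  rewrite -(periodic_int j t cis2pi); apply: He => //; lra.
pose Q (a b : R) := 0 <= a -> b <= 1 -> lift_on_circle f (a * r) -> lift_on_circle f (b * r).
have : Q 0 1.
  apply: additive_of_local; first by lra.
  - move=> x y z xy yz h1 h2 x0 z1 Lx; apply: h2 => //; first by lra.
    by apply: h1 => //; lra.
  - move=> x x0 x1; have x01 : 0 <= x <= 1 by rewrite x0.
    have [e e0 He] := tube _ x01; exists e => // u v h1 h2 h3 h4 u0 v1.
    have u01 : 0 <= u <= 1 by rewrite u0; lra.
    have v01 : 0 <= v <= 1 by rewrite v1 andbT; lra.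
    apply: lift_transfer => t; do ?[apply: f0|apply: df]; rewrite ?inr//.
    apply: Re_mulJ_pos; apply: He => //; rewrite ltr_norml; apply/andP; split; lra.
rewrite /Q mul1r; apply => //.
have [t0 ft0] := polar (f 0).
exists (fun _ => t0); split => //.
  by move=> t /=; rewrite !mul0r.
by move=> t; exists 0; exact: is_derive_cst.
Qed.

End CircleLift.

(** * Turning of the tangent on the extremal circle *)

Section Boundary.
Context {R : realType}.
Implicit Types (z w l : R[i]) (t : R).

(* With E = A - conj B, the first factor on the right is E' along the circle, so the right-hand side
   is |E|^2 times the derivative of arg E; it is affine in Re (A B), hence least at -k |A|^2. *)
Lemma tangent_turning (A B P : R[i]) (n alpha k c : R) : normc B = k * normc A ->
  A != 0 -> 0 < k -> k < 1 -> alpha < Re P -> 0 <= n -> 2 * c <= n ->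
  c * (1 + k) = (1 - k) / 2 -> (alpha + 2^-1) * (1 - k) = n * k ->
  - c * normc (A - B^*%C) ^+ 2 <
  Im (('i * (A * P) - ('i * (B * (n%:C + P)))^*%C) * (A - B^*%C)^*%C).
Proof.
move=> BA A0 k0 k1 aP n0 cn ck ak.
have S0 : 0 < normc A ^+ 2 by rewrite exprn_gt0// normc_gt0.
have BE : normc B ^+ 2 = k ^+ 2 * normc A ^+ 2 by rewrite BA exprMn.
have XE : - (k * normc A ^+ 2) <= Re (A * B).
  have := normc_Re (A * B); rewrite ler_norml => /andP[h _].
  by move: h; rewrite Normc.normcM BA expr2 mulrCA.
have EE : normc (A - B^*%C) ^+ 2 = normc A ^+ 2 - 2 * Re (A * B) + normc B ^+ 2.
  by rewrite !sqr_normc_ReIm !ReImE; ring.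
have -> : Im (('i * (A * P) - ('i * (B * (n%:C + P)))^*%C) * (A - B^*%C)^*%C) =
    Re P * (normc A ^+ 2 - normc B ^+ 2) + n * (Re (A * B) - normc B ^+ 2).
  by rewrite !sqr_normc_ReIm !ReImE /=; ring.
rewrite EE BE; move: (normc A ^+ 2) (Re (A * B)) (Re P) S0 XE aP => S X p S0 XE aP.
rewrite -subr_gt0.
have -> : p * (S - k ^+ 2 * S) + n * (X - k ^+ 2 * S) - - c * (S - 2 * X + k ^+ 2 * S) =
  (n - 2 * c) * (X + k * S) + (p - alpha) * (S * (1 - k ^+ 2)) +
  S * (1 + k) * (alpha * (1 - k) - n * k + c * (1 + k)) by ring.
have -> : alpha * (1 - k) - n * k + c * (1 + k) = 0 by rewrite ck; lra.
rewrite mulr0 addr0 ltr_wpDl//; first by rewrite mulr_ge0//; lra.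
by rewrite mulr_gt0 ?mulr_gt0//; [lra|rewrite subr_gt0 expr_lt1// ltW].
Qed.

Lemma turning_continuous (V E : R -> R[i]) t : (forall s, E s != 0) ->
  (exists l, cvderiv V t l) -> (exists l, cvderiv E t l) ->
  rcont (fun s => Im (V s * (E s)^*%C) / normc (E s) ^+ 2) t.
Proof.
move=> E0 [lV [V1 V2]] [lE [E1 E2]].
pose N := - ((fun s => Re (V s)) * (fun s => Im (E s))) + (fun s => Im (V s)) * (fun s => Re (E s)).
pose D := (fun s => Re (E s)) * (fun s => Re (E s)) + (fun s => Im (E s)) * (fun s => Im (E s)).
have DE s : D s = normc (E s) ^+ 2 by rewrite sqr_normc_ReIm !expr2.
have D0 : D t != 0 by rewrite DE expf_neq0// normc_eq0.
have dN := is_deriveD (is_deriveN (is_deriveM V1 E2)) (is_deriveM V2 E1).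
have dD := is_deriveD (is_deriveM E1 E1) (is_deriveM E2 E2).
have d3 := @is_deriveV R D t _ _ D0 dD.
rewrite (_ : (fun s => _) = N * (fun s => (D s)^-1)); first exact: is_derive_rcont (is_deriveM dN d3).
apply/funext => s; rewrite -DE !ReImE /N.
rewrite -[RHS]/((- (Re (V s) * Im (E s)) + Im (V s) * Re (E s)) * (D s)^-1).
by congr (_ / _); ring.
Qed.

(** With H = h', the vector [E] is the velocity of f along the circle divided by i, and [T] is a
    differentiable argument of it. [tangent_turning] bounds its derivative below and [two_crossings]
    then supplies the direction. *)
Lemma boundary_direction (H H2 : R[i] -> R[i]) (alpha r : R) (n : nat) :
  (1 < n)%N -> 0 < r -> r < 1 -> - 2^-1 < alpha ->
  r ^+ n = (1 + 2 * alpha) / (1 + 2 * n%:R + 2 * alpha) ->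
  (forall z, normc z < 1 -> H z != 0) ->
  (forall z, normc z < 1 -> cderiv H z (H2 z)) ->
  (forall z, normc z < 1 -> exists l, cderiv H2 z l) ->
  (forall z, normc z < 1 -> alpha < Re (1 + z * H2 z / H z)) ->
  exists phi t1 t2, [/\ t1 < t2, t2 < t1 + 2 * pi,
    forall t, t1 < t -> t < t2 -> let z := r%:C * cis t in
      0 < Re ((z * H z - (z ^+ n * (z * H z))^*%C) * (cis phi)^*%C) &
    forall t, t2 < t -> t < t1 + 2 * pi -> let z := r%:C * cis t in
      Re ((z * H z - (z ^+ n * (z * H z))^*%C) * (cis phi)^*%C) < 0].
Proof.
move=> n1 r0 r1 al rn H0 dH dH2 Hal; have pi0 := pi_gt0 R.
pose gam t : R[i] := r%:C * cis t.
have ng t : normc (gam t) = r.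
  by rewrite Normc.normcM normc_cis normc_real mulr1 gtr0_norm.
have ng1 t : normc (gam t) < 1 by rewrite ng.
have g0 t : gam t != 0 by rewrite -normc_eq0 ng gt_eqF.
have gp t : gam (t + 2 * pi) = gam t by rewrite /gam cis2pi.
have dg t : cvderiv gam t ('i * gam t).
  by have := cvderiv_circle r t; rewrite mulrCA.
pose a z := z * H z; pose a1 z := H z + z * H2 z.
have da z : normc z < 1 -> cderiv a z (a1 z) by move=> /dH/cderiv_mulX.
pose A t := a (gam t); pose B t := gam t ^+ n * A t.
pose k := r ^+ n.
have k0 : 0 < k by rewrite exprn_gt0.
have k1 : k < 1 by rewrite exprn_ilt1 ?(ltW r0)//; lia.
have nBA t : normc (B t) = k * normc (A t) by rewrite Normc.normcM normcX ng.
have A0 t : A t != 0 by rewrite mulf_neq0// H0.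
have nA0 t : 0 < normc (A t) by rewrite normc_gt0.
pose E t := A t - (B t)^*%C.
have E0 t : E t != 0.
  rewrite subr_eq0; apply/eqP => /(congr1 (@Normc.normc R)); rewrite normc_conj nBA => h.
  have : k * normc (A t) < normc (A t) by rewrite gtr_pMl.
  by rewrite -h ltxx.
pose q1 z := z * a1 z.
pose V t := 'i * q1 (gam t) - ('i * (gam t ^+ n * (n%:R * A t + q1 (gam t))))^*%C.
have dA t : cvderiv A t ('i * q1 (gam t)).
  have := cvderiv_comp (dg t) (da _ (ng1 t)).
  by rewrite mulrCA [a1 _ * _]mulrC.
have dB t : cvderiv B t ('i * (gam t ^+ n * (n%:R * A t + q1 (gam t)))).
  have [l Hl lE] := cderiv_mulXn n (da _ (ng1 t)).
  have := cvderiv_comp (dg t) Hl.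
  by rewrite mulrCA [l * _]mulrC lE.
have dE t : cvderiv E t (V t) by exact: cvderivB (dA t) (cvderiv_conj (dB t)).
have dq1 z : normc z < 1 -> exists l, cderiv q1 z l.
  move=> z1; have [l Hl] := dH2 z z1; eexists.
  by apply: cderiv_mulX; apply: cderivD; [exact: dH|exact: cderiv_mulX Hl].
have dV t : exists l, cvderiv V t l.
  have [l Hl] := dq1 _ (ng1 t).
  have c1 := cvderiv_comp (dg t) (cderivZ 'i Hl).
  have [m Hm _] := cderiv_mulXn n (cderivD (cderivZ n%:R (da _ (ng1 t))) Hl).
  have c2 := cvderiv_comp (dg t) (cderivZ 'i Hm).
  by eexists; exact: cvderivB c1 (cvderiv_conj c2).
pose T' t := Im (V t * (E t)^*%C) / normc (E t) ^+ 2.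
have cT' t : rcont T' t by apply: turning_continuous => //; exists (V t).
have [phi0 [L [Lp HL dL]]] : exists phi0 : R, lift_on_circle H r.
  exists 0; apply: lift_circle_exists => [|z zr|z zr]; first exact: ltW.
    by rewrite H0//; lra.
  by exists (H2 z); apply: dH; lra.
have liftg : lifted gam id by move=> t; rewrite ng.
have liftA : lifted A (fun t => t + L t) by exact: liftedM liftg HL.
pose q t := E t * (A t)^*%C.
have qpos t : 0 < Re (q t).
  rewrite (_ : q t = A t * (A t)^*%C - (A t * B t)^*%C); last first.
    have cM (x y : R[i]) : (x * y)^*%C = x^*%C * y^*%C by rewrite rmorphM.
    by rewrite /q /E mulrBl cM [(B t)^*%C * _]mulrC.
  rewrite normcJM ReD ReN ReJ -[Re _%:C]/(normc (A t) ^+ 2).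
  have := normc_Re (A t * B t); rewrite Normc.normcM nBA ler_norml => /andP[_ h].
  have : k * normc (A t) ^+ 2 < normc (A t) ^+ 2 by rewrite gtr_pMl ?exprn_gt0.
  move=> h2; rewrite subr_gt0; apply: le_lt_trans h2; apply: (le_trans h).
  by rewrite mulrCA -expr2.
(* The summands are arguments of z, of H z and of E conj A; the last has positive real part because
   |B| < |A|. Only the first is not periodic, so T gains exactly 2 pi per turn. *)
pose T t := (t + L t) + atan (Im (q t) / Re (q t)).
have liftE : lifted E T by exact: lifted_divJ A0 liftA (lifted_atan qpos).
have dT t : is_derive t (1 : R) T (T' t).
  have [kL HkL] := dL t.
  have [kq Hkq] := derive_atan_ratio (qpos t) (cvderivM (dE t) (cvderiv_conj (dA t))).
  have d : is_derive t (1 : R) T (1 + kL + kq).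
    exact: is_deriveD (is_deriveD (is_derive_id _ _) HkL) Hkq.
  by rewrite /T' -(lifted_derive E0 liftE (dE t) d).
have Tp t : T (t + 2 * pi) = T t + 2 * pi.
  by rewrite /T Lp /q /E /B /A gp; ring.
have T'p t : T' (t + 2 * pi) = T' t by rewrite /T' /V /E /B /A gp.
pose c := (1 - k) / 2 / (1 + k).
have nn : 2 <= n%:R :> R by rewrite (ler_nat R 2 n).
have c0 : 0 < c by rewrite !divr_gt0//; lra.
have ck : c * (1 + k) = (1 - k) / 2 by rewrite divfK// gt_eqF//; lra.
have c12 : 2 * c < 1 by rewrite -(@ltr_pM2r _ (1 + k)); lra.
(* The formula for the radius, solved as a linear equation in k = r^n. *)
have ak : (alpha + 2^-1) * (1 - k) = n%:R * k.
  have d0 : 1 + 2 * n%:R + 2 * alpha != 0 by rewrite gt_eqF//; lra.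
  by rewrite /k rn; field.
have T'gt t : - c < T' t.
  rewrite /T' ltr_pdivlMr ?exprn_gt0 ?normc_gt0//.
  pose P := 1 + gam t * H2 (gam t) / H (gam t).
  have Hg := H0 _ (ng1 t).
  have qE : q1 (gam t) = A t * P.
    by rewrite /q1 /a1 /A /a /P; field.
  have -> : V t = 'i * (A t * P) - ('i * (B t * (n%:R%:C + P)))^*%C.
    by rewrite /V qE rmorph_nat /B; congr (_ - _^*%C); ring.
  apply: (@tangent_turning _ _ _ _ alpha k); rewrite ?ler0n//; [exact: Hal|lra].
have [phi [t1 [t2 [t12 t21 pos neg]]]] := two_crossings dT cT' c0 c12 T'gt Tp T'p.
(* T is an argument of E, while the velocity of f is i E: the quarter turn makes up for this and
   turns the sine of T - phi into a real part. *)
exists (phi + pi / 2), t1, t2.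
have key t : Re (E t * (cis (phi + pi / 2))^*%C) = normc (E t) * sin (T t - phi).
  rewrite {1}liftE -cisN -mulrA -cisD !ReImE /= mul0r subr0; congr (_ * _).
  by rewrite opprD addrA -sinDpihalf subrK.
split => // t h1 h2 /=; rewrite -/(gam t) -[_ - _]/(E t) key.
  by rewrite mulr_gt0 ?pos// normc_gt0.
by rewrite pmulr_rlt0 ?neg// normc_gt0.
Qed.

End Boundary.

(** * The minimum principle *)

Section MaximumPrinciple.
Context {R : realType}.
Implicit Types (z w l : R[i]) (f g : R[i] -> R[i]) (t : R).

(** Polar coordinates present the closed disk as the continuous image of a compact rectangle. *)
Lemma closed_disk_Im_min f (r : R) : 0 < r -> (forall z, normc z <= r -> ccont f z) ->
  exists2 z0, normc z0 <= r & forall z, normc z <= r -> Im (f z0) <= Im (f z).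
Proof.
move=> r0 cf; have pi0 := pi_gt0 R.
pose D : set (R * R) := `[0, 1]%classic `*` `[0, 2 * pi]%classic.
pose gam (q : R * R) : R[i] := (q.1 * r)%:C * cis q.2.
have gD q : D q -> normc (gam q) <= r.
  move=> [h1 _]; have /andP[q0 q1] : 0 <= q.1 <= 1 by move: h1; rewrite /= in_itv.
  rewrite /gam Normc.normcM normc_cis mulr1 normc_real ger0_norm ?mulr_ge0// ?(ltW r0)//.
  by rewrite ler_piMl// ltW.
have cD : compact D by apply: compact_setX; exact: segment_compact.
have D0 : D !=set0 by exists (0, 0); split; rewrite /= in_itv/= lexx ?ler01//=; lra.
have cont : {within D, continuous (fun q => Im (f (gam q)))}.
  apply: continuous_in_subspaceT => q; rewrite inE => Dq.
  apply/cvgrPdist_lt => e e0.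
  have [d d0 Hd] := cf _ (gD _ Dq) _ e0.
  have e1 : 0 < d / 2 / r by rewrite !divr_gt0.
  have e2 : 0 < d / 2 / (`|q.1 * r| + 1) by rewrite !divr_gt0// ltr_wpDl.
  have [s s0 Hs] := cis_near q.2 e2.
  exists (ball q.1 (d / 2 / r), ball q.2 s); first by split; exact: nbhsx_ballx.
  move=> q' [/= b1 b2].
  apply: le_lt_trans (Hd (gam q') _); first by rewrite distrC -ImN -ImD normc_Im.
  have -> : gam q' - gam q = ((q'.1 - q.1) * r)%:C * cis q'.2 +
    (q.1 * r)%:C * (cis q'.2 - cis q.2).
    by rewrite /gam !rmorphM rmorphB /=; ring.
  apply: le_lt_trans (normcD _ _) _; rewrite !Normc.normcM normc_cis !normc_real mulr1.
  have h1 : `|(q'.1 - q.1) * r| < d / 2.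
    by rewrite normrM (gtr0_norm r0) -ltr_pdivlMr// distrC.
  have h2 : normc (cis q'.2 - cis q.2) * (`|q.1 * r| + 1) < d / 2.
    by rewrite -ltr_pdivlMr ?ltr_wpDl//; apply: Hs; rewrite distrC.
  have h3 := normc_ge0 (cis q'.2 - cis q.2).
  by lra.
have [q qD qmin] := compact_EVT_min D0 cD cont.
rewrite inE in qD; exists (gam q); first exact: gD.
move=> z zr; have [t [/andP[t0 t1] zE]] := polar_from 0 z.
have := qmin (normc z / r, t); rewrite inE /gam /= divfK ?gt_eqF// -zE; apply.
split; rewrite /= in_itv/= ?divr_ge0 ?normc_ge0 ?(ltW r0)//= ?ler_pdivrMr ?mul1r//.
by rewrite t0; lra.
Qed.

(** A value <= 0 inside would give an interior minimum z1 of Im f. Local constancy at minima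
    propagates its value along the segment from z1 to zeta, where Im f is positive. *)
Lemma Im_minimum_principle f (r : R) : 0 < r ->
  (forall z, normc z < r -> analytic_at f z) -> (forall z, normc z <= r -> ccont f z) ->
  (forall z, normc z = r -> 0 <= Im (f z)) ->
  (exists2 zeta, normc zeta = r & 0 < Im (f zeta)) ->
  forall z, normc z < r -> 0 < Im (f z).
Proof.
move=> r0 af cf bd [zeta zr zpos] z zlt; rewrite ltNge; apply/negP => zneg.
have [z1 [z1r z1min z1neg]] : exists z1, [/\ normc z1 < r,
    (forall w, normc w <= r -> Im (f z1) <= Im (f w)) & Im (f z1) <= 0].
  have [z0 z0r z0min] := closed_disk_Im_min r0 cf.
  (* If the minimum sits on the circle it is >= 0, so the interior point z, with its value <= 0, is
     a minimum as well. *)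
  have := z0r; rewrite le_eqVlt => /orP[/eqP /bd h|z0lt]; last first.
    by exists z0; split => //; apply: le_trans zneg; exact: z0min (ltW zlt).
  exists z; split => // w wr; apply: le_trans (z0min _ wr).
  exact: le_trans zneg h.
pose W t := z1 + t%:C * (zeta - z1).
have Wlt t : 0 <= t -> t < 1 -> normc (W t) < r.
  move=> t0 t1; rewrite /W (_ : _ + _ = (1 - t)%:C * z1 + t%:C * zeta); last first.
    by rewrite rmorphB rmorph1; ring.
  apply: le_lt_trans (normcD _ _) _; rewrite !Normc.normcM !normc_real !ger0_norm ?subr_ge0 ?(ltW t1)//.
  rewrite zr; have : (1 - t) * normc z1 < (1 - t) * r by rewrite ltr_pM2l// subr_gt0.
  by lra.
have Wle t : 0 <= t -> t <= 1 -> normc (W t) <= r.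
  move=> t0; rewrite le_eqVlt => /orP[/eqP ->|/(Wlt _ t0)/ltW//].
  by rewrite /W rmorph1 mul1r addrC subrK zr.
have WB s t : normc (W s - W t) = `|s - t| * normc (zeta - z1).
  by rewrite -normc_real -Normc.normcM rmorphB; congr normc; rewrite /W; ring.
have L0 : 0 < normc (zeta - z1) + 1 by rewrite ltr_wpDl ?normc_ge0.
suff : forall t, 0 <= t -> t <= 1 -> Im (f (W t)) = Im (f z1).
  move=> /(_ 1 ler01 (lexx _)); rewrite /W rmorph1 mul1r addrC subrK => h.
  by move: zpos; rewrite h ltNge z1neg.
apply: real_induction; first by rewrite /W rmorph0 mul0r addr0.
- move=> t t0 t1 HP; have [] := @analytic_local_min R f (W t).
  + exact/af/Wlt.
  + have rw : 0 < r - normc (W t) by rewrite subr_gt0 Wlt.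
    exists (r - normc (W t)) => // w wW; rewrite HP//; apply: z1min.
    rewrite (_ : w = W t + (w - W t)); last by ring.
    by apply: le_trans (normcD _ _) _; lra.
  move=> e e0 He; exists (e / (normc (zeta - z1) + 1)); first by rewrite divr_gt0.
  move=> s ts se s1; rewrite He ?HP// WB gtr0_norm ?subr_gt0//.
  have : s - t < e / (normc (zeta - z1) + 1) by lra.
  rewrite ltr_pdivlMr// => h.
  by have := normc_ge0 (zeta - z1); nra.
- move=> t t0 t1 HP; apply/eqP; rewrite eq_le z1min ?Wle ?(ltW t0)// andbT.
  apply: le_of_eps => e e0.
  have [d d0 Hd] := cf _ (Wle _ (ltW t0) t1) _ e0.
  have dL : 0 < d / (normc (zeta - z1) + 1) by rewrite divr_gt0.
  pose s := Num.max 0 (t - d / (normc (zeta - z1) + 1) / 2).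
  have s0 : 0 <= s by rewrite le_max lexx.
  have st : s < t by rewrite gt_max t0; lra.
  have sd : t - s < d / (normc (zeta - z1) + 1).
    have : t - d / (normc (zeta - z1) + 1) / 2 <= s by rewrite le_max lexx orbT.
    by lra.
  rewrite ltr_pdivlMr// in sd.
  have : normc (f (W s) - f (W t)) < e.
    apply: Hd; rewrite WB ltr0_norm ?subr_lt0//.
    by have := normc_ge0 (zeta - z1); nra.
  have := normc_Im (f (W s) - f (W t)); rewrite ImD ImN HP// ler_norml => /andP[_ h] h2.
  have := normc_Im (f (W s) - f (W t)); rewrite ImD ImN HP// ler_norml => /andP[h3 _].
  by lra.
Qed.

End MaximumPrinciple.

(** * From signs on two arcs to a sign in the disk *)

Section HalfPlane.
Context {R : realType}.
Implicit Types (z w l c : R[i]) (f g K : R[i] -> R[i]) (t : R).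

Lemma chord s t : cis s - cis t = 2 * 'i * (sin ((s - t) / 2))%:C * cis ((s + t) / 2).
Proof.
have -> : cis s = cis ((s + t) / 2 + (s - t) / 2) by congr cis; field.
have -> : cis t = cis ((s + t) / 2 - (s - t) / 2) by congr cis; field.
move: ((s + t) / 2) ((s - t) / 2) => p q.
rewrite !cisD cisN; apply: eq_ReIm; rewrite !ReImE /=; ring.
Qed.

(** On the circle the weight (z - z1) (z - z2) / (z1 - z2) is a real multiple of the tangent i z,
    and the multiple changes sign exactly at z1 and z2. *)
Lemma chord_product r t t1 t2 : sin ((t1 - t2) / 2) != 0 ->
  (r%:C * cis t - r%:C * cis t1) * (r%:C * cis t - r%:C * cis t2) =
  (2 * sin ((t - t1) / 2) * sin ((t - t2) / 2) / sin ((t1 - t2) / 2))%:C *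
   ('i * (r%:C * cis t)) * (r%:C * cis t1 - r%:C * cis t2).
Proof.
move=> s0; rewrite -!mulrBr !chord.
have E : cis ((t + t1) / 2) * cis ((t + t2) / 2) = cis t * cis ((t1 + t2) / 2).
  by rewrite -!cisD; congr cis; field.
have sC : (sin ((t1 - t2) / 2))%:C != 0 :> R[i] by rewrite eq_complex /= eqxx andbT.
rewrite !rmorphM fmorphV /=.
set S1 := (sin ((t - t1) / 2))%:C; set S2 := (sin ((t - t2) / 2))%:C.
set S := (sin ((t1 - t2) / 2))%:C in sC *.
transitivity (4 * ('i * 'i) * r%:C ^+ 2 * S1 * S2 * (cis ((t + t1) / 2) * cis ((t + t2) / 2))).
  by ring.
by rewrite E (_ : 2%:C = 2) ?rmorph_nat//; field.
Qed.

(** On the circle the imaginary part in question is [lam t] times Re (z K z). Both factors are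
    positive on the first arc and negative on the second, so the product is nonnegative and the
    minimum principle applies. *)
Lemma half_plane_value K (r t1 t2 : R) : 0 < r -> t1 < t2 -> t2 < t1 + 2 * pi ->
  (forall z, normc z <= r -> analytic_at K z) ->
  (forall t, t1 < t -> t < t2 -> 0 < Re (r%:C * cis t * K (r%:C * cis t))) ->
  (forall t, t2 < t -> t < t1 + 2 * pi -> Re (r%:C * cis t * K (r%:C * cis t)) < 0) ->
  let z1 := r%:C * cis t1 in let z2 := r%:C * cis t2 in
  z1 != z2 /\
  forall z, normc z < r -> 0 < Im ((z - z1) * (z - z2) * K z / (z1 - z2)).
Proof.
move=> r0 t12 t21 aK pos neg z1 z2; have pi0 := pi_gt0 R.
have s12 : sin ((t1 - t2) / 2) < 0.
  rewrite (_ : (t1 - t2) / 2 = - ((t2 - t1) / 2)); last by field.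
  by rewrite sinN oppr_lt0; apply: sin_gt0_pi; apply/andP; split; lra.
have rC : r%:C != 0 :> R[i] by rewrite eq_complex /= eqxx andbT gt_eqF.
have z12 : z1 != z2.
  rewrite -subr_eq0 -mulrBr chord !mulf_neq0 ?cis_neq0//.
    by rewrite eq_complex /= oner_eq0 andbF.
  by rewrite eq_complex /= eqxx andbT lt_eqF.
split => //.
pose Q z := (z - z1) * (z - z2) * K z / (z1 - z2).
have aQ z : normc z <= r -> analytic_at Q z.
  move=> /aK aKz; have -> : Q = (fun w => (z1 - z2)^-1 * ((w * (w * K w) + - (z1 + z2) * (w * K w)) + z1 * z2 * K w)).
    by apply/funext => w; rewrite /Q; ring.
  apply: analyticZ; apply: analyticD; last exact: analyticZ.
  apply: analyticD; last by apply: analyticZ; exact: analytic_mulX.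
  by do 2 apply: analytic_mulX.
have cQ z : normc z <= r -> ccont Q z.
  by move=> /aQ/analytic_derive1[/cderiv_ccont].
pose lam t := 2 * sin ((t - t1) / 2) * sin ((t - t2) / 2) / sin ((t1 - t2) / 2).
have QE t : Im (Q (r%:C * cis t)) = lam t * Re (r%:C * cis t * K (r%:C * cis t)).
  rewrite /Q chord_product ?lt_eqF// -/(lam t) -/z1 -/z2.
  rewrite (_ : _ / _ = (lam t)%:C * ('i * (r%:C * cis t * K (r%:C * cis t)))); last first.
    by field; rewrite subr_eq0.
  by move: (_ * K _) => X; rewrite !ReImE /=; ring.
have lampos t : t1 < t -> t < t2 -> 0 < lam t.
  move=> h1 h2; have s1 : 0 < sin ((t - t1) / 2) by apply: sin_gt0_pi; apply/andP; split; lra.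
  have s2 : sin ((t - t2) / 2) < 0.
    rewrite (_ : (t - t2) / 2 = - ((t2 - t) / 2)); last by field.
    by rewrite sinN oppr_lt0; apply: sin_gt0_pi; apply/andP; split; lra.
  by rewrite /lam nmulr_rgt0 ?invr_lt0// pmulr_rlt0// mulr_gt0.
have lamneg t : t2 < t -> t < t1 + 2 * pi -> lam t < 0.
  move=> h1 h2; have s1 : 0 < sin ((t - t1) / 2) by apply: sin_gt0_pi; apply/andP; split; lra.
  have s2 : 0 < sin ((t - t2) / 2) by apply: sin_gt0_pi; apply/andP; split; lra.
  by rewrite /lam nmulr_llt0 ?invr_lt0// !mulr_gt0.
apply: (Im_minimum_principle r0) => [z /ltW/aQ//|z /cQ//|z zr|].
- have [t [/andP[t1t tt1] ->]] := polar_from t1 z; rewrite zr QE.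
  move: t1t; rewrite le_eqVlt => /orP[/eqP <-|t1t].
    by rewrite /lam subrr mul0r sin0 mulr0 !mul0r.
  have [tt2|] := ltP t t2; first by rewrite mulr_ge0// ltW ?lampos ?pos.
  rewrite le_eqVlt => /orP[/eqP <-|t2t].
    by rewrite /lam subrr mul0r sin0 mulr0 !mul0r.
  by rewrite mulr_le0// ltW ?lamneg ?neg.
- have h1 : t1 < (t1 + t2) / 2 by lra.
  have h2 : (t1 + t2) / 2 < t2 by lra.
  exists (r%:C * cis ((t1 + t2) / 2)).
    by rewrite Normc.normcM normc_cis mulr1 normc_real gtr0_norm.
  by rewrite QE mulr_gt0 ?lampos ?pos.
Qed.

End HalfPlane.

(** * The half-plane model *)

Section Moebius.
Context {R : realType}.
Implicit Types (z w l c : R[i]) (f g : R[i] -> R[i]).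

Lemma cderiv_comp f g z k l : cderiv g z l -> cderiv f (g z) k ->
  cderiv (f \o g) z (k * l).
Proof.
move=> Hg Hf e e0.
pose L := normc l + 1; pose K := normc k + 1.
have L0 : 0 < L by rewrite ltr_wpDl ?normc_ge0.
have K0 : 0 < K by rewrite ltr_wpDl ?normc_ge0.
have e1 : 0 < e / 2 / L by rewrite !divr_gt0.
have e2 : 0 < e / 2 / K by rewrite !divr_gt0.
have [r1 r10 H1] := Hf _ e1; have [r2 r20 H2] := Hg _ e2; have [r3 r30 H3] := Hg _ ltr01.
exists (Num.min (r1 / L) (Num.min r2 r3)); first by rewrite !lt_min r20 r30 divr_gt0.
move=> s; rewrite !lt_min ltr_pdivlMr// => /and3P[s1 /H2 s2 /H3 s3].
have lip : normc (g s - g z) <= L * normc (s - z).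
  rewrite (_ : g s - g z = (g s - g z - l * (s - z)) + l * (s - z)); last by ring.
  by apply: le_trans (normcD _ _) _; rewrite Normc.normcM /L; lra.
have gs : normc (g s - g z) < r1 by apply: le_lt_trans lip _; rewrite mulrC.
rewrite (_ : _ - _ = (f (g s) - f (g z) - k * (g s - g z)) +
  k * (g s - g z - l * (s - z))); last by rewrite /=; ring.
apply: le_trans (normcD _ _) _; rewrite Normc.normcM.
have q1 : normc (f (g s) - f (g z) - k * (g s - g z)) <= e / 2 * normc (s - z).
  apply: le_trans (H1 _ gs) _; apply: le_trans (ler_wpM2l (ltW e1) lip) _.
  by rewrite mulrA divfK ?gt_eqF.
have q2 : normc k * normc (g s - g z - l * (s - z)) <= e / 2 * normc (s - z).
  apply: (@le_trans _ _ (K * (e / 2 / K * normc (s - z)))).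
    by apply: ler_pM => //; rewrite ?normc_ge0// lerDl.
  by rewrite mulrA mulrCA divff ?mulr1// gt_eqF.
by lra.
Qed.

Lemma cderiv_inv c w : w != c -> cderiv (fun v => (v - c)^-1) w (- (w - c) ^- 2).
Proof.
move=> wc e e0; have a0 : w - c != 0 by rewrite subr_eq0.
have n0 : 0 < normc (w - c) by rewrite normc_gt0.
set N := normc (w - c) in n0.
have N3 : 0 < N ^+ 3 by rewrite exprn_gt0.
exists (Num.min (N / 2) (e * N ^+ 3 / 2)); first by rewrite lt_min !divr_gt0// mulr_gt0.
move=> v; rewrite lt_min => /andP[v1 v2].
have vN : N / 2 <= normc (v - c).
  have : N <= normc (v - c) + normc (v - w).
    by rewrite /N {1}(_ : w - c = (v - c) - (v - w)) ?normcB//; ring.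
  by lra.
have v0 : v - c != 0 by rewrite -normc_gt0; lra.
rewrite (_ : _ - _ = (v - w) * (v - w) / ((v - c) * (w - c) ^+ 2)); last by field; rewrite a0.
rewrite !Normc.normcM Normc.normcV Normc.normcM normcX -/N mulrAC.
rewrite ler_wpM2r ?normc_ge0// ler_pdivrMr; last first.
  by rewrite mulr_gt0 ?exprn_gt0//; lra.
apply: (@le_trans _ _ (e * (N / 2 * N ^+ 2))).
  by rewrite (_ : e * _ = e * N ^+ 3 / 2) ?ltW//; field.
by rewrite ler_pM2l// ler_pM2r// exprn_gt0.
Qed.

Lemma cderiv_cst c z : cderiv (fun _ => c) z 0.
Proof.
move=> e e0; exists 1 => // w _; rewrite subrr mul0r subr0 Normc.normc0.
by rewrite mulr_ge0 ?normc_ge0 ?ltW.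
Qed.

(** For the map w -> (w z2 - c z1) / (w - c) this compares the modulus of the image with r: the
    image lies in the disk exactly when w lies in the upper half plane. *)
Lemma moebius_identity (r : R) z1 z2 w : normc z1 = r -> normc z2 = r ->
  let S := (r ^+ 2)%:C - z1^*%C * z2 in let c := - 'i * S in
  r ^+ 2 * normc (w - c) ^+ 2 - normc (w * z2 - c * z1) ^+ 2 = 2 * normc S ^+ 2 * Im w.
Proof.
move=> r1 r2 S c; apply: complexI.
(* Polynomial identities in which conjugates are independent variables. *)
have ring_id2 (i s s' v v' : R[i]) : - (v * (i * s') * s) - v' * (- i * s) * s' = - (i * s * s' * (v - v')).
  by ring.
have ring_id3 (i s s' x : R[i]) : - (i * s * s' * (2 * x * i)) = - (i * i) * (2 * (s * s') * x) by ring.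
have ring_id (q v b v' i s x y x' y' : R[i]) : q * ((v - b) * (v' - i * s)) - (v * y - b * x) *
    (v' * y' - i * s * x') = (q - y * y') * (v * v') + (q - x * x') * (b * (i * s)) -
    v * (i * s) * (q - x' * y) - v' * b * (q - x * y') by ring.
have N z : z * z^*%C = (normc z ^+ 2)%:C.
  by rewrite sqr_normc_ReIm; apply: eq_ReIm; rewrite !ReImE /=; ring.
have cB x y : (x - y)^*%C = x^*%C - y^*%C :> R[i] by rewrite rmorphB.
have cM x y : (x * y)^*%C = x^*%C * y^*%C :> R[i] by rewrite rmorphM.
have E1 := N z1; have E2 := N z2; rewrite r1 in E1; rewrite r2 in E2.
have i2 : 'i * 'i = - 1 :> R[i] by rewrite -expr2 sqr_i.
have W : w - w^*%C = 2 * (Im w)%:C * 'i by rewrite subcJ.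
have Sc : S^*%C = (r ^+ 2)%:C - z1 * z2^*%C by rewrite /S cB cM conjcK conjc_real.
have cc : c^*%C = 'i * S^*%C.
  by rewrite /c cM; congr (_ * _); apply: eq_ReIm; rewrite !ReImE /=; ring.
have aux1 (p q s : R) : (p * q - s)%:C = p%:C * q%:C - s%:C :> R[i] by rewrite rmorphB rmorphM.
have aux2 (p q : R) : (2 * p * q)%:C = 2 * p%:C * q%:C :> R[i] by rewrite !rmorphM rmorph_nat.
rewrite aux1 aux2 -!N (cB w) (cB (w * z2)) (cM w) (cM c) cc.
set rr := (r ^+ 2)%:C in E1 E2 Sc *.
set w' := w^*%C in W *; set S' := S^*%C in Sc cc *.
transitivity ((rr - z2 * z2^*%C) * (w * w') + (rr - z1 * z1^*%C) * (c * ('i * S')) -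
  w * ('i * S') * S - w' * c * (rr - z1 * z2^*%C)).
  exact: ring_id.
rewrite E1 E2 !subrr !mul0r addr0 sub0r -Sc.
transitivity (- ('i * S * S' * (w - w'))); first by rewrite /c; exact: ring_id2.
rewrite W; transitivity (- ('i * 'i) * (2 * (S * S') * (Im w)%:C)); first exact: ring_id3.
by rewrite i2 opprK mul1r.
Qed.

(** The pole c lies in the lower half plane, 0 goes to z1 and infinity to z2. The differential
    equation in the third clause turns the weight (z - z1) (z - z2) / (z1 - z2) into w M'(w), so the
    sign condition in the disk becomes growth along the rays from 0. *)
Lemma moebius_exists (r : R) z1 z2 : 0 < r -> normc z1 = r -> normc z2 = r -> z1 != z2 ->
  exists M : R[i] -> R[i], [/\
    forall w, 0 < Im w -> normc (M w) < r,
    forall z, normc z < r -> exists2 w, 0 < Im w & M w = z,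
    forall w, 0 < Im w -> exists2 l, cderiv M w l & w * l * (z1 - z2) = (M w - z1) * (M w - z2),
    forall e, 0 < e -> exists2 d : R, 0 < d &
      forall w, 0 < Im w -> normc w < d -> normc (M w - z1) < e &
    forall e, 0 < e -> exists2 B : R, 0 < B &
      forall w, 0 < Im w -> B < normc w -> normc (M w - z2) < e].
Proof.
move=> r0 r1 r2 z12.
pose S := (r ^+ 2)%:C - z1^*%C * z2; pose c := - 'i * S.
have z120 : 0 < normc (z1 - z2) by rewrite normc_gt0 subr_eq0.
have Imc : Im c = - (normc (z1 - z2) ^+ 2 / 2).
  have h1 := sqr_normc_ReIm z1; have h2 := sqr_normc_ReIm z2; rewrite r1 in h1; rewrite r2 in h2.
  rewrite sqr_normc_ReIm /c /S !ReImE /=.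
  by move: h1 h2; rewrite !expr2; lra.
have Imc0 : Im c < 0 by rewrite Imc oppr_lt0 divr_gt0// exprn_gt0.
have S0 : 0 < normc S.
  rewrite normc_gt0; apply: contraTneq Imc0 => h.
  by rewrite /c h mulr0 /= ltxx.
have wc w : 0 < Im w -> w - c != 0.
  move=> w0; apply: contraTneq w0 => /eqP; rewrite subr_eq0 => /eqP ->.
  by rewrite -leNgt ltW.
have wcn w : 0 < Im w -> - Im c < normc (w - c).
  move=> w0; apply: lt_le_trans (normc_Im _); rewrite ImD ImN gtr0_norm; lra.
pose M w := z2 + c * (z2 - z1) * (w - c)^-1.
have ME w : w - c != 0 -> M w = (w * z2 - c * z1) / (w - c).
  by move=> h; rewrite /M; field.
have c0 : c != 0 by apply: contraTneq Imc0 => ->; rewrite /= ltxx.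
have nc0 : 0 < normc c by rewrite normc_gt0.
exists M; split.
- move=> w w0; have h := wc w w0; rewrite ME// Normc.normcM Normc.normcV.
  rewrite ltr_pdivrMr ?normc_gt0// -ltr_sqr ?nnegrE ?normc_ge0 ?mulr_ge0 ?normc_ge0 ?(ltW r0)//.
  rewrite exprMn -subr_gt0 (moebius_identity w r1 r2).
  by rewrite mulr_gt0// mulr_gt0// exprn_gt0.
- move=> z zr; have zz2 : z - z2 != 0.
    by rewrite subr_eq0; apply: contraTneq zr => ->; rewrite r2 ltxx.
  pose w := c * (z - z1) / (z - z2).
  have wcE : w - c = c * (z2 - z1) / (z - z2) by rewrite /w; field.
  have w0 : w - c != 0.
    by rewrite wcE mulf_neq0 ?invr_eq0// mulf_neq0// subr_eq0 eq_sym.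
  have Mw : M w = z.
    have h21 : z2 - z1 != 0 by rewrite subr_eq0 eq_sym.
    by rewrite /M wcE; field; rewrite ?h21 ?c0 ?zz2.
  exists w => //; move: zr; rewrite -{1}Mw ME// Normc.normcM Normc.normcV.
  rewrite ltr_pdivrMr ?normc_gt0// -ltr_sqr ?nnegrE ?normc_ge0 ?mulr_ge0 ?normc_ge0 ?(ltW r0)//.
  by rewrite exprMn -subr_gt0 (moebius_identity w r1 r2) pmulr_rgt0// mulr_gt0// exprn_gt0.
- move=> w w0; have h := wc w w0.
  exists (0 + c * (z2 - z1) * (- (w - c) ^- 2)).
    apply: cderivD; first exact: cderiv_cst.
    by apply: cderivZ; apply: cderiv_inv; rewrite -subr_eq0.
  by rewrite add0r /M; field.
- move=> e e0; exists (e * - Im c / normc (z1 - z2)).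
    by rewrite divr_gt0// mulr_gt0// oppr_gt0.
  move=> w w0; rewrite ltr_pdivlMr// => wd.
  rewrite (_ : M w - z1 = w * (z2 - z1) / (w - c)); last by rewrite /M; field; exact: wc.
  rewrite !Normc.normcM Normc.normcV ltr_pdivrMr ?normc_gt0 ?wc// normc_distC.
  apply: lt_trans wd _.
  by rewrite ltr_pM2l// wcn.
- move=> e e0; exists (normc c + normc c * normc (z1 - z2) / e).
    by rewrite addr_gt0// divr_gt0// mulr_gt0.
  move=> w w0 wB.
  rewrite (_ : M w - z2 = c * (z2 - z1) / (w - c)); last by rewrite /M; field; exact: wc.
  rewrite Normc.normcM (Normc.normcM c) Normc.normcV ltr_pdivrMr ?normc_gt0 ?wc// -ltr_pdivrMl//.
  have : normc w <= normc (w - c) + normc c.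
    by rewrite {1}(_ : w = (w - c) + c) ?normcD//; ring.
  move=> h; rewrite (normc_distC z2) [ltLHS]mulrC -(ltrD2l (normc c)).
  by apply: lt_le_trans wB _; rewrite addrC.
Qed.

(* Put Q = w0 k and a = f w - f w0, which is real: a = Q (w - w0) / w0 + o(w - w0) and Im Q > 0 force a
   to have the sign of - Im ((w - w0) / w0), and Re (g w - g w0) is a Re (l / k) up to a small error. *)
Lemma level_local f g w0 k l : cderiv f w0 k -> cderiv g w0 l ->
  0 < Im (w0 * k) -> 0 < 1 + 2 * Re (l / k) ->
  exists2 e : R, 0 < e & forall w, normc (w - w0) < e -> Im (f w) = Im (f w0) ->
    (0 < - Im ((w - w0) / w0) -> 0 < Re (f w - f w0) + 2 * Re (g w - g w0)) /\
    (- Im ((w - w0) / w0) < 0 -> Re (f w - f w0) + 2 * Re (g w - g w0) < 0).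
Proof.
move=> Hf Hg Q0 om0.
have wk0 : w0 * k != 0 by apply: contraTneq Q0 => ->; rewrite ltxx.
have /andP[w00 k0] : (w0 != 0) && (k != 0) by rewrite mulf_eq0 negb_or in wk0.
have nk : 0 < normc k by rewrite normc_gt0.
have nw : 0 < normc w0 by rewrite normc_gt0.
set om := l / k in om0; set Q := w0 * k in Q0 wk0.
have nQ : 0 < normc Q by rewrite normc_gt0.
(* The three bounds serve, in this order, to compare |k| |w - w0| with 2 |a|, to fix the sign of Im
   ((w - w0) / w0), and to control Re (g w - g w0). *)
pose e1 := Num.min (normc k / 2) (Num.min (Im Q * normc k / normc Q / 8) 
   ((1 + 2 * Re om) * normc k / (16 * (1 + normc om)))).
have om1 : 0 < 1 + normc om by rewrite ltr_wpDr ?normc_ge0.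
have e10 : 0 < e1 by rewrite !lt_min !divr_gt0 ?mulr_gt0.
have [d1 d10 H1] := Hf _ e10; have [d2 d20 H2] := Hg _ e10.
exists (Num.min d1 d2); first by rewrite lt_min d10.
move=> w; rewrite lt_min => /andP[/H1 {}H1 /H2 {}H2] Imf.
have e1a : e1 <= normc k / 2 by rewrite ge_min lexx.
have e1b : e1 <= Im Q * normc k / normc Q / 8 by rewrite !ge_min lexx orbT.
have e1c : e1 <= (1 + 2 * Re om) * normc k / (16 * (1 + normc om)) by rewrite !ge_min lexx !orbT.
set N := normc (w - w0) in H1 H2; have N0 : 0 <= N := normc_ge0 _.
set a := Re (f w - f w0).
have fE : f w - f w0 = a%:C.
  by apply: eq_ReIm => //; rewrite ImD ImN Imf subrr.
rewrite fE in H1.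
have aN : normc k * N <= 2 * `|a|.
  have : normc (k * (w - w0)) <= normc (a%:C : R[i]) + normc (a%:C - k * (w - w0)).
    by rewrite {1}(_ : k * (w - w0) = a%:C - (a%:C - k * (w - w0))) ?normcB//; ring.
  rewrite Normc.normcM normc_real -/N => h.
  have : e1 * N <= normc k / 2 * N by rewrite ler_wpM2r.
  by lra.
have e8 : e1 * N <= Im Q / normc Q * `|a| / 4.
  apply: (@le_trans _ _ (Im Q * normc k / normc Q / 8 * N)); first by rewrite ler_wpM2r.
  have -> : Im Q * normc k / normc Q / 8 * N = Im Q / normc Q / 8 * (normc k * N).
    by field; rewrite gt_eqF.
  apply: le_trans (ler_wpM2l _ aN) _; first by rewrite !divr_ge0// ltW.
  by rewrite le_eqVlt; apply/orP; left; apply/eqP; field; rewrite gt_eqF.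
have e16 : e1 * N * (1 + normc om) <= (1 + 2 * Re om) * `|a| / 8.
  apply: (@le_trans _ _ ((1 + 2 * Re om) * normc k / (16 * (1 + normc om)) * N * (1 + normc om))).
    by rewrite ler_wpM2r ?(ltW om1)// ler_wpM2r.
  have -> : (1 + 2 * Re om) * normc k / (16 * (1 + normc om)) * N * (1 + normc om) =
     (1 + 2 * Re om) / 16 * (normc k * N) by field; rewrite gt_eqF.
  apply: le_trans (ler_wpM2l _ aN) _; first by rewrite divr_ge0// ltW.
  by rewrite le_eqVlt; apply/orP; left; apply/eqP; field.
pose E := a%:C - k * (w - w0).
have dE : (w - w0) / w0 = (a%:C - E) / Q by rewrite /E /Q; field; rewrite ?w00 ?k0.
have ImE : `|Im (E / Q)| <= Im Q / normc Q ^+ 2 * `|a| / 4.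
  apply: le_trans (normc_Im _) _; rewrite Normc.normcM Normc.normcV ler_pdivrMr//.
  apply: le_trans H1 _; apply: le_trans e8 _.
  by rewrite le_eqVlt; apply/orP; left; apply/eqP; field; rewrite gt_eqF.
have Ima : Im (a%:C / Q) = - (Im Q / normc Q ^+ 2) * a.
  rewrite (_ : a%:C / Q = a%:C * Q^*%C / (normc Q ^+ 2)%:C); last first.
    have nC : (normc Q ^+ 2)%:C != 0 :> R[i] by rewrite eq_complex /= eqxx andbT expf_neq0 ?gt_eqF.
    have QJ : Q * Q^*%C = (normc Q ^+ 2)%:C.
      by rewrite sqr_normc_ReIm; apply: eq_ReIm; rewrite !ReImE /=; ring.
    apply: (mulIf nC); rewrite divfK// -{1}QJ; field; exact: wk0.
  rewrite -fmorphV /= !ReImE /=; ring.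
pose m := Im Q / normc Q ^+ 2.
have m0 : 0 < m by rewrite divr_gt0// exprn_gt0.
have key1 : `|- Im ((w - w0) / w0) - m * a| <= m * `|a| / 4.
  rewrite dE mulrBl ImD ImN Ima -/m.
  by rewrite (_ : _ - _ = Im (E / Q)) //; ring.
have key2 : `|Re (g w - g w0) - Re om * a| <= (1 + 2 * Re om) * `|a| / 8.
  have -> : Re (g w - g w0) - Re om * a = Re ((g w - g w0 - l * (w - w0)) - om * E).
    rewrite (_ : _ - om * E = g w - g w0 - om * a%:C); last by rewrite /E /om; field.
    by rewrite !ReImE /=; ring.
  apply: le_trans (normc_Re _) _; apply: le_trans (normcB _ _) _; rewrite Normc.normcM.
  apply: le_trans e16.
  have : normc om * normc E <= normc om * (e1 * N) by rewrite ler_wpM2l ?normc_ge0.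
  by lra.
move: key1 key2; rewrite !ler_norml => /andP[a1 a2] /andP[b1 b2].
have ma : 0 <= m * `|a| by rewrite mulr_ge0// ltW.
split => h.
  have a0 : 0 < a.
    rewrite ltNge; apply/negP => a0; rewrite ler0_norm// in a2 ma; nra.
  by rewrite gtr0_norm// in b1; nra.
have a0 : a < 0.
  rewrite ltNge; apply/negP => a0; rewrite ger0_norm// in a1 ma; nra.
by rewrite ltr0_norm// in b2; nra.
Qed.

End Moebius.

(** * Level curves *)

Section LevelCurves.
Context {R : realType}.
Variables (Phi : R -> R -> R[i]) (m M : R).

Lemma ivt_on (T : R -> R) (a b v : R) : a <= b ->
  (forall x, a <= x -> x <= b -> rcont T x) -> T a <= v -> v <= T b ->
  exists x, [/\ a <= x, x <= b & T x = v].
Proof.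
move=> ab cT av vb.
have [||x] := @IVT R T a b v ab.
- apply: continuous_in_subspaceT => x; rewrite inE /= in_itv /= => /andP[ax xb].
  exact/rcontP/cT.
- by rewrite ge_min av le_max vb orbT.
by rewrite in_itv /= => /andP[ax xb] <-; exists x.
Qed.

(* x is the slope of a ray in the half plane, s its height above the real axis. *)
Definition monotone_levels :=
  [/\ forall x s, 0 < s -> local_incr (fun s => Im (Phi x s)) s,
      forall x e, 0 < e -> exists2 d : R, 0 < d & forall s, 0 < s -> s < d -> `|Im (Phi x s) - m| < e,
      forall x e, 0 < e -> exists2 B : R, 0 < B & forall s, B < s -> `|Im (Phi x s) - M| < e,
      forall x0 s0, 0 < s0 -> forall e, 0 < e -> exists2 d : R, 0 < d &
        forall x s, `|x - x0| < d -> `|s - s0| < d -> normc (Phi x s - Phi x0 s0) < e &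
      forall x0 s0, 0 < s0 -> exists2 e : R, 0 < e &
        forall x s, `|x - x0| < e -> `|s - s0| < e -> Im (Phi x s) = Im (Phi x0 s0) ->
        (x0 < x -> Re (Phi x0 s0) < Re (Phi x s)) /\ (x < x0 -> Re (Phi x s) < Re (Phi x0 s0))].

Hypothesis Hyp : monotone_levels.

Lemma Im_mono x s s' : 0 < s -> s < s' -> Im (Phi x s) < Im (Phi x s').
Proof.
move=> s0 ss'; case: Hyp => H1 _ _ _ _.
by apply: (@local_incr_lt R (fun s => Im (Phi x s))) => // t st ts; apply: H1; apply: lt_le_trans st.
Qed.

Lemma Im_le_mono x s s' : 0 < s -> s <= s' -> Im (Phi x s) <= Im (Phi x s').
Proof. by move=> s0; rewrite le_eqVlt => /orP[/eqP ->//|/(Im_mono x s0)/ltW]. Qed.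

Lemma Im_inj x s s' : 0 < s -> 0 < s' -> Im (Phi x s) = Im (Phi x s') -> s = s'.
Proof.
move=> s0 s'0 h; case: (ltgtP s s') => // lt; exfalso.
  by have := Im_mono x s0 lt; rewrite h ltxx.
by have := Im_mono x s'0 lt; rewrite h ltxx.
Qed.

Lemma Im_range x s : 0 < s -> m < Im (Phi x s) < M.
Proof.
move=> s0; case: Hyp => _ Hm HM _ _.
have s20 : 0 < s / 2 by rewrite divr_gt0.
apply/andP; split.
  apply: (@le_lt_trans _ _ (Im (Phi x (s / 2)))); last by apply: Im_mono => //; lra.
  rewrite leNgt; apply/negP => h.
  have e0 : 0 < m - Im (Phi x (s / 2)) by rewrite subr_gt0.
  have [d d0 Hd] := Hm x _ e0.
  pose t := Num.min (s / 2) d / 2.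
  have mt : 0 < Num.min (s / 2) d by rewrite lt_min s20.
  have t0 : 0 < t by rewrite divr_gt0.
  have : t < Num.min (s / 2) d by rewrite /t; lra.
  rewrite lt_min => /andP[ts td].
  have := Hd _ t0 td; have := Im_mono x t0 ts; rewrite ltr_norml => h1 /andP[h2 _]; lra.
apply: (@lt_le_trans _ _ (Im (Phi x (s + 1)))); first by apply: Im_mono => //; lra.
rewrite leNgt; apply/negP => h.
have e0 : 0 < Im (Phi x (s + 1)) - M by rewrite subr_gt0.
have [B B0 HB] := HM x _ e0.
have t1 : B < Num.max (s + 1) B + 1.
  by have : B <= Num.max (s + 1) B; [rewrite le_max lexx orbT|lra].
have t2 : s + 1 < Num.max (s + 1) B + 1.
  by have : s + 1 <= Num.max (s + 1) B; [rewrite le_max lexx|lra].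
have s10 : 0 < s + 1 by lra.
have := HB _ t1; have := Im_mono x s10 t2; rewrite ltr_norml => h1 /andP[_ h2]; lra.
Qed.

Lemma Phi_rcont x s : 0 < s -> rcont (fun s => Im (Phi x s)) s.
Proof.
move=> s0 e e0; case: Hyp => _ _ _ Hc _; have [d d0 Hd] := Hc x s s0 e e0.
exists d => // t ts; have := Hd x t; rewrite subrr normr0 => /(_ d0 ts).
by apply: le_lt_trans; rewrite -ImN -ImD normc_Im.
Qed.

Lemma level_exists x c : m < c -> c < M -> exists2 s, 0 < s & Im (Phi x s) = c.
Proof.
move=> mc cM; case: Hyp => _ Hm HM _ _.
have e1 : 0 < c - m by rewrite subr_gt0.
have e2 : 0 < M - c by rewrite subr_gt0.
have [d d0 Hd] := Hm x _ e1; have [B B0 HB] := HM x _ e2.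
have d20 : 0 < d / 2 by rewrite divr_gt0.
have ua : Im (Phi x (d / 2)) < c.
  by have := Hd (d / 2) d20; rewrite ltr_norml => /(_ _)/andP h; have [|h1 h2] := h; lra.
have ub : c < Im (Phi x (B + 1)).
  by have := HB (B + 1); rewrite ltr_norml => /(_ _)/andP h; have [|h1 h2] := h; lra.
have ab : d / 2 <= B + 1.
  rewrite leNgt; apply/negP => h.
  have B10 : 0 < B + 1 by lra.
  by have := Im_mono x B10 h; lra.
have cT s : d / 2 <= s -> s <= B + 1 -> rcont (fun s => Im (Phi x s)) s.
  by move=> sa _; apply: Phi_rcont; apply: lt_le_trans sa.
have [s [sa sb sE]] := ivt_on ab cT (ltW ua) (ltW ub).
by exists s => //; apply: lt_le_trans sa.
Qed.

(** Continuity of the height at which a ray meets a level. On the ray x0 the heights s0 - e1 and s0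
    + e1 miss the level by at least 2 g; nearby rays keep a gap g there, and monotonicity in s traps
    the height in between. *)
Lemma level_near x0 s0 e : 0 < s0 -> 0 < e -> exists2 d : R, 0 < d &
  forall x s, `|x - x0| < d -> 0 < s -> `|Im (Phi x s) - Im (Phi x0 s0)| < d -> `|s - s0| < e.
Proof.
move=> s00 e0; case: Hyp => _ _ _ Hc _.
pose e1 := Num.min e s0 / 2.
have me : 0 < Num.min e s0 by rewrite lt_min e0.
have [e10 e1e e1s] : [/\ 0 < e1, e1 < e & e1 < s0].
  have : e1 < Num.min e s0 by rewrite /e1; lra.
  by rewrite lt_min => /andP[h1 h2]; split => //; rewrite divr_gt0.
have a0 : 0 < s0 - e1 by lra.
have b0 : 0 < s0 + e1 by lra.
have ua : Im (Phi x0 (s0 - e1)) < Im (Phi x0 s0) by apply: Im_mono => //; lra.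
have ub : Im (Phi x0 s0) < Im (Phi x0 (s0 + e1)) by apply: Im_mono => //; lra.
pose g := Num.min (Im (Phi x0 s0) - Im (Phi x0 (s0 - e1))) (Im (Phi x0 (s0 + e1)) - Im (Phi x0 s0)) / 2.
have [g0 ga gb] : [/\ 0 < g, 2 * g <= Im (Phi x0 s0) - Im (Phi x0 (s0 - e1)) &
    2 * g <= Im (Phi x0 (s0 + e1)) - Im (Phi x0 s0)].
  have -> : 2 * g = Num.min (Im (Phi x0 s0) - Im (Phi x0 (s0 - e1))) (Im (Phi x0 (s0 + e1)) - Im (Phi x0 s0)).
    by rewrite /g; field.
  rewrite !ge_min !lexx orbT; split => //.
  by rewrite divr_gt0// lt_min !subr_gt0 ua.
have [d1 d10 Hd1] := Hc x0 _ a0 _ g0; have [d2 d20 Hd2] := Hc x0 _ b0 _ g0.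
exists (Num.min g (Num.min d1 d2)); first by rewrite !lt_min g0 d10.
move=> x s; rewrite !lt_min => /and3P[_ x1 x2] sp /and3P[us _ _].
have h1 := Hd1 x (s0 - e1) x1; rewrite subrr normr0 in h1; have {}h1 := h1 d10.
have h2 := Hd2 x (s0 + e1) x2; rewrite subrr normr0 in h2; have {}h2 := h2 d20.
have := normc_Im (Phi x (s0 - e1) - Phi x0 (s0 - e1)).
rewrite ImD ImN ler_norml => /andP[i1 i2].
have := normc_Im (Phi x (s0 + e1) - Phi x0 (s0 + e1)).
rewrite ImD ImN ler_norml => /andP[j1 j2].
move: us; rewrite ltr_norml => /andP[k1 k2].
rewrite ltr_norml; apply/andP; split.
  suff : s0 - e1 < s by lra.
  by rewrite ltNge; apply/negP => /(Im_le_mono x sp); lra.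
suff : s < s0 + e1 by lra.
by rewrite ltNge; apply/negP => /(Im_le_mono x b0); lra.
Qed.

(** Every ray meets the level exactly once, so the level is a graph x -> s x, continuous by
    [level_near]. The last clause of [monotone_levels] makes Re locally increasing along it, and
    local increase everywhere is increase. *)
Lemma level_curve c : m < c -> c < M -> exists s : R -> R,
  [/\ forall x, 0 < s x, forall x, Im (Phi x (s x)) = c,
      forall x y, x < y -> Re (Phi x (s x)) < Re (Phi y (s y)) &
      forall x, rcont (fun x => Re (Phi x (s x))) x].
Proof.
move=> mc cM; case: (Hyp) => _ _ _ Hc Hl.
have /choice[s Hs] : forall x, exists t, 0 < t /\ Im (Phi x t) = c.
  by move=> x; have [t t0 tE] := level_exists x mc cM; exists t.
have s0 x : 0 < s x by case: (Hs x).
have sE x : Im (Phi x (s x)) = c by case: (Hs x).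
have near x0 e : 0 < e -> exists2 d : R, 0 < d & forall x, `|x - x0| < d ->
    `|x - x0| < e /\ `|s x - s x0| < e.
  move=> e0; have [d d0 Hd] := level_near x0 (s0 x0) e0.
  exists (Num.min d e); first by rewrite lt_min d0.
  by move=> x; rewrite lt_min => /andP[xd xe]; split => //; apply: (Hd x) => //;
    rewrite !sE subrr normr0.
exists s; split => //.
- move=> x y; apply: (@local_incr_lt R (fun x => Re (Phi x (s x)))) => x0 _ _.
  have [e e0 He] := Hl x0 _ (s0 x0); have [d d0 Hd] := near x0 e e0.
  by exists d => // y' /Hd[h1 h2]; apply: He; rewrite ?sE.
- move=> x0 e e0; have [d1 d10 Hd1] := Hc x0 _ (s0 x0) e e0.
  have [d d0 Hd] := near x0 d1 d10.
  exists d => // y /Hd[h1 h2]; apply: le_lt_trans (Hd1 _ _ h1 h2).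
  by rewrite -ReN -ReD normc_Re.
Qed.

Lemma Phi_inj x s x' s' : 0 < s -> 0 < s' -> Phi x s = Phi x' s' -> x = x' /\ s = s'.
Proof.
move=> s0 s'0 E; have /andP[mc cM] := Im_range x s0.
have [t [t0 tE tinc _]] := level_curve mc cM.
have sE : s = t x by apply: (@Im_inj x); rewrite ?tE.
have s'E : s' = t x' by apply: (@Im_inj x'); rewrite ?tE// E.
have xx' : x = x'.
  by case: (ltgtP x x') => // /tinc; rewrite -sE -s'E E ltxx.
by split => //; rewrite sE s'E xx'.
Qed.

Definition slice c := [set p | exists x s, 0 < s /\ Phi x s = p +i* c].

(** Along the level Re is continuous, bounded and strictly increasing in x over the whole line, so
    its values fill an open interval. *)
Lemma sliceP B c : m < c -> c < M -> (forall x s, 0 < s -> normc (Phi x s) <= B) ->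
  inf (slice c) < sup (slice c) /\
  forall p, slice c p <-> inf (slice c) < p < sup (slice c).
Proof.
move=> mc cM HB; have [t [t0 tE tinc tcont]] := level_curve mc cM.
pose P x := Re (Phi x (t x)).
have SP x : slice c (P x).
  by exists x, (t x); split => //; apply: eq_ReIm; rewrite /= ?tE.
have PS p : slice c p -> exists x, p = P x.
  move=> [x [s [s0 E]]]; exists x.
  have sE : s = t x by apply: (@Im_inj x); rewrite ?tE// E.
  by rewrite /P -sE E.
have hsup : has_sup (slice c).
  split; first by exists (P 0).
  exists B => _ /PS[x ->]; apply: le_trans (HB x _ (t0 x)).
  by apply: le_trans (normc_Re _); exact: ler_norm.
have hinf : has_inf (slice c).
  split; first by exists (P 0).
  exists (- B) => _ /PS[x ->]; rewrite lerNl; apply: le_trans (HB x _ (t0 x)).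
  by apply: le_trans (normc_Re _); rewrite -normrN; exact: ler_norm.
have bnd x : inf (slice c) < P x < sup (slice c).
  apply/andP; split.
    apply: (@le_lt_trans _ _ (P (x - 1))); last by apply: tinc; lra.
    exact: (ge_inf (proj2 hinf) (SP _)).
  apply: (@lt_le_trans _ _ (P (x + 1))); first by apply: tinc; lra.
  exact: (ub_le_sup (proj2 hsup) (SP _)).
split; first by have /andP[h1 h2] := bnd 0; exact: lt_trans h1 h2.
move=> p; split=> [/PS[x ->]//|/andP[p1 p2]].
have e1 : 0 < p - inf (slice c) by rewrite subr_gt0.
have e2 : 0 < sup (slice c) - p by rewrite subr_gt0.
have [_ /PS[x1 ->] h1] := inf_adherent e1 hinf.
have [_ /PS[x2 ->] h2] := sup_adherent e2 hsup.
have h1' : P x1 < p by lra.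
have h2' : p < P x2 by lra.
have x12 : x1 <= x2.
  by rewrite leNgt; apply/negP => /tinc; rewrite -/(P _) -/(P _); lra.
have [x [_ _ <-]] := ivt_on x12 (fun x _ _ => tcont x) (ltW h1') (ltW h2').
exact: SP.
Qed.

(** The level through the point reaches at least 2 eta to either side, at the slopes x0 - 1 and x0 +
    1. Neighbouring levels pass within eta of these two places, and each is a full interval, so
    together they cover a neighbourhood. *)
Lemma Phi_open B x0 s0 : (forall x s, 0 < s -> normc (Phi x s) <= B) -> 0 < s0 ->
  exists2 e : R, 0 < e & forall y, normc (y - Phi x0 s0) < e -> exists x s, 0 < s /\ Phi x s = y.
Proof.
move=> HB s00; case: (Hyp) => _ _ _ Hc _.
have /andP[mc cM] := Im_range x0 s00.
have [t [t0 tE tinc _]] := level_curve mc cM.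
have s0E : s0 = t x0 by apply: (@Im_inj x0); rewrite ?tE.
have p1 : Re (Phi (x0 - 1) (t (x0 - 1))) < Re (Phi x0 s0) by rewrite s0E; apply: tinc; lra.
have p2 : Re (Phi x0 s0) < Re (Phi (x0 + 1) (t (x0 + 1))) by rewrite s0E; apply: tinc; lra.
pose eta := Num.min (Re (Phi x0 s0) - Re (Phi (x0 - 1) (t (x0 - 1))))
   (Re (Phi (x0 + 1) (t (x0 + 1))) - Re (Phi x0 s0)) / 2.
have [eta0 eta1 eta2] : [/\ 0 < eta, 2 * eta <= Re (Phi x0 s0) - Re (Phi (x0 - 1) (t (x0 - 1))) &
    2 * eta <= Re (Phi (x0 + 1) (t (x0 + 1))) - Re (Phi x0 s0)].
  have -> : 2 * eta = Num.min (Re (Phi x0 s0) - Re (Phi (x0 - 1) (t (x0 - 1))))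
      (Re (Phi (x0 + 1) (t (x0 + 1))) - Re (Phi x0 s0)) by rewrite /eta; field.
  rewrite !ge_min !lexx orbT; split => //.
  by rewrite divr_gt0// lt_min !subr_gt0 p1.
have stay x1 : exists2 b : R, 0 < b & forall c, m < c -> c < M -> `|c - Im (Phi x0 s0)| < b ->
    exists p, slice c p /\ `|p - Re (Phi x1 (t x1))| < eta.
  have [d d0 Hd] := Hc x1 _ (t0 x1) _ eta0.
  have [b b0 Hb] := level_near x1 (t0 x1) d0.
  exists b => // c mc' c'M cb; have [s sp sE] := level_exists x1 mc' c'M.
  have ss : `|s - t x1| < d by apply: (Hb x1 s) => //; rewrite ?subrr ?normr0 ?tE ?sE.
  exists (Re (Phi x1 s)); split.
    by exists x1, s; split => //; apply: eq_ReIm.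
  have := Hd x1 s; rewrite subrr normr0 => /(_ d0 ss).
  by apply: le_lt_trans; rewrite -ReN -ReD normc_Re.
have [b1 b10 Hb1] := stay (x0 - 1); have [b2 b20 Hb2] := stay (x0 + 1).
set c0 := Im (Phi x0 s0) in mc cM Hb1 Hb2.
exists (Num.min eta (Num.min (Num.min b1 b2) (Num.min (c0 - m) (M - c0)))).
  by rewrite !lt_min eta0 b10 b20 !subr_gt0 mc cM.
move=> y; rewrite !lt_min => /and3P[y1 /andP[y2 y3] /andP[y4 y5]].
have := normc_Im (y - Phi x0 s0); rewrite ImD ImN -/c0 => iy.
have := normc_Re (y - Phi x0 s0); rewrite ReD ReN ler_norml => /andP[r1 r2].
have /andP[iy1 iy2] : - normc (y - Phi x0 s0) <= Im y - c0 <= normc (y - Phi x0 s0) by rewrite -ler_norml.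
have mc' : m < Im y by lra.
have c'M : Im y < M by lra.
have [q1 [Sq1]] := Hb1 _ mc' c'M (le_lt_trans iy y2).
have [q2 [Sq2]] := Hb2 _ mc' c'M (le_lt_trans iy y3).
rewrite !ltr_norml => /andP[u1 u2] /andP[v1 v2].
have [_ HS] := sliceP mc' c'M HB.
have /andP[w1 w2] := (HS q1).1 Sq1; have /andP[w3 w4] := (HS q2).1 Sq2.
have [|x [s [sp E]]] := (HS (Re y)).2; first by apply/andP; split; lra.
by exists x, s; split => //; rewrite E; apply: eq_ReIm.
Qed.

End LevelCurves.

(** * Half-lines filling the complement *)

Section Rays.
Context {R : realType}.
Implicit Types (a b d z : R[i]).

Definition ray a b := [set a + t%:C * b | t in [set t : R | 0 <= t]].

Lemma ray_halfline a b : b != 0 -> is_halfline (ray a b).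
Proof. by move=> b0; exists a, b. Qed.

Lemma halfline_cover (O : set R[i]) d (m M : R) (lo hi : R -> R) : d != 0 -> m < M ->
  (forall p c, O (d * (p +i* c)) -> m < c < M) ->
  (forall c, m < c -> c < M -> lo c < hi c) ->
  (forall c p, m < c -> c < M -> O (d * (p +i* c)) <-> lo c < p < hi c) ->
  exists F : set (set R[i]),
    [/\ (forall L, F L -> is_halfline L),
        (forall L1 L2, F L1 -> F L2 -> L1 <> L2 -> L1 `&` L2 = set0) &
        ~` O = \bigcup_(L in F) L].
Proof.
move=> d0 mM Om lohi Oslice.
(* The member of the family meant to pass through d (p + i c); it depends on p only through the side
   of the slice, or through the foot of an orthogonal ray. The lines c = m and c = M belong to the
   orthogonal rays. *)
pose through p c : set R[i] :=
  if c <= m then ray (d * (p +i* m)) (d * - 'i) else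
  if M <= c then ray (d * (p +i* M)) (d * 'i) else
  if p <= lo c then ray (d * (lo c +i* c)) (d * - 1) else ray (d * (hi c +i* c)) (d * 1).
have i0 : ('i : R[i]) != 0 by rewrite eq_complex /= oner_eq0 andbF.
have coord p c q e (x : R[i]) t : d * (p +i* c) + t%:C * (d * x) = d * (q +i* e) ->
    q = p + t * Re x /\ e = c + t * Im x.
  move=> h; have : (p +i* c) + t%:C * x = q +i* e by apply: (mulfI d0); rewrite -h; ring.
  by move=> E; rewrite -[q]/(Re (q +i* e)) -[e in _ /\ e = _]/(Im (q +i* e)) -E !ReImE /=; split; ring.
have self p c : ~ O (d * (p +i* c)) -> through p c (d * (p +i* c)).
  move=> nO; rewrite /through; have [cm|mc] := leP c m.
    exists (m - c); first by rewrite /= subr_ge0.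
    by rewrite mulrCA -mulrDr; congr (_ * _); apply: eq_ReIm; rewrite !ReImE /=; ring.
  have [Mc|cM] := leP M c.
    exists (c - M); first by rewrite /= subr_ge0.
    by rewrite mulrCA -mulrDr; congr (_ * _); apply: eq_ReIm; rewrite !ReImE /=; ring.
  have [pl|lp] := leP p (lo c).
    exists (lo c - p); first by rewrite /= subr_ge0.
    by rewrite mulrCA -mulrDr; congr (_ * _); apply: eq_ReIm; rewrite !ReImE /=; ring.
  have hp : hi c <= p.
    by rewrite leNgt; apply/negP => h; apply: nO; apply/Oslice => //; rewrite lp.
  exists (p - hi c); first by rewrite /= subr_ge0.
  by rewrite mulrCA -mulrDr; congr (_ * _); apply: eq_ReIm; rewrite !ReImE /=; ring.
(* Each point of a member lies outside O and has this very member as its own. Hence members with a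
   common point coincide, and the union avoids O. *)
have determined p c q e : ~ O (d * (p +i* c)) -> through p c (d * (q +i* e)) ->
    through q e = through p c /\ ~ O (d * (q +i* e)).
  move=> nO; rewrite {1 3}/through; have [cm|mc] := leP c m.
    move=> [t /= t0 /coord[/= qE eE]]; rewrite oppr0 mulr0 addr0 in qE; rewrite mulrN1 in eE; rewrite qE.
    have em : e <= m by rewrite eE; lra.
    by rewrite /through em; split => // /Om/andP[]; rewrite ltNge em.
  have [Mc|cM] := leP M c.
    move=> [t /= t0 /coord[/= qE eE]]; rewrite mulr0 addr0 in qE; rewrite mulr1 in eE; rewrite qE.
    have Me : M <= e by rewrite eE; lra.
    rewrite /through Me leNgt (lt_le_trans mM Me); split => // /Om/andP[_].
    by rewrite ltNge Me.
  have [pl|lp] := leP p (lo c).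
    move=> [t /= t0 /coord[/= qE eE]]; rewrite mulrN1 in qE; rewrite oppr0 mulr0 addr0 in eE; rewrite eE.
    have ql : q <= lo c by rewrite qE; lra.
    rewrite /through leNgt mc /= leNgt cM /= ql; split => // /(Oslice _ _ mc cM)/andP[].
    by rewrite ltNge ql.
  move=> [t /= t0 /coord[/= qE eE]]; rewrite mulr1 in qE; rewrite mulr0 addr0 in eE; rewrite eE.
  have hq : hi c <= q by rewrite qE; lra.
  rewrite /through leNgt mc /= leNgt cM /= leNgt (lt_le_trans (lohi _ mc cM) hq) /=.
  by split => // /(Oslice _ _ mc cM)/andP[_]; rewrite ltNge hq.
have cplx z : exists p c, z = d * (p +i* c).
  exists (Re (z / d)), (Im (z / d)).
  by rewrite (_ : _ +i* _ = z / d) ?[d * _]mulrC ?divfK//; apply: eq_ReIm.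
exists [set L | exists p c, ~ O (d * (p +i* c)) /\ L = through p c]; split.
- move=> L [p [c [_ ->]]]; rewrite /through.
  by case: ifP => _; [|case: ifP => _; [|case: ifP => _]]; apply: ray_halfline;
    rewrite mulf_neq0// ?oppr_eq0// oner_eq0.
- move=> L1 L2 [p [c [nO1 ->]]] [q [e [nO2 ->]]] neq.
  rewrite -subset0 => z [z1 z2]; apply: neq.
  have [p' [c' zE]] := cplx z; rewrite zE in z1 z2.
  by rewrite -(determined _ _ _ _ nO1 z1).1 -(determined _ _ _ _ nO2 z2).1.
- apply/seteqP; split => z.
    have [p [c ->]] := cplx z; move=> nO; exists (through p c); last exact: self.
    by exists p, c.
  move=> [L [p [c [nO ->]]]]; have [q [e ->]] := cplx z.
  by move=> /(determined _ _ _ _ nO)[].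
Qed.

End Rays.

(** * From the disk to monotone levels *)

Section ShearedDisk.
Context {R : realType}.
Implicit Types (z w l d : R[i]) (f g h : R[i] -> R[i]) (t : R).

Lemma ccontD f g z : ccont f z -> ccont g z -> ccont (fun w => f w + g w) z.
Proof.
move=> Hf Hg e e0; have e20 : 0 < e / 2 by lra.
have [d1 d10 H1] := Hf _ e20; have [d2 d20 H2] := Hg _ e20.
exists (Num.min d1 d2); first by rewrite lt_min d10.
move=> w; rewrite lt_min => /andP[/H1 {}H1 /H2 {}H2].
rewrite (_ : _ - _ = (f w - f z) + (g w - g z)); last by ring.
by apply: le_lt_trans (normcD _ _) _; lra.
Qed.

Lemma ccontZ d f z : ccont f z -> ccont (fun w => d * f w) z.
Proof.
move=> Hf e e0; have c0 : 0 < normc d + 1 by rewrite ltr_wpDl ?normc_ge0.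
have [r r0 Hr] := Hf (e / (normc d + 1)) (divr_gt0 e0 c0).
exists r => // w /Hr; rewrite -mulrBr Normc.normcM ltr_pdivlMr// => h.
by have := normc_ge0 (f w - f z); have := normc_ge0 d; nra.
Qed.

Lemma ccont_conj f z : ccont f z -> ccont (fun w => (f w)^*%C) z.
Proof.
move=> Hf e /Hf[r r0 Hr]; exists r => // w /Hr.
by rewrite -normc_conj rmorphB.
Qed.

(** Minima of Im for f, - f, i f and - i f bound both parts of f from both sides. *)
Lemma closed_disk_bounded f (r : R) : 0 < r -> (forall z, normc z <= r -> ccont f z) ->
  exists B, forall z, normc z <= r -> normc (f z) <= B.
Proof.
move=> r0 cf.
have [z1 _ H1] := closed_disk_Im_min r0 cf.
have [z2 _ H2] := closed_disk_Im_min r0 (fun z zr => ccontZ (- 1) (cf z zr)).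
have [z3 _ H3] := closed_disk_Im_min r0 (fun z zr => ccontZ 'i (cf z zr)).
have [z4 _ H4] := closed_disk_Im_min r0 (fun z zr => ccontZ (- 'i) (cf z zr)).
exists (`|Im (f z1)| + `|Im (f z2)| + `|Re (f z3)| + `|Re (f z4)|) => z zr.
apply: le_trans (normc_ReDIm _) _.
have h1 := H1 z zr; have := H2 z zr; have := H3 z zr; have := H4 z zr.
have e1 w : Im (-1 * w) = - Im w by rewrite mulN1r ImN.
have e2 w : Im ('i * w) = Re w by rewrite mulrC ImiRe.
have e3 w : Im (- 'i * w) = - Re w by rewrite mulNr ImN e2.
rewrite !e1 !e2 !e3 => h4 h3 h2.
have n1 := ler_norm (- Im (f z1)); have n2 := ler_norm (Im (f z2)).
have n3 := ler_norm (- Re (f z3)); have n4 := ler_norm (Re (f z4)).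
rewrite normrN in n1; rewrite normrN in n3.
have p1 := normr_ge0 (Im (f z1)); have p2 := normr_ge0 (Im (f z2)).
have p3 := normr_ge0 (Re (f z3)); have p4 := normr_ge0 (Re (f z4)).
have : `|Re (f z)| <= `|Re (f z3)| + `|Re (f z4)| by rewrite ler_norml; apply/andP; split; lra.
have : `|Im (f z)| <= `|Im (f z1)| + `|Im (f z2)| by rewrite ler_norml; apply/andP; split; lra.
lra.
Qed.

Lemma Im_div z w : w != 0 -> Im (z / w) = Im (z * w^*%C) / normc w ^+ 2.
Proof.
move=> w0; have n0 : normc w ^+ 2 != 0 by rewrite expf_neq0// normc_eq0.
have nC : (normc w ^+ 2)%:C != 0 :> R[i] by rewrite eq_complex /= eqxx andbT.
rewrite (_ : z / w = z * w^*%C * ((normc w ^+ 2)^-1)%:C); last first.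
  have cc : ((normc w ^+ 2)^-1)%:C * (normc w ^+ 2)%:C = 1 :> R[i] by rewrite -rmorphM mulVf.
  by apply: (mulIf nC); rewrite -[RHS]mulrA cc mulr1 -normcJM; field.
by rewrite [LHS]ImM mulr0 add0r mulrC.
Qed.

(** The quantity equals (|a|^2 - |b|^2) / |a - b|^2. With a = conj d h' and b = d g' this is where
    |g'| < |h'| enters. *)
Lemma Re_div_pos (a b : R[i]) : normc b < normc a -> 0 < 1 + 2 * Re (b / (a - b)).
Proof.
move=> ba; have ab0 : a - b != 0.
  by rewrite subr_eq0; apply: contraTneq ba => ->; rewrite ltxx.
have n0 : 0 < normc (a - b) ^+ 2 by rewrite exprn_gt0// normc_gt0.
have -> : Re (b / (a - b)) = Re (b * (a - b)^*%C) / normc (a - b) ^+ 2.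
  have := Im_div ('i * b) ab0; rewrite -!mulrA.
  move: (b / (a - b)) (b * (a - b)^*%C) => X Y; rewrite !ReImE /= !mul0r !add0r !mul1r; exact.
rewrite -(@pmulr_lgt0 _ (normc (a - b) ^+ 2))// mulrDl mul1r -mulrA divfK ?gt_eqF//.
rewrite (_ : _ + _ = normc a ^+ 2 - normc b ^+ 2).
  by rewrite subr_gt0 ltr_sqr ?nnegrE ?normc_ge0.
by rewrite !sqr_normc_ReIm !ReImE; ring.
Qed.

Definition polar_point (x s : R) : R[i] := (s * x) +i* s.

Lemma polar_point_near (x0 s0 e : R) : 0 < s0 -> 0 < e -> exists2 d : R, 0 < d &
  forall x s, `|x - x0| < d -> `|s - s0| < d ->
    normc (polar_point x s - polar_point x0 s0) < e.
Proof.
move=> s00 e0; pose L := `|x0| + s0 + 3.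
have L0 : 0 < L by rewrite /L; have := normr_ge0 x0; lra.
exists (Num.min 1 (e / L)); first by rewrite lt_min ltr01 divr_gt0.
move=> x s; rewrite !lt_min => /andP[x1 xe] /andP[s1 se].
apply: le_lt_trans (normc_ReDIm _) _; rewrite /= -/(_ - _).
have -> : s * x - s0 * x0 = (s - s0) * x + s0 * (x - x0) by ring.
have h1 : `|(s - s0) * x + s0 * (x - x0)| <= `|s - s0| * `|x| + s0 * `|x - x0|.
  by apply: le_trans (ler_normD _ _) _; rewrite !normrM (gtr0_norm s00).
have h2 : `|x| <= `|x0| + 1.
  rewrite {1}(_ : x = x0 + (x - x0)); last by ring.
  by apply: le_trans (ler_normD _ _) _; lra.
have n1 := normr_ge0 (s - s0); have n2 := normr_ge0 (x - x0); have n3 := normr_ge0 x0.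
have h3 : `|s - s0| * `|x| <= `|s - s0| * (`|x0| + 1) by rewrite ler_wpM2l.
rewrite ltr_pdivlMr// in xe; rewrite ltr_pdivlMr// in se.
move: h1 h3 xe se; rewrite /L; nra.
Qed.

Lemma cvderiv_polar_point x s : cvderiv (polar_point x) s (x +i* 1).
Proof.
split; rewrite /=; last exact: is_derive_id.
rewrite (_ : (fun s => s * x) = x \*: (id : R -> R)); last by apply/funext => t; rewrite /= mulrC.
by apply: is_derive_eq (is_deriveZ _ _) _; rewrite /GRing.scale/= mulr1.
Qed.

(* Im (conj d f) is the imaginary part of the analytic function conj d h - d g, whose derivative is K,
   and conj d f differs from that function by 2 Re (d g). *)
Lemma sheared_disk_monotone_levels h g (H g1 : R[i] -> R[i]) d (r : R) z1 z2 :
  0 < r -> d * d^*%C = 1 -> normc z1 = r -> normc z2 = r -> z1 != z2 ->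
  (forall z, normc z <= r -> cderiv h z (H z)) ->
  (forall z, normc z <= r -> cderiv g z (g1 z)) ->
  (forall z, normc z < r -> normc (g1 z) < normc (H z)) ->
  (forall z, normc z < r ->
    0 < Im ((z - z1) * (z - z2) * (d^*%C * H z + - d * g1 z) / (z1 - z2))) ->
  exists W : R[i] -> R[i], [/\
    forall w, 0 < Im w -> normc (W w) < r,
    forall z, normc z < r -> exists2 w, 0 < Im w & W w = z &
    let F z := d^*%C * (h z + (g z)^*%C) in
    monotone_levels (fun x s => F (W (polar_point x s))) (Im (F z1)) (Im (F z2))].
Proof.
move=> r0 dd r1 r2 z12 dh dg gH Qpos.
have [W [W1 W2 W3 W4 W5]] := moebius_exists r0 r1 r2 z12.
exists W; split => // F.
have nd : normc d = 1.
  have := congr1 (@Normc.normc R) dd; rewrite Normc.normcM normc_conj Normc.normc1 => h1.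
  by have := normc_ge0 d; nra.
pose K z := d^*%C * H z + - d * g1 z.
pose Gam z := d^*%C * h z + - d * g z; pose gam z := d * g z.
have dGam z : normc z <= r -> cderiv Gam z (K z).
  by move=> zr; apply: cderivD; apply: cderivZ; [exact: dh|exact: dg].
have dgam z : normc z <= r -> cderiv gam z (d * g1 z) by move=> zr; apply: cderivZ; exact: dg.
have FIm z : Im (F z) = Im (Gam z) by rewrite /F /Gam !ReImE; ring.
have FRe z : Re (F z) = Re (Gam z) + 2 * Re (gam z) by rewrite /F /Gam /gam !ReImE; ring.
have cF z : normc z <= r -> ccont F z.
  move=> zr; apply: ccontZ; apply: ccontD; first exact: cderiv_ccont (dh _ zr).
  by apply: ccont_conj; exact: cderiv_ccont (dg _ zr).
have key w : 0 < Im w -> exists k, exists l, [/\ cderiv (Gam \o W) w k, cderiv (gam \o W) w l,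
    0 < Im (w * k) & 0 < 1 + 2 * Re (l / k)].
  move=> w0; have [l Hl lE] := W3 w w0; have zr := W1 w w0.
  have z120 : z1 - z2 != 0 by rewrite subr_eq0.
  exists (K (W w) * l), (d * g1 (W w) * l); split.
  - exact: cderiv_comp Hl (dGam _ (ltW zr)).
  - exact: cderiv_comp Hl (dgam _ (ltW zr)).
  - have -> : w * (K (W w) * l) = (W w - z1) * (W w - z2) * K (W w) / (z1 - z2).
      by rewrite -lE; field.
    exact: Qpos.
  - have l0 : l != 0.
      apply/eqP => l0; have := Qpos _ zr; rewrite -lE l0 mulr0 !mul0r /= ltxx; exact.
    have -> : d * g1 (W w) * l / (K (W w) * l) = d * g1 (W w) / (d^*%C * H (W w) - d * g1 (W w)).
      by rewrite -mulNr -/(K _) invfM mulrACA divff// mulr1.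
    by apply: Re_div_pos; rewrite !Normc.normcM normc_conj nd !mul1r; exact: gH.
have pw x s : 0 < s -> 0 < Im (polar_point x s) by [].
split.
- move=> x s s0; have [k [_ [Hk _ kpos _]]] := key _ (pw x s s0).
  have [_ dI] := cvderiv_comp (cvderiv_polar_point x s) Hk.
  rewrite (_ : (fun s => _) = (fun s => Im (Gam (W (polar_point x s))))); last first.
    by apply/funext => t; rewrite FIm.
  apply: is_derive_local_incr dI _.
  (* The derivative along the ray is k (x + i), and the point itself is s (x + i) with s > 0, so Im
     (w k) > 0 is the required sign. *)
  have e1 : polar_point x s * k = s%:C * (k * (x +i* 1)).
    by rewrite (_ : polar_point x s = s%:C * (x +i* 1)); [ring|apply: eq_ReIm; rewrite !ReImE /=; ring].
  move: kpos; rewrite e1; move: (k * _) => X; rewrite ImM /= mul0r addr0.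
  by rewrite pmulr_rgt0.
- move=> x e e0; have zr : normc z1 <= r by rewrite r1.
  have [a a0 Ha] := cF _ zr e e0; have [b b0 Hb] := W4 a a0.
  have L0 : 0 < `|x| + 1 by rewrite ltr_wpDl.
  exists (b / (`|x| + 1)); first by rewrite divr_gt0.
  move=> s s0; rewrite ltr_pdivlMr// => sb.
  rewrite -ImN -ImD; apply: le_lt_trans (normc_Im _) _; apply: Ha; apply: Hb; first exact: pw.
  apply: le_lt_trans (normc_ReDIm _) _; rewrite /= normrM (gtr0_norm s0); lra.
- move=> x e e0; have zr : normc z2 <= r by rewrite r2.
  have [a a0 Ha] := cF _ zr e e0; have [b b0 Hb] := W5 a a0.
  exists b => // s sb; have s0 : 0 < s by exact: lt_trans sb.
  rewrite -ImN -ImD; apply: le_lt_trans (normc_Im _) _; apply: Ha; apply: Hb; first exact: pw.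
  by apply: lt_le_trans sb _; apply: le_trans (normc_Im _); rewrite /= ler_norm.
- move=> x0 s0 s00 e e0; have w0 := pw x0 s0 s00.
  have [a a0 Ha] := cF _ (ltW (W1 _ w0)) e e0.
  have [l Hl _] := W3 _ w0; have [b b0 Hb] := cderiv_ccont Hl a0.
  have [c c0 Hc] := polar_point_near x0 s00 b0.
  by exists c => // x s xc sc; apply: Ha; apply: Hb; exact: Hc.
- move=> x0 s0 s00; have w0 := pw x0 s0 s00.
  have [k [l [Hk Hl kpos lpos]]] := key _ w0.
  have [e e0 He] := level_local Hk Hl kpos lpos.
  have [c c0 Hc] := polar_point_near x0 s00 e0.
  exists (Num.min c s0); first by rewrite lt_min c0.
  move=> x s; rewrite !lt_min => /andP[xc _] /andP[sc ss].
  have sp : 0 < s by move: ss; rewrite ltr_norml => /andP[]; lra.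
  rewrite !FIm !FRe => E; have [h1 h2] := He _ (Hc _ _ xc sc) E.
  have w00 : polar_point x0 s0 != 0 by rewrite eq_complex /= negb_and [s0 == 0]gt_eqF// orbT.
  (* x is the cotangent of the angle of the ray: it grows as the argument decreases, which explains
     the minus sign in [level_local]. *)
  have sgn : - Im ((polar_point x s - polar_point x0 s0) / polar_point x0 s0) =
     s * s0 / normc (polar_point x0 s0) ^+ 2 * (x - x0).
    rewrite Im_div// -mulNr mulrAC; congr (_ / _).
    by rewrite !ReImE /polar_point /=; ring.
  have p0 : 0 < s * s0 / normc (polar_point x0 s0) ^+ 2.
    by apply: divr_gt0; [exact: mulr_gt0|rewrite exprn_gt0// normc_gt0].
  have ReBD (a b a' b' : R[i]) : Re (a - a') + 2 * Re (b - b') =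
      (Re a + 2 * Re b) - (Re a' + 2 * Re b') by rewrite !ReD !ReN; ring.
  rewrite sgn in h1 h2; split => hx.
    have /h1 : 0 < s * s0 / normc (polar_point x0 s0) ^+ 2 * (x - x0) by rewrite mulr_gt0// subr_gt0.
    by rewrite /comp ReBD subr_gt0.
  have /h2 : s * s0 / normc (polar_point x0 s0) ^+ 2 * (x - x0) < 0 by rewrite pmulr_rlt0// subr_lt0.
  by rewrite /comp ReBD subr_lt0.
Qed.

End ShearedDisk.

(** * The image domain and the theorem *)

Section CloseToConvex.
Context {R : realType}.
Implicit Types (z w d : R[i]) (f : R[i] -> R[i]).

(** The image is a union of images of radii, all of which contain f 0. *)
Lemma cdisk_image_connected f (r : R) : 0 < r -> (forall z, normc z <= r -> ccont f z) ->
  connected (f @` cdisk r).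
Proof.
move=> r0 cf.
have -> : f @` cdisk r = \bigcup_(z in cdisk r) ((fun t : R => f (t%:C * z)) @` `[0, 1]%classic).
  apply/seteqP; split => y.
    move=> [z zr <-]; exists z => //; exists 1; last by rewrite rmorph1 mul1r.
    by rewrite /= in_itv/= ler01 lexx.
  move=> [z /cdiskE zr [t]]; rewrite /= in_itv /= => /andP[t0 t1] <-.
  exists (t%:C * z) => //; apply/cdiskE; rewrite Normc.normcM normc_real ger0_norm//.
  by apply: le_lt_trans zr; rewrite ler_piMl// normc_ge0.
apply: bigcup_connected.
  exists (f 0) => z _; exists 0; last by rewrite rmorph0 mul0r.
  by rewrite /= in_itv/= ler01 lexx.
move=> z /cdiskE zr; apply: connected_continuous_connected; first exact: segment_connected.
apply: continuous_in_subspaceT => t; rewrite inE /= in_itv /= => /andP[t0 t1].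
have tz : normc (t%:C * z) <= r.
  rewrite Normc.normcM normc_real ger0_norm//; apply: le_trans (ltW zr).
  by rewrite ler_piMl// normc_ge0.
move=> A /nbhs_normcP[e e0 eA].
have [b b0 Hb] := cf _ tz e e0.
have L0 : 0 < normc z + 1 by rewrite ltr_wpDl ?normc_ge0.
apply/nbhs_ballP; exists (b / (normc z + 1)); first by rewrite /= divr_gt0.
move=> s; rewrite /ball /= ltr_pdivlMr// => ts; apply: eA; apply: Hb.
rewrite -mulrBl -rmorphB Normc.normcM normc_real distrC.
by apply: le_lt_trans ts; rewrite ler_wpM2l// lerDl.
Qed.

(** Multiplication by the unit d carries the image of [Phi] onto that of f, so injectivity, openness
    and the slices of the image are read off from the levels of [Phi]. *)
Lemma close_to_convex_of_levels f d (r m M : R) (W : R[i] -> R[i]) : 0 < r ->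
  d * d^*%C = 1 -> (forall z, normc z <= r -> ccont f z) ->
  (forall w, 0 < Im w -> normc (W w) < r) ->
  (forall z, normc z < r -> exists2 w, 0 < Im w & W w = z) ->
  monotone_levels (fun x s => d^*%C * f (W (polar_point x s))) m M ->
  close_to_convex_on (cdisk r) f.
Proof.
move=> r0 dd cf W1 W2; set Phi := fun x s => _ => hyp.
have d0 : d != 0 by apply/eqP => h; move: dd; rewrite h mul0r => /esym/eqP; rewrite oner_eq0.
have nd : normc d = 1.
  have := congr1 (@Normc.normc R) dd; rewrite Normc.normcM normc_conj Normc.normc1 => h1.
  by have := normc_ge0 d; nra.
have dd' : d^*%C * d = 1 by rewrite mulrC.
have [B HB] := closed_disk_bounded r0 cf.
have PhiB x s : 0 < s -> normc (Phi x s) <= B.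
  move=> s0; rewrite /Phi Normc.normcM normc_conj nd mul1r; apply: HB; apply: ltW.
  by apply: W1; rewrite /polar_point.
have param z : normc z < r -> exists x s, 0 < s /\ W (polar_point x s) = z.
  move=> /W2[w w0 <-]; exists (Re w / Im w), (Im w); split => //; congr W.
  by apply: eq_ReIm => //=; rewrite mulrC divfK// gt_eqF.
have fE x s : f (W (polar_point x s)) = d * Phi x s by rewrite /Phi mulrA dd mul1r.
have OP y : (f @` cdisk r) (d * y) <-> exists x s, 0 < s /\ Phi x s = y.
  split=> [[z /cdiskE/param[x [s [s0 <-]]]]|[x [s [s0 <-]]]].
    by rewrite fE => /(mulfI d0) <-; exists x, s.
  by exists (W (polar_point x s)); [apply/cdiskE/W1|exact: fE].
split.
  move=> z z'; rewrite !inE => /cdiskE/param[x [s [s0 <-]]] /cdiskE/param[x' [s' [s'0 <-]]].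
  by rewrite !fE => /(mulfI d0)/(Phi_inj hyp s0 s'0)[-> ->].
have mM : m < M by have /andP[h1 h2] := Im_range hyp 0 ltr01; exact: lt_trans h1 h2.
split.
- rewrite openE => _ [z /cdiskE/param[x [s [s0 <-]]] <-].
  have [e e0 He] := Phi_open hyp x PhiB s0.
  apply/nbhs_normcP; exists e => // y ye.
  have -> : y = d * (d^*%C * y) by rewrite mulrA dd mul1r.
  apply/OP/He; rewrite /Phi -mulrBr Normc.normcM normc_conj nd mul1r; exact: ye.
- exact: cdisk_image_connected.
- apply: (@halfline_cover _ _ d m M (fun c => inf (slice Phi c)) (fun c => sup (slice Phi c))) => //.
  + move=> p c /OP[x [s [s0 E]]].
    by have := Im_range hyp x s0; rewrite E.
  + by move=> c mc cM; have [] := sliceP hyp mc cM PhiB.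
  + move=> c p mc cM; have [_ HS] := sliceP hyp mc cM PhiB.
    split=> [/OP h|h]; first exact/HS.
    by apply/OP; exact: (HS p).2.
Qed.

End CloseToConvex.

Theorem theorem3p5 (R : realType) (alpha : R) (n : nat) (h g : R[i] -> R[i]) :
  - 2^-1 < alpha -> alpha < 0 -> (2 <= n)%N ->
  analytic_on (cdisk 1) h -> analytic_on (cdisk 1) g ->
  (forall z, cdisk 1 z -> derive1 h z != 0) ->
  (forall z, cdisk 1 z ->
     alpha < complex.Re (1 + z * derive1 (derive1 h) z / derive1 h z)) ->
  (forall z, cdisk 1 z -> derive1 g z = z ^+ n * derive1 h z) ->
  close_to_convex_on
    (cdisk (((1 + 2 * alpha) / (1 + 2 * n%:R + 2 * alpha)) `^ (n%:R^-1)))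
    (fun z => h z + (g z)^*).
Proof.
move=> al a0 n2 ah ag h0 hal hg.
have n20 : 2 <= n%:R :> R by rewrite (ler_nat R 2 n).
set q := (1 + 2 * alpha) / _; set r := q `^ _.
have q0 : 0 < q by rewrite divr_gt0//; lra.
have q1 : q < 1 by rewrite ltr_pdivrMr; lra.
have r0 : 0 < r by exact: powR_gt0.
have rn : r ^+ n = q.
  by rewrite -powR_mulrn ?(ltW r0)// -powRrM mulVf ?powRr1 ?(ltW q0)// gt_eqF//; lra.
have r1 : r < 1.
  rewrite ltNge; apply/negP => /(exprn_ege1 n); rewrite rn; lra.
have D z : normc z <= r -> cdisk 1 z by move=> zr; apply/cdiskE; lra.
pose H := derive1 h; pose H2 := derive1 H; pose g1 := derive1 g.
have ah' z : cdisk 1 z -> cderiv h z (H z) /\ analytic_at H z.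
  by move=> /(analytic_onP ah)/analytic_derive1.
have ag' z : cdisk 1 z -> cderiv g z (g1 z) /\ analytic_at g1 z.
  by move=> /(analytic_onP ag)/analytic_derive1.
have [phi [t1 [t2 [t12 t21 pos neg]]]] := @boundary_direction R H H2 alpha r n n2 r0 r1 al rn
  (fun z zr => h0 z (iffRL (cdiskE _ _) zr))
  (fun z zr => (analytic_derive1 (ah' z (iffRL (cdiskE _ _) zr)).2).1)
  (fun z zr => ex_intro _ _ (analytic_derive1 (analytic_derive1 (ah' z (iffRL (cdiskE _ _) zr)).2).2).1)
  (fun z zr => hal z (iffRL (cdiskE _ _) zr)).
pose d := cis phi; pose K z := d^*%C * H z + - d * g1 z.
have dd : d * d^*%C = 1 by exact: cis_conj.
have aK z : normc z <= r -> analytic_at K z.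
  by move=> /D Dz; apply: analyticD; apply: analyticZ; [exact: (ah' z Dz).2|exact: (ag' z Dz).2].
have nr t : normc (r%:C * cis t) = r.
  by rewrite Normc.normcM normc_cis mulr1 normc_real gtr0_norm.
(* Conjugating the summand d z g' leaves the real part unchanged and turns z K z into (A - conj B)
   conj d. *)
have KE t : let z := r%:C * cis t in
    Re (z * K z) = Re ((z * H z - (z ^+ n * (z * H z))^*%C) * (cis phi)^*%C).
  move=> z; rewrite /K /g1 hg; last by apply: D; rewrite nr.
  rewrite -/H -/d mulrDr mulNr mulrN (mulrCA z d) (mulrCA z (z ^+ n)) (mulrCA z).
  by move: (z ^+ n * (z * H z)) => b; move: (z * H z) => a; rewrite !ReImE; ring.
have [z12 Qpos] := @half_plane_value R K r t1 t2 r0 t12 t21 aK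
  (fun t h1 h2 => etrans (congr1 (fun x => 0 < x) (KE t)) (pos t h1 h2))
  (fun t h1 h2 => etrans (congr1 (fun x => x < 0) (KE t)) (neg t h1 h2)).
have gH z : normc z < r -> normc (g1 z) < normc (H z).
  move=> zr; have Dz := D z (ltW zr).
  rewrite /g1 hg// Normc.normcM normcX gtr_pMl ?normc_gt0 ?h0//.
  rewrite exprn_ilt1 ?normc_ge0//; first by lia.
  by lra.
have [W [W1 W2 hyp]] := sheared_disk_monotone_levels r0 dd (nr t1) (nr t2) z12
  (fun z zr => (ah' z (D z zr)).1) (fun z zr => (ag' z (D z zr)).1) gH Qpos.
have cf z : normc z <= r -> ccont (fun z => h z + (g z)^*%C) z.
  move=> /D Dz; apply: ccontD; first exact: cderiv_ccont (ah' z Dz).1.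
  by apply: ccont_conj; exact: cderiv_ccont (ag' z Dz).1.
exact: close_to_convex_of_levels r0 dd cf W1 W2 hyp.
Qed.
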